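(* There exists an outer function $f\in\mathcal{B}$ with $1/f\in H^\infty$ such that the set of all weak-star sequential limits in $\mathcal{B}$ of functions of the form $fQ$, with $Q$ an analytic polynomial, is a proper subspace of $\mathcal{B}$.
   Context: $\mathcal{B}$ is the Bloch space of analytic $f$ on $\mathbb{D}$ with $|f(0)|+\sup_z(1-|z|)|f'(z)|<\infty$, identified with the dual of $W^1=\{g \text{ analytic}: |g(0)|+\int_{\mathbb{D}}|g'|dA<\infty\}$ via the pairing $\lim_{r\to1^-}\int_{\partial\mathbb{D}}f(r\zeta)\overline{g(r\zeta)}dm(\zeta)$, with the corresponding weak-star topology. $H^\infty$ is the space of bounded analytic functions on $\mathbb{D}$. *)

(* Defs.v *)
From HB Require Import structures.
From mathcomp Require Import all_boot all_order all_algebra.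
From mathcomp Require Import all_classical all_reals all_analysis.
From mathcomp Require Import complex.

Set Implicit Arguments.
Unset Strict Implicit.
Unset Printing Implicit Defensive.

Import Order.TTheory GRing.Theory Num.Theory.
Import numFieldNormedType.Exports.

Local Open Scope classical_set_scope.
Local Open Scope ring_scope.
Local Open Scope complex_scope.

Section Defs.
Variable R : realType.
Local Notation C := R[i].

Definition cabs (z : C) : R := ComplexField.Normc.normc z.

Definition in_disc (z : C) : Prop := cabs z < 1.

Definition cexp (w : C) : C :=
  (expR (complex.Re w) * cos (complex.Im w)) +i* (expR (complex.Re w) * sin (complex.Im w)).

Definition eit (t : R) : C := cos t +i* sin t.

Definition is_cderiv (f : C -> C) (z d : C) : Prop :=
  forall e : R, 0 < e -> exists2 del : R, 0 < del &
    forall h : C, h != 0 -> cabs h < del ->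
      cabs ((f (z + h) - f z) / h - d) < e.

Definition analytic_disc (f : C -> C) : Prop :=
  forall z, in_disc z -> exists d, is_cderiv f z d.

Definition Hinf (f : C -> C) : Prop :=
  analytic_disc f /\ exists M : R, forall z, in_disc z -> cabs (f z) <= M.

Definition bloch (f : C -> C) : Prop :=
  exists fd : C -> C, (forall z, in_disc z -> is_cderiv f z (fd z)) /\
    exists M : R, forall z, in_disc z -> (1 - cabs z) * cabs (fd z) <= M.

(* W^1: |g(0)| + int_D |g'| dA < oo  (dA area measure; the normalising
   constant 1/pi is irrelevant for finiteness) *)
Definition W1 (g : C -> C) : Prop :=
  exists gd : C -> C, (forall z, in_disc z -> is_cderiv g z (gd z)) /\
    (\int[(@lebesgue_measure R \x @lebesgue_measure R)%E]_(p in
        [set p : R * R | (p.1 ^+ 2 + p.2 ^+ 2 < 1)%R])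
        (cabs (gd (p.1 +i* p.2)))%:E < +oo)%E.

Definition circle_int (F : R -> C) : C :=
  ((Rintegral (@lebesgue_measure R) `[0, 2 * pi] (fun t => complex.Re (F t)))
   +i* (Rintegral (@lebesgue_measure R) `[0, 2 * pi] (fun t => complex.Im (F t))))
  / (2 * pi)%:C.

Definition pairing_to (f g : C -> C) (l : C) : Prop :=
  let P := fun r : R =>
    circle_int (fun t => f (r%:C * eit t) * conjc (g (r%:C * eit t))) in
  (complex.Re (P r) @[r --> (1 : R)^'-] --> complex.Re l) /\
  (complex.Im (P r) @[r --> (1 : R)^'-] --> complex.Im l).

(* weak-star convergence in B = (W^1)^* of a sequence F_n to h *)
Definition wstar_cvg (F : nat -> C -> C) (h : C -> C) : Prop :=
  forall g, W1 g ->
    exists (l : nat -> C) (L : C),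
      (forall n, pairing_to (F n) g (l n)) /\ pairing_to h g L /\
      (complex.Re (l n) @[n --> \oo] --> complex.Re L) /\ (complex.Im (l n) @[n --> \oo] --> complex.Im L).

(* outer function: f(z) = c exp( int_{dD} (zeta+z)/(zeta-z) log psi(zeta) dm(zeta) )
   with |c| = 1 and log psi integrable; u stands for log psi *)
Definition outer (f : C -> C) : Prop :=
  exists (c : C) (u : R -> R),
    cabs c = 1 /\
    (@lebesgue_measure R).-integrable `[0, 2 * pi] (fun t => (u t)%:E) /\
    forall z, in_disc z ->
      f z = c * cexp (circle_int (fun t => (eit t + z) / (eit t - z) * (u t)%:C)).

Definition wstar_poly_limits (f : C -> C) (h : C -> C) : Prop :=
  bloch h /\ exists Q : nat -> {poly C},
    wstar_cvg (fun n z => f z * (Q n).[z]) h.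

End Defs.

(* Main.v *)
Require Import Defs.
From HB Require Import structures.
From mathcomp Require Import all_boot all_order all_algebra.
From mathcomp Require Import all_classical all_reals all_analysis.
From mathcomp Require Import complex ring lra measurable_realfun.
Import Order.TTheory GRing.Theory Num.Theory.
Import numFieldNormedType.Exports.

Set Implicit Arguments.
Unset Strict Implicit.
Unset Printing Implicit Defensive.
Local Open Scope classical_set_scope.
Local Open Scope ring_scope.
Local Open Scope complex_scope.

(* If f Q_n -> h weak-star, then f Q_n is bounded in the Bloch space.  Hence, if
   (1 - |z|) |f'(z)| >= c at points z that accumulate at every point of the
   circle, all the polynomials Q_n are bounded by K / c on the circle: near the
   boundary Q_n is constant at the scale where f still oscillates.  By the
   maximum principle h / f is then bounded, so that h is bounded when f is, and
   no unbounded Bloch function is a sequential limit.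

   Take f = exp S, where S is the Schwarz integral of the indicator function of
   a measurable set E, so that f is outer and 1 <= |f| <= e.  Oscillation near
   every boundary point is obtained by making E look like a half-line at a
   sequence of scales: on the k-th arc E is the right half of that arc, except on
   the later arcs, which are much shorter and are centered at a dense set.

   Boundedness in the Bloch space is proved by testing against
   sum_j c_j (1 - |w_j|) (1 - conj(w_j) z)^(-2) with 0 <= c_j <= 4^(-j), which is
   in W^1, the pairing with each summand being a Cauchy formula.  The unbounded
   Bloch function is the Schwarz integral of the indicator function of a
   half-circle. *)

(** Weak-star convergence is only convergence of each pairing with a function of [W1], so the bound
    on f Q_n needs a uniform boundedness argument. It uses one test series. If functions number n_i
    had bounds K_i growing faster than 4^i, nearly attained at w_i, choose c_i in turn as 0 or
    4^(-i) so that the partial sum up to i, paired with function n_i, is at least 9/20 of K_i / 4^i.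
    The tail is at most a third of K_i / 4^i; this is what the ratio 4 is for. How function n_i
    behaves at the earlier points does not matter.

    S' at height h_k above the center of the k-th arc is of size 1 / h_k, since the jump of the
    indicator function is at distance h_k. The part of the circle off the arc contributes at most an
    amount fixed by the arc length, negligible against 1 / h_k for small h_k. The later arcs have
    total measure a small multiple of h_k, against a kernel of size at most h_k^(-2). Hence the
    order of the choices: an arc, its height, the next arc. Every center recurs, so that for a fixed
    Q the terms free of f' can be removed at a fixed rational angle by letting the height tend to
    0. *)

(** * The real-valued modulus on the complex numbers *)

Section ComplexModulus.
Context {R : realType}.
Local Notation C := R[i].
Implicit Types (z w : C) (x : R).

Lemma cabsE z : cabs z = Num.sqrt (complex.Re z ^+ 2 + complex.Im z ^+ 2).
Proof. by case: z. Qed.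

Lemma cabs_ge0 z : 0 <= cabs z.
Proof. by rewrite cabsE sqrtr_ge0. Qed.

Lemma cabs_sqr z : cabs z ^+ 2 = complex.Re z ^+ 2 + complex.Im z ^+ 2.
Proof. by rewrite cabsE sqr_sqrtr// addr_ge0 ?sqr_ge0. Qed.

Lemma cabs0 : cabs (0 : C) = 0.
Proof. exact: ComplexField.Normc.normc0. Qed.

Lemma cabs1 : cabs (1 : C) = 1.
Proof. exact: ComplexField.Normc.normc1. Qed.

Lemma cabsM z w : cabs (z * w) = cabs z * cabs w.
Proof. exact: ComplexField.Normc.normcM. Qed.

Lemma cabsV z : cabs z^-1 = (cabs z)^-1.
Proof. exact: ComplexField.Normc.normcV. Qed.

Lemma cabsf z w : cabs (z / w) = cabs z / cabs w.
Proof. by rewrite cabsM cabsV. Qed.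

Lemma cabsX z n : cabs (z ^+ n) = cabs z ^+ n.
Proof. by elim: n => [|n IH]; rewrite ?expr0 ?cabs1// !exprS cabsM IH. Qed.

Lemma cabsN z : cabs (- z) = cabs z.
Proof. exact: normcN. Qed.

Lemma cabsD z w : cabs (z + w) <= cabs z + cabs w.
Proof. exact: le_normcD. Qed.

Lemma cabsB z w : cabs (z - w) <= cabs z + cabs w.
Proof. by rewrite -(cabsN w) cabsD. Qed.

Lemma cabs_distC z w : cabs (z - w) = cabs (w - z).
Proof. by rewrite -cabsN opprB. Qed.

Lemma cabs_dist z w : cabs z - cabs w <= cabs (z - w).
Proof. by rewrite lerBlDr -[X in cabs X <= _](subrK w) cabsD. Qed.

Lemma cabs_eq0 z : (cabs z == 0) = (z == 0).
Proof.
by apply/eqP/eqP => [/ComplexField.Normc.eq0_normc//|->]; rewrite cabs0.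
Qed.

Lemma cabs_gt0 z : (0 < cabs z) = (z != 0).
Proof. by rewrite lt_def cabs_eq0 cabs_ge0 andbT. Qed.

Lemma cabs_real x : cabs x%:C = `|x|.
Proof. by rewrite cabsE/= expr0n addr0 sqrtr_sqr. Qed.

Lemma cabs2 : cabs (2 : C) = 2.
Proof. by rewrite (_ : (2 : C) = (2 : R)%:C) ?cabs_real ?ger0_norm// rmorph_nat. Qed.

Lemma cabs_conj z : cabs (conjc z) = cabs z.
Proof. by case: z => a b; rewrite !cabsE/= sqrrN. Qed.

Lemma norm_Re_le z : `|complex.Re z| <= cabs z.
Proof. by rewrite cabsE -sqrtr_sqr ler_wsqrtr// lerDl sqr_ge0. Qed.

Lemma norm_Im_le z : `|complex.Im z| <= cabs z.
Proof. by rewrite cabsE -sqrtr_sqr ler_wsqrtr// lerDr sqr_ge0. Qed.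

Lemma Re_le z : complex.Re z <= cabs z.
Proof. by apply: le_trans (norm_Re_le z); exact: ler_norm. Qed.

Lemma cabs_le_ReIm z : cabs z <= `|complex.Re z| + `|complex.Im z|.
Proof.
rewrite -[leRHS]ger0_norm ?addr_ge0// -sqrtr_sqr cabsE ler_wsqrtr// sqrrD.
rewrite !real_normK ?num_real// [leRHS]addrAC lerDl.
by rewrite mulrn_wge0// mulr_ge0.
Qed.

Lemma cabs_sum n (F : nat -> C) :
  cabs (\sum_(i < n) F i) <= \sum_(i < n) cabs (F i).
Proof.
elim: n => [|n IH]; first by rewrite !big_ord0 cabs0.
by rewrite !big_ord_recr/= (le_trans (cabsD _ _))// lerD2r.
Qed.

Lemma cReD z w : complex.Re (z + w) = complex.Re z + complex.Re w.
Proof. by case: z; case: w. Qed.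

Lemma cImD z w : complex.Im (z + w) = complex.Im z + complex.Im w.
Proof. by case: z; case: w. Qed.

Lemma cReN z : complex.Re (- z) = - complex.Re z.
Proof. by case: z. Qed.

Lemma cImN z : complex.Im (- z) = - complex.Im z.
Proof. by case: z. Qed.

Lemma cReM z w : complex.Re (z * w) =
  complex.Re z * complex.Re w - complex.Im z * complex.Im w.
Proof. by case: z; case: w. Qed.

Lemma cImM z w : complex.Im (z * w) =
  complex.Re z * complex.Im w + complex.Im z * complex.Re w.
Proof. by case: z => a b; case: w => c d; rewrite /= addrC. Qed.

Lemma complex_ext z w :
  complex.Re z = complex.Re w -> complex.Im z = complex.Im w -> z = w.
Proof. by case: z; case: w => /= ? ? ? ? -> ->. Qed.

Lemma cReV z : complex.Re z^-1 = complex.Re z / cabs z ^+ 2.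
Proof. by rewrite cabs_sqr; case: z. Qed.

Lemma cImV z : complex.Im z^-1 = - complex.Im z / cabs z ^+ 2.
Proof. by rewrite cabs_sqr; case: z => a b /=; rewrite mulNr. Qed.

Lemma mul_conj z : z * conjc z = (cabs z ^+ 2)%:C.
Proof.
rewrite cabs_sqr; case: z => a b /=; apply: complex_ext => /=; ring.
Qed.

End ComplexModulus.

(** * Calculus of the complex derivative *)

Section ComplexDerivative.
Context {R : realType}.
Local Notation C := R[i].
Implicit Types (z w d : C) (f g : C -> C).

(** Without division, h = 0 is allowed; this matters in the chain rule, where the increment of the
    inner function may vanish. *)
Lemma is_cderivP f z d : is_cderiv f z d <->
  forall e : R, 0 < e -> exists2 del : R, 0 < del &
    forall h : C, cabs h < del ->
      cabs (f (z + h) - f z - d * h) <= e * cabs h.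
Proof.
split=> H e e0.
  have [del del0 Hd] := H e e0; exists del => // h hd.
  have [->|h0] := eqVneq h 0.
    by rewrite addr0 subrr mulr0 subr0 cabs0 mulr0.
  rewrite (_ : _ - _ = ((f (z + h) - f z) / h - d) * h); last by field.
  by rewrite cabsM ler_wpM2r ?cabs_ge0// ltW// Hd.
have e20 : 0 < e / 2 by lra.
have [del del0 Hd] := H _ e20; exists del => // h h0 hd.
rewrite (_ : _ - _ = (f (z + h) - f z - d * h) / h); last by field.
rewrite cabsf ltr_pdivrMr ?cabs_gt0//; apply: (le_lt_trans (Hd _ hd)).
by rewrite ltr_pM2r ?cabs_gt0//; lra.
Qed.

(** Kernels, Cauchy integrals and the test series are all differentiated through a second-order
    Taylor bound: when uniform in a parameter, such a bound passes through integrals and sums. *)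
Lemma is_cderiv_quadratic f z d (M r : R) : 0 < r ->
  (forall h, cabs h < r -> cabs (f (z + h) - f z - d * h) <= M * cabs h ^+ 2) ->
  is_cderiv f z d.
Proof.
move=> r0 H; apply/is_cderivP => e e0.
pose M' := `|M| + 1.
have M'0 : 0 < M' by rewrite /M'; have := normr_ge0 M; lra.
exists (Num.min r (e / M')); first by rewrite lt_min r0 divr_gt0.
move=> h; rewrite lt_min => /andP[hr he].
apply: (le_trans (H _ hr)); rewrite expr2 mulrA ler_wpM2r ?cabs_ge0//.
apply: (@le_trans _ _ (M' * cabs h)).
  by rewrite ler_wpM2r ?cabs_ge0// /M'; have := ler_norm M; lra.
by rewrite mulrC -ler_pdivlMr// ltW.
Qed.

Lemma is_cderiv_continuous f z d : is_cderiv f z d ->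
  forall e : R, 0 < e -> exists2 del : R, 0 < del &
    forall h : C, cabs h < del -> cabs (f (z + h) - f z) <= e.
Proof.
move=> /is_cderivP H e e0.
have [del del0 Hd] := H 1 ltr01.
have p0 : 0 < 1 + cabs d by have := cabs_ge0 d; lra.
exists (Num.min del (e / (1 + cabs d))); first by rewrite lt_min del0 divr_gt0.
move=> h; rewrite lt_min => /andP[/Hd h1 h2].
rewrite -(subrK (d * h) (f (z + h) - f z)); apply: (le_trans (cabsD _ _)).
rewrite cabsM; apply: (@le_trans _ _ ((1 + cabs d) * cabs h)).
  by rewrite mulrDl lerD2r.
by rewrite mulrC -ler_pdivlMr// ltW.
Qed.

Lemma is_cderiv_cst (c z : C) : is_cderiv (fun=> c) z 0.
Proof.
apply/is_cderivP => e e0; exists 1 => // h _.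
by rewrite subrr mul0r subr0 cabs0 mulr_ge0 ?cabs_ge0// ltW.
Qed.

Lemma is_cderiv_id z : is_cderiv id z 1.
Proof.
apply/is_cderivP => e e0; exists 1 => // h _.
by rewrite /= mul1r [z + h]addrC addrK subrr cabs0 mulr_ge0 ?cabs_ge0// ltW.
Qed.

Lemma is_cderivD f g z a b : is_cderiv f z a -> is_cderiv g z b ->
  is_cderiv (fun x => f x + g x) z (a + b).
Proof.
move=> /is_cderivP Hf /is_cderivP Hg; apply/is_cderivP => e e0.
have e20 : 0 < e / 2 by lra.
have [d1 d10 H1] := Hf _ e20; have [d2 d20 H2] := Hg _ e20.
exists (Num.min d1 d2); first by rewrite lt_min d10.
move=> h; rewrite lt_min => /andP[/H1 h1 /H2 h2].
rewrite (_ : _ - _ = (f (z + h) - f z - a * h) + (g (z + h) - g z - b * h));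
  last by ring.
by apply: (le_trans (cabsD _ _)); lra.
Qed.

Lemma is_cderivM f g z a b : is_cderiv f z a -> is_cderiv g z b ->
  is_cderiv (fun x => f x * g x) z (a * g z + f z * b).
Proof.
move=> Hf Hg; apply/is_cderivP => e e0.
have /is_cderivP Hf' := Hf; have /is_cderivP Hg' := Hg.
pose K := cabs (f z) + cabs (g z) + cabs b + 2.
have K0 : 0 < K.
  by rewrite /K; have := cabs_ge0 (f z); have := cabs_ge0 (g z);
     have := cabs_ge0 b; lra.
have eK : 0 < e / (2 * K) by rewrite divr_gt0// mulr_gt0.
pose e' := Num.min 1 (e / (2 * K)).
have e'0 : 0 < e' by rewrite lt_min ltr01.
have [d1 d10 H1] := Hf' _ e'0; have [d2 d20 H2] := Hg' _ e'0.
have [d3 d30 H3] := is_cderiv_continuous Hf e'0.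
exists (Num.min d1 (Num.min d2 d3)); first by rewrite !lt_min d10 d20.
move=> h; rewrite !lt_min => /and3P[/H1 h1 /H2 h2 /H3 h3].
rewrite (_ : _ - _ = (f (z + h) - f z - a * h) * g z +
  f (z + h) * (g (z + h) - g z - b * h) + (f (z + h) - f z) * (b * h));
  last by ring.
have e'1 : e' <= 1 by rewrite ge_min lexx.
have e'K : e' <= e / (2 * K) by rewrite ge_min lexx orbT.
have ch := cabs_ge0 h.
have fzh : cabs (f (z + h)) <= cabs (f z) + 1.
  by rewrite -(subrK (f z) (f (z + h))); apply: (le_trans (cabsD _ _)); lra.
apply: (le_trans (cabsD _ _)); rewrite cabsM.
apply: (@le_trans _ _ (e' * cabs h * cabs (g z) +
   (cabs (f z) + 1) * (e' * cabs h) + e' * (cabs b * cabs h))).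
  rewrite lerD//.
    apply: (le_trans (cabsD _ _)); rewrite !cabsM lerD//.
      by rewrite ler_wpM2r ?cabs_ge0.
    by rewrite ler_pM ?cabs_ge0.
  by rewrite cabsM ler_wpM2r// mulr_ge0 ?cabs_ge0.
rewrite (_ : _ + _ = e' * (K - 1) * cabs h); last by rewrite /K; ring.
rewrite ler_wpM2r//; apply: (@le_trans _ _ (e / (2 * K) * K)).
  by apply: ler_pM => //; rewrite ?(ltW e'0)// /K;
    have := cabs_ge0 (f z); have := cabs_ge0 (g z); have := cabs_ge0 b; lra.
rewrite (_ : e / _ * _ = e / 2); first by lra.
by field; rewrite gt_eqF.
Qed.

Lemma is_cderiv_scale (c : C) f z a : is_cderiv f z a ->
  is_cderiv (fun x => c * f x) z (c * a).
Proof.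
move=> Hf; have := is_cderivM (is_cderiv_cst c z) Hf.
by rewrite mul0r add0r.
Qed.

Lemma is_cderiv_comp f g z a b : is_cderiv f z a -> is_cderiv g (f z) b ->
  is_cderiv (fun x => g (f x)) z (b * a).
Proof.
move=> Hf /is_cderivP Hg; apply/is_cderivP => e e0.
have /is_cderivP Hf' := Hf.
pose K := cabs a + cabs b + 1.
have K0 : 0 < K by rewrite /K; have := cabs_ge0 a; have := cabs_ge0 b; lra.
pose e' := Num.min 1 (e / (2 * K)).
have e'0 : 0 < e' by rewrite lt_min ltr01 divr_gt0// mulr_gt0.
have [d1 d10 H1] := Hg _ e'0.
have [d2 d20 H2] := Hf' _ e'0.
have d12 : 0 < d1 / 2 by lra.
have [d3 d30 H3] := is_cderiv_continuous Hf d12.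
exists (Num.min d2 d3); first by rewrite lt_min d20.
move=> h; rewrite lt_min => /andP[/H2 h2 /H3 h3].
set k := f (z + h) - f z in h2 h3.
have /H1 h1 : cabs k < d1 by lra.
have ch := cabs_ge0 h.
have e'1 : e' <= 1 by rewrite ge_min lexx.
have e'K : e' <= e / (2 * K) by rewrite ge_min lexx orbT.
have kh : cabs k <= (cabs a + 1) * cabs h.
  rewrite -(subrK (a * h) k); apply: (le_trans (cabsD _ _)).
  rewrite cabsM mulrDl mul1r addrC lerD2l (le_trans h2)//.
  by rewrite -[leRHS]mul1r ler_wpM2r.
rewrite (_ : f (z + h) = f z + k); last by rewrite /k; ring.
rewrite (_ : _ - _ = (g (f z + k) - g (f z) - b * k) + b * (k - a * h));
  last by ring.
apply: (le_trans (cabsD _ _)); rewrite cabsM.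
apply: (@le_trans _ _ (e' * ((cabs a + 1) * cabs h) + cabs b * (e' * cabs h))).
  rewrite lerD//; last by rewrite ler_wpM2l ?cabs_ge0.
  by rewrite (le_trans h1)// ler_wpM2l// ltW.
rewrite (_ : _ + _ = e' * K * cabs h); last by rewrite /K; ring.
rewrite ler_wpM2r//; apply: (@le_trans _ _ (e / (2 * K) * K)).
  by rewrite ler_wpM2r// ltW.
rewrite (_ : e / _ * _ = e / 2); first by lra.
by field; rewrite gt_eqF.
Qed.

Lemma is_cderiv_horner (p : {poly C}) z :
  is_cderiv (fun x => p.[x]) z (p^`()).[z].
Proof.
elim/poly_ind: p => [|p c IH].
  rewrite deriv0 horner0 (_ : (fun _ => _) = fun=> 0); first exact: is_cderiv_cst.
  by apply/funext => x; rewrite horner0.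
rewrite (_ : (fun x => _) = fun x => p.[x] * x + c); last first.
  by apply/funext => x; rewrite hornerMXaddC.
rewrite derivMXaddC hornerD hornerM hornerX.
rewrite (_ : _ + _ = ((p^`()).[z] * z + p.[z] * 1) + 0); last by ring.
by apply: is_cderivD (is_cderiv_cst _ _); exact: is_cderivM IH (is_cderiv_id z).
Qed.

Lemma is_cderiv_unique f z a b : is_cderiv f z a -> is_cderiv f z b -> a = b.
Proof.
move=> /is_cderivP Ha /is_cderivP Hb; apply/eqP; rewrite -subr_eq0 -cabs_eq0.
apply/negPn/negP => ab.
have {}ab : 0 < cabs (a - b) by rewrite lt_def ab cabs_ge0.
have e0 : 0 < cabs (a - b) / 4 by lra.
have [d1 d10 H1] := Ha _ e0; have [d2 d20 H2] := Hb _ e0.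
pose x := Num.min d1 d2 / 2.
have m0 : 0 < Num.min d1 d2 by rewrite lt_min d10.
have x0 : 0 < x by rewrite /x; lra.
have cx : cabs x%:C = x by rewrite cabs_real gtr0_norm.
have m1 : Num.min d1 d2 <= d1 by rewrite ge_min lexx.
have m2 : Num.min d1 d2 <= d2 by rewrite ge_min lexx orbT.
have x1 : cabs x%:C < d1 by rewrite cx /x; lra.
have x2 : cabs x%:C < d2 by rewrite cx /x; lra.
have h1 := H1 _ x1; have h2 := H2 _ x2; rewrite cx in h1 h2.
have : cabs ((a - b) * x%:C) <= cabs (a - b) / 4 * x + cabs (a - b) / 4 * x.
  rewrite (_ : _ * _ = (f (z + x%:C) - f z - b * x%:C) -
     (f (z + x%:C) - f z - a * x%:C)); last by ring.
  by apply: (le_trans (cabsB _ _)); exact: lerD.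
by rewrite cabsM cx; have := mulr_gt0 ab x0; lra.
Qed.

End ComplexDerivative.

(** * Complex curves over a real parameter, and integrals over the circle *)

Section CurvesAndCircleIntegrals.
Context {R : realType}.
Local Notation C := R[i].
Local Notation mu := (@lebesgue_measure R).
Local Notation I := (`[0, 2 * pi]%classic : set R).
Implicit Types (f g : R -> R) (F G : R -> C) (z w : C).

(** Translates between the epsilon form used for complex curves and [is_derive], so that the mean
    value theorem, the fundamental theorem and differentiation under the integral apply to real and
    imaginary parts. *)
Lemma is_derive_eps f (t d : R) : is_derive t 1 f d <->
  forall e : R, 0 < e -> exists2 del : R, 0 < del &
    forall h : R, `|h| < del -> `|f (t + h) - f t - d * h| <= e * `|h|.
Proof.
split=> [[/cvg_ex[l /= fl] fd] e e0|H].
  have ld : l = d by rewrite -fd /derive; apply/esym/cvg_lim.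
  subst l.
  move/cvgrPdist_le : fl => /(_ _ e0)[del /= del0 Hd].
  exists del => // h hd; have [->|h0] := eqVneq h 0.
    by rewrite addr0 subrr mulr0 subr0 !normr0 mulr0.
  have := Hd h; rewrite /ball_/= sub0r normrN => /(_ hd h0).
  rewrite scaler1 /GRing.scale/= distrC => Hh.
  rewrite (_ : _ - _ = (h^-1 * (f (h + t) - f t) - d) * h).
    by rewrite normrM ler_wpM2r.
  by rewrite addrC [h + t]addrC; field.
suff fl : h^-1 *: (f (h *: (1:R^o) + t) - f t) @[h --> 0^'] --> d.
  by split; [apply/cvg_ex; exists d|exact/cvg_lim].
apply/cvgrPdist_le => e e0; have [del del0 Hd] := H _ e0.
exists del => //= h; rewrite /ball_/= sub0r normrN => /Hd hd h0.
rewrite scaler1 /GRing.scale/= distrC.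
rewrite (_ : _ - _ = (f (t + h) - f t - d * h) / h).
  by rewrite normrM normfV ler_pdivrMr ?normr_gt0.
by rewrite [h + t]addrC; field.
Qed.

Definition is_rderiv F (t : R) (d : C) : Prop :=
  forall e : R, 0 < e -> exists2 del : R, 0 < del &
    forall h : R, `|h| < del ->
      cabs (F (t + h) - F t - d * h%:C) <= e * `|h|.

Lemma is_rderivP F t d : is_rderiv F t d <->
  is_derive t 1 (fun s => complex.Re (F s)) (complex.Re d) /\
  is_derive t 1 (fun s => complex.Im (F s)) (complex.Im d).
Proof.
have reE (h : R) : complex.Re (F (t + h) - F t - d * h%:C) =
    complex.Re (F (t + h)) - complex.Re (F t) - complex.Re d * h.
  by rewrite !(cReD, cReN, cReM)/= mulr0 subr0.
have imE (h : R) : complex.Im (F (t + h) - F t - d * h%:C) =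
    complex.Im (F (t + h)) - complex.Im (F t) - complex.Im d * h.
  by rewrite !(cImD, cImN, cImM)/= mulr0 add0r.
split=> [H|[/is_derive_eps H1 /is_derive_eps H2] e e0].
  by split; apply/is_derive_eps => e e0; have [del del0 Hd] := H _ e0;
    exists del => // h /Hd; apply: le_trans; rewrite -?reE -?imE
      ?norm_Re_le ?norm_Im_le.
have e20 : 0 < e / 2 by lra.
have [d1 d10 h1] := H1 _ e20; have [d2 d20 h2] := H2 _ e20.
exists (Num.min d1 d2); first by rewrite lt_min d10.
move=> h; rewrite lt_min => /andP[/h1 {}h1 /h2 {}h2].
by apply: (le_trans (cabs_le_ReIm _)); rewrite reE imE; lra.
Qed.

Lemma is_rderiv_comp (P : C -> C) F t D d :
  is_cderiv P (F t) D -> is_rderiv F t d -> is_rderiv (fun s => P (F s)) t (D * d).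
Proof.
move=> /is_cderivP HP HF e e0.
pose K := cabs d + cabs D + 1.
have K0 : 0 < K by rewrite /K; have := cabs_ge0 d; have := cabs_ge0 D; lra.
pose e' := Num.min 1 (e / (2 * K)).
have e'0 : 0 < e' by rewrite lt_min ltr01 divr_gt0// mulr_gt0.
have [d1 d10 H1] := HP _ e'0.
have [d2 d20 H2] := HF _ e'0.
have p0 : 0 < cabs d + 1 by have := cabs_ge0 d; lra.
exists (Num.min d2 (d1 / (cabs d + 1))); first by rewrite lt_min d20 divr_gt0.
move=> h; rewrite lt_min => /andP[/H2 h2]; rewrite ltr_pdivlMr// => h3.
set k := F (t + h) - F t in h2.
have e'1 : e' <= 1 by rewrite ge_min lexx.
have e'K : e' <= e / (2 * K) by rewrite ge_min lexx orbT.
have nh := normr_ge0 h.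
have kh : cabs k <= (cabs d + 1) * `|h|.
  rewrite -(subrK (d * h%:C) k); apply: (le_trans (cabsD _ _)).
  rewrite cabsM cabs_real mulrDl mul1r addrC lerD2l (le_trans h2)//.
  by rewrite -[leRHS]mul1r ler_wpM2r.
have /H1 h1 : cabs k < d1 by apply: (le_lt_trans kh); rewrite mulrC.
rewrite (_ : F (t + h) = F t + k); last by rewrite /k; ring.
rewrite (_ : _ - _ = (P (F t + k) - P (F t) - D * k) + D * (k - d * h%:C));
  last by ring.
apply: (le_trans (cabsD _ _)); rewrite cabsM.
apply: (@le_trans _ _ (e' * ((cabs d + 1) * `|h|) + cabs D * (e' * `|h|))).
  rewrite lerD//; last by rewrite ler_wpM2l ?cabs_ge0.
  by rewrite (le_trans h1)// ler_wpM2l// ltW.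
rewrite (_ : _ + _ = e' * K * `|h|); last by rewrite /K; ring.
rewrite ler_wpM2r//; apply: (@le_trans _ _ (e / (2 * K) * K)).
  by rewrite ler_wpM2r// ltW.
rewrite (_ : e / _ * _ = e / 2); first by lra.
by field; rewrite gt_eqF.
Qed.

Lemma is_rderiv_eit t : is_rderiv (@eit R) t ('i * eit t).
Proof.
apply/is_rderivP; rewrite /eit/=; split.
  by rewrite mul0r mul1r sub0r; exact: is_derive_cos.
by rewrite mul0r mul1r add0r; exact: is_derive_sin.
Qed.

Lemma is_rderiv_affine (a b : C) F t d : is_rderiv F t d ->
  is_rderiv (fun s => a + b * F s) t (b * d).
Proof.
move=> HF; apply: (@is_rderiv_comp (fun x => a + b * x)) => //.
rewrite -[b]add0r; apply: is_cderivD (is_cderiv_cst _ _) _.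
rewrite add0r -[X in is_cderiv _ _ X]mulr1.
by apply: is_cderiv_scale; exact: is_cderiv_id.
Qed.

(** By parts, because [circle_int] integrates the two parts separately. *)
Definition ccont F := continuous (fun t => complex.Re (F t)) /\
  continuous (fun t => complex.Im (F t)).

Lemma ccontP F : ccont F <-> forall t (e : R), 0 < e ->
  exists2 del : R, 0 < del & forall s, `|t - s| < del -> cabs (F t - F s) <= e.
Proof.
split=> [[c1 c2] t e e0|H].
  have e20 : 0 < e / 2 by lra.
  have /cvgrPdist_le/(_ _ e20)[d1 /= d10 h1] := c1 t.
  have /cvgrPdist_le/(_ _ e20)[d2 /= d20 h2] := c2 t.
  exists (Num.min d1 d2); first by rewrite lt_min d10.
  move=> s; rewrite lt_min => /andP[/h1 {}h1 /h2 {}h2].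
  by apply: (le_trans (cabs_le_ReIm _)); rewrite !(cReD, cReN, cImD, cImN); lra.
by split=> t; apply/cvgrPdist_le => e e0; have [del del0 Hd] := H t e e0;
  exists del => //= s /Hd; apply: le_trans; rewrite -?cReN -?cImN -?cReD -?cImD
      ?norm_Re_le ?norm_Im_le.
Qed.

Lemma ccont_cst z : ccont (fun=> z).
Proof. by split=> t; exact: cvg_cst. Qed.

Lemma ccont_eit : ccont (@eit R).
Proof. by split; [exact: continuous_cos|exact: continuous_sin]. Qed.

Lemma ccontD F G : ccont F -> ccont G -> ccont (fun t => F t + G t).
Proof.
move=> [f1 f2] [g1 g2]; split=> t.
  under eq_fun do rewrite cReD.
  by apply: cvgD; [exact: f1|exact: g1].
under eq_fun do rewrite cImD.
by apply: cvgD; [exact: f2|exact: g2].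
Qed.

Lemma ccontM F G : ccont F -> ccont G -> ccont (fun t => F t * G t).
Proof.
move=> [f1 f2] [g1 g2]; split=> t.
  under eq_fun do rewrite cReM.
  by apply: cvgB; apply: cvgM; [exact: f1|exact: g1|exact: f2|exact: g2].
under eq_fun do rewrite cImM.
by apply: cvgD; apply: cvgM; [exact: f1|exact: g2|exact: f2|exact: g1].
Qed.

Lemma ccontX F n : ccont F -> ccont (fun t => F t ^+ n).
Proof.
move=> cF; elim: n => [|n IH]; first exact: ccont_cst.
by under eq_fun do rewrite exprS; exact: ccontM.
Qed.

Lemma ccontN F : ccont F -> ccont (fun t => - F t).
Proof.
move=> cF; rewrite (_ : (fun t => _) = fun t => -1 * F t).
  exact: ccontM (ccont_cst _) cF.
by apply/funext => t; rewrite mulN1r.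
Qed.

Lemma ccont_conj F : ccont F -> ccont (fun t => conjc (F t)).
Proof.
move=> [f1 f2]; split=> t.
  rewrite (_ : (fun t => _) = fun t => complex.Re (F t)).
    exact: f1.
  by apply/funext => s; case: (F s).
rewrite (_ : (fun t => _) = fun t => - complex.Im (F t)).
  by apply: cvgN; exact: f2.
by apply/funext => s; case: (F s).
Qed.

Lemma ccontV F : ccont F -> (forall t, F t != 0) -> ccont (fun t => (F t)^-1).
Proof.
move=> cF F0; have [f1 f2] := cF.
have cn : continuous (fun t => cabs (F t) ^+ 2).
  move=> t; under eq_fun do rewrite cabs_sqr !expr2.
  by apply: cvgD; apply: cvgM; (exact: f1 || exact: f2).
have n0 t : cabs (F t) ^+ 2 != 0 by rewrite expf_neq0// cabs_eq0.
split=> t.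
  under eq_fun do rewrite cReV.
  by apply: cvgM; [exact: f1|apply: cvgV => //; exact: cn].
under eq_fun do rewrite cImV.
by apply: cvgM; [apply: cvgN; exact: f2|apply: cvgV => //; exact: cn].
Qed.

Lemma ccont_comp (P : C -> C) F :
  (forall t (e : R), 0 < e -> exists2 del : R, 0 < del & forall h, cabs h < del ->
    cabs (P (F t + h) - P (F t)) <= e) ->
  ccont F -> ccont (fun t => P (F t)).
Proof.
move=> HP /ccontP cF; apply/ccontP => t e e0.
have [d1 d10 H1] := HP t e e0; have d120 : 0 < d1 / 2 by lra.
have [d2 d20 H2] := cF t _ d120; exists d2 => // s /H2 h2.
rewrite cabs_distC -{1}(subrK (F t) (F s)) addrC [F s - F t + _]addrC addrC.
by apply: H1; rewrite cabs_distC; lra.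
Qed.

Lemma ccont_comp_cderiv (P : C -> C) F : (forall t, exists d, is_cderiv P (F t) d) ->
  ccont F -> ccont (fun t => P (F t)).
Proof.
move=> HP; apply: ccont_comp => t; have [d] := HP t.
exact: is_cderiv_continuous.
Qed.

(** The class of integrands: closed under sums and products, integrable since the interval has
    finite measure, and containing both continuous curves and indicator functions. *)
Definition bmeas F := [/\ measurable_fun I (fun t => complex.Re (F t)),
  measurable_fun I (fun t => complex.Im (F t)) &
  exists M : R, forall t, t \in I -> cabs (F t) <= M].

Lemma measI : measurable I. Proof. exact: measurable_itv. Qed.

Lemma pi_neq0 : pi != 0 :> R. Proof. by rewrite gt_eqF// pi_gt0. Qed.

Lemma twopi_gt0 : 0 < 2 * pi :> R.
Proof. by rewrite mulr_gt0// pi_gt0. Qed.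

Lemma mu_I : mu I = (2 * pi)%:E.
Proof. by rewrite lebesgue_measure_itv/= lte_fin twopi_gt0 sube0. Qed.

Lemma Rintegral_I_cst (r : R) : Rintegral mu I (fun=> r) = r * (2 * pi).
Proof.
have m : fine (mu I) = 2 * pi by rewrite mu_I.
by rewrite (Rintegral_cst mu measI r) m.
Qed.

Lemma continuous_bounded f : continuous f -> exists M, forall t, t \in I -> `|f t| <= M.
Proof.
move=> cf.
have : compact (f @` I).
  apply: continuous_compact; last exact: segment_compact.
  exact: continuous_subspaceT.
move=> /compact_bounded[M [_ HM]]; exists (M + 1) => t tI.
by apply: HM; [lra|exists t => //; exact: set_mem].
Qed.

Lemma ccont_bmeas F : ccont F -> bmeas F.
Proof.
move=> [c1 c2]; split.
- by apply: subspace_continuous_measurable_fun; [exact: measurable_itv|exact: continuous_subspaceT].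
- by apply: subspace_continuous_measurable_fun; [exact: measurable_itv|exact: continuous_subspaceT].
have [M1 H1] := continuous_bounded c1; have [M2 H2] := continuous_bounded c2.
exists (M1 + M2) => t tI; apply: (le_trans (cabs_le_ReIm _)).
by rewrite lerD ?H1 ?H2.
Qed.

Lemma Re_funD (T : Type) (F G : T -> C) : (fun t => complex.Re (F t + G t)) =
  (fun t => complex.Re (F t) + complex.Re (G t)).
Proof. by apply/funext => t; rewrite cReD. Qed.

Lemma Im_funD (T : Type) (F G : T -> C) : (fun t => complex.Im (F t + G t)) =
  (fun t => complex.Im (F t) + complex.Im (G t)).
Proof. by apply/funext => t; rewrite cImD. Qed.

Lemma Re_funM (T : Type) (F G : T -> C) : (fun t => complex.Re (F t * G t)) =
  (fun t => complex.Re (F t) * complex.Re (G t) - complex.Im (F t) * complex.Im (G t)).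
Proof. by apply/funext => t; rewrite cReM. Qed.

Lemma Im_funM (T : Type) (F G : T -> C) : (fun t => complex.Im (F t * G t)) =
  (fun t => complex.Re (F t) * complex.Im (G t) + complex.Im (F t) * complex.Re (G t)).
Proof. by apply/funext => t; rewrite cImM. Qed.

Lemma bmeasD F G : bmeas F -> bmeas G -> bmeas (fun t => F t + G t).
Proof.
move=> [f1 f2 [M HM]] [g1 g2 [N HN]]; split.
- by rewrite Re_funD; exact: measurable_funD.
- by rewrite Im_funD; exact: measurable_funD.
by exists (M + N) => t tI; rewrite (le_trans (cabsD _ _))// lerD ?HM ?HN.
Qed.

Lemma bmeasM F G : bmeas F -> bmeas G -> bmeas (fun t => F t * G t).
Proof.
move=> [f1 f2 [M HM]] [g1 g2 [N HN]]; split.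
- by rewrite Re_funM; apply: measurable_funB; exact: measurable_funM.
- by rewrite Im_funM; apply: measurable_funD; exact: measurable_funM.
by exists (M * N) => t tI; rewrite cabsM ler_pM ?cabs_ge0 ?HM ?HN.
Qed.

Lemma bmeas_cst z : bmeas (fun=> z).
Proof. exact: ccont_bmeas (ccont_cst z). Qed.

Lemma bmeasZ z F : bmeas F -> bmeas (fun t => z * F t).
Proof. exact: bmeasM (bmeas_cst z). Qed.

Lemma bmeas_real f : measurable_fun I f ->
  (exists M : R, forall t, t \in I -> `|f t| <= M) -> bmeas (fun t => (f t)%:C).
Proof.
move=> mf [M HM]; split; [exact: mf|exact: measurable_cst|].
by exists M => t tI; rewrite cabs_real HM.
Qed.

Lemma bounded_integrable f : measurable_fun I f ->
  (exists M : R, forall t, t \in I -> `|f t| <= M) -> mu.-integrable I (EFin \o f).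
Proof.
move=> mf [M HM]; apply: measurable_bounded_integrable => //.
  by rewrite [ltLHS]mu_I ltry.
exists M; split; first exact: num_real.
by move=> x Mx t /= tI; apply: le_trans (ltW Mx); apply: HM; exact: mem_set.
Qed.

Lemma bmeas_integrable F : bmeas F ->
  mu.-integrable I (EFin \o (fun t => complex.Re (F t))) /\
  mu.-integrable I (EFin \o (fun t => complex.Im (F t))).
Proof.
move=> [m1 m2 [M HM]]; split; apply: bounded_integrable => //; exists M => t /HM;
  apply: le_trans; [exact: norm_Re_le|exact: norm_Im_le].
Qed.

Lemma circle_intE F : circle_int F =
  ((2 * pi)^-1 * Rintegral mu I (fun t => complex.Re (F t))) +i*
  ((2 * pi)^-1 * Rintegral mu I (fun t => complex.Im (F t))).
Proof.
rewrite /circle_int -[(2 * pi)%:C^-1]fmorphV/=.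
by apply: complex_ext => /=; ring.
Qed.

Lemma circle_intD F G : bmeas F -> bmeas G ->
  circle_int (fun t => F t + G t) = circle_int F + circle_int G.
Proof.
move=> /bmeas_integrable[f1 f2] /bmeas_integrable[g1 g2]; rewrite !circle_intE.
apply: complex_ext; rewrite ?(cReD, cImD)/= -mulrDr; congr (_ * _).
  by under eq_Rintegral do rewrite cReD; rewrite RintegralD//; exact: measI.
by under eq_Rintegral do rewrite cImD; rewrite RintegralD//; exact: measI.
Qed.

Lemma circle_intZ z F : bmeas F ->
  circle_int (fun t => z * F t) = z * circle_int F.
Proof.
move=> /bmeas_integrable[f1 f2]; rewrite !circle_intE.
have iZ (a : R) g : mu.-integrable I (EFin \o g) ->
    mu.-integrable I (EFin \o (fun t => a * g t)).
  move=> ig; rewrite (_ : EFin \o _ = (fun t => a%:E * (EFin \o g) t)%E)//.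
  by apply: integrableZl => //; exact: measI.
apply: complex_ext; rewrite ?(cReM, cImM)/=.
  under eq_Rintegral do rewrite cReM.
  rewrite RintegralB// ?RintegralZl//; [ring|exact: iZ|exact: iZ].
under eq_Rintegral do rewrite cImM.
rewrite RintegralD// ?RintegralZl//; [ring|exact: iZ|exact: iZ].
Qed.

Lemma circle_int_sum n (F : nat -> R -> C) : (forall i, bmeas (F i)) ->
  bmeas (fun t => \sum_(i < n) F i t) /\
  circle_int (fun t => \sum_(i < n) F i t) = \sum_(i < n) circle_int (F i).
Proof.
move=> mF; elim: n => [|n [IH1 IH2]].
  under eq_fun do rewrite big_ord0; rewrite big_ord0; split.
    exact: bmeas_cst.
  rewrite -[RHS](mul0r (circle_int (fun=> 1))) -circle_intZ ?mul0r//.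
  exact: bmeas_cst.
under eq_fun do rewrite big_ord_recr/=; rewrite big_ord_recr/= -IH2 -circle_intD//.
by split => //; exact: bmeasD.
Qed.

(* The factor 2 is the price of bounding real and imaginary parts apart. *)
Lemma circle_int_le_Rintegral F f : bmeas F -> mu.-integrable I (EFin \o f) ->
  (forall t, t \in I -> cabs (F t) <= f t) ->
  cabs (circle_int F) <= pi^-1 * Rintegral mu I f.
Proof.
move=> /bmeas_integrable[f1 f2] fi Ff.
have p0 : 0 < (2 * pi)^-1 :> R by rewrite invr_gt0 twopi_gt0.
have H g : mu.-integrable I (EFin \o g) -> (forall t, t \in I -> `|g t| <= f t) ->
    `|(2 * pi)^-1 * Rintegral mu I g| <= (2 * pi)^-1 * Rintegral mu I f.
  move=> ig gf; rewrite normrM gtr0_norm// ler_pM2l//.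
  apply: (@le_trans _ _ (Rintegral mu I (fun t => `|g t|))).
    by apply: le_normr_Rintegral => //; exact: measI.
  apply: le_Rintegral => //.
    exact: integrable_norm ig.
  by move=> t tI; apply: gf; exact: mem_set.
rewrite circle_intE; apply: (le_trans (cabs_le_ReIm _)) => /=.
rewrite (_ : pi^-1 * _ = (2 * pi)^-1 * Rintegral mu I f +
    (2 * pi)^-1 * Rintegral mu I f); last first.
  have pf (p x : R) : p != 0 -> p^-1 * x = (2 * p)^-1 * x + (2 * p)^-1 * x.
    by move=> p'; field.
  exact: pf pi_neq0.
by rewrite lerD//; apply: H => // t tI; apply: le_trans (Ff _ tI);
  rewrite ?norm_Re_le ?norm_Im_le.
Qed.

Lemma circle_int_bound F (M : R) : bmeas F ->
  (forall t, t \in I -> cabs (F t) <= M) -> cabs (circle_int F) <= 2 * M.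
Proof.
move=> mF FM.
apply: (le_trans (circle_int_le_Rintegral (f := cst M) mF _ FM)).
  by apply: bounded_integrable => //; exists `|M|.
rewrite Rintegral_I_cst.
have pf (p x : R) : p != 0 -> p^-1 * (x * (2 * p)) = 2 * x.
  by move=> p'; field.
by rewrite pf// pi_neq0.
Qed.

Lemma circle_int_cst z : circle_int (fun=> z) = z.
Proof.
rewrite circle_intE !Rintegral_I_cst.
have pf (x : R) : (2 * pi)^-1 * (x * (2 * pi)) = x.
  by rewrite mulrC mulfK// gt_eqF// twopi_gt0.
by apply: complex_ext => /=; rewrite pf.
Qed.

Lemma FTC2_real (f F : R -> R) (a b : R) : a < b -> continuous f ->
  (forall t : R, is_derive t 1 F (f t)) -> Rintegral mu `[a, b] f = F b - F a.
Proof.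
move=> ab cf dF; rewrite /Rintegral (@continuous_FTC2 _ f F)//.
- exact: continuous_subspaceT.
- have cF : continuous F.
    by move=> t; apply/differentiable_continuous/derivable1_diffP; case: (dF t).
  split; first by move=> t _; case: (dF t).
    by apply: cvg_at_right_filter; exact: cF.
  by apply: cvg_at_left_filter; exact: cF.
by move=> t _; rewrite derive1E; apply: derive_val; exact: dF.
Qed.

Lemma circle_int_FTC F G : ccont F -> (forall t, is_rderiv G t (F t)) ->
  circle_int F = (G (2 * pi) - G 0) / (2 * pi)%:C.
Proof.
move=> [c1 c2] dG.
rewrite circle_intE -[(2 * pi)%:C^-1]fmorphV/=.
have dR (t : R) : is_derive t 1 (fun s => complex.Re (G s)) (complex.Re (F t)).
  by have /is_rderivP[] := dG t.
have dI (t : R) : is_derive t 1 (fun s => complex.Im (G s)) (complex.Im (F t)).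
  by have /is_rderivP[] := dG t.
rewrite (FTC2_real twopi_gt0 c1 dR) (FTC2_real twopi_gt0 c2 dI).
by apply: complex_ext; rewrite ?(cReM, cImM, cReD, cImD, cReN, cImN)/=; ring.
Qed.

Lemma eit_2pi : eit (2 * pi) = eit 0 :> C.
Proof.
have H : (2 * pi : R) = pi + pi by rewrite mulr_natl mulr2n.
by rewrite /eit H cosD sinD (@cospi R) (@sinpi R) cos0 sin0; apply: complex_ext => /=; ring.
Qed.

Lemma cabs_eit t : cabs (eit t : C) = 1.
Proof. by rewrite cabsE/= cos2Dsin2 sqrtr1. Qed.

Lemma conj_eit t : conjc (eit t : C) = (eit t)^-1.
Proof.
have e0 : eit t != 0 :> C by rewrite -cabs_gt0 cabs_eit.
apply: (mulfI e0); rewrite mulfV// mul_conj cabs_eit expr1n.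
by [].
Qed.

End CurvesAndCircleIntegrals.

(** * Cauchy integrals and Cauchy's formulas on circles centered at 0 *)

Section CauchyFormula.
Context {R : realType}.
Local Notation C := R[i].
Local Notation mu := (@lebesgue_measure R).
Local Notation I := (`[0, 2 * pi]%classic : set R).
Implicit Types (f g : R -> R) (z w a : C) (psi : R -> C).

(** Plays the role of contour deformation: a circle integral is moved to an easier one along a
    parameter in [0, 1] for which its derivative vanishes. *)
Lemma is_rderiv_cst (F : R -> C) : (forall s, 0 <= s <= 1 -> is_rderiv F s 0) ->
  F 1 = F 0.
Proof.
move=> dF.
have H f : (forall s : R, 0 <= s <= 1 -> is_derive s 1 f 0) -> f 1 = f 0.
  move=> df.
  have df' (x : R) : x \in `]0, 1[%R -> is_derive x 1 f 0.
    by rewrite in_itv/= => /andP[x0 x1]; apply: df; rewrite !ltW.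
  have cf : {within `[0, 1], continuous f}.
    apply: derivable_within_continuous => x; rewrite in_itv/= => xI.
    by case: (df x xI).
  have [x _ /eqP] := MVT (df := fun=> 0) ltr01 df' cf.
  by rewrite mul0r subr_eq0 => /eqP.
apply: complex_ext.
  by apply: (H (fun s => complex.Re (F s))) => s /dF/is_rderivP[].
by apply: (H (fun s => complex.Im (F s))) => s /dF/is_rderivP[].
Qed.

Lemma is_rderiv_real (s : R) : is_rderiv (fun x => x%:C) s 1.
Proof.
move=> e e0; exists 1 => // h _.
rewrite (_ : _ - _ - _ = 0) ?cabs0; first by rewrite mulr_ge0// ltW.
by rewrite rmorphD/=; ring.
Qed.

Lemma cabs_circle (r t : R) : 0 <= r -> cabs (r%:C * eit t) = r.
Proof. by move=> r0; rewrite cabsM cabs_eit mulr1 cabs_real ger0_norm. Qed.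

Lemma circle_dist (r t : R) a : 0 <= r -> r - cabs a <= cabs (r%:C * eit t - a).
Proof. by move=> r0; rewrite -{1}(cabs_circle t r0) cabs_dist. Qed.

Lemma circle_neq (r t : R) a : cabs a < r -> r%:C * eit t - a != 0.
Proof.
move=> ar; have r0 : 0 <= r by apply: le_trans (ltW ar); exact: cabs_ge0.
by rewrite -cabs_gt0 (lt_le_trans _ (circle_dist _ _ r0))// subr_gt0.
Qed.

Lemma ccont_circle (r : R) : ccont (fun t => r%:C * eit t).
Proof. exact: ccontM (ccont_cst _) ccont_eit. Qed.

Lemma ccont_kernel (r : R) a : cabs a < r -> ccont (fun t => (r%:C * eit t - a)^-1).
Proof.
move=> ar; apply: ccontV => [|t]; last exact: circle_neq.
by apply: ccontD; [exact: ccont_circle|exact: ccont_cst].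
Qed.

(** [psi] is any bounded measurable density, not necessarily the boundary values of an analytic
    function: Schwarz integrals of indicator functions reduce to this form. *)
Definition cauchy_int (r : R) psi k a :=
  circle_int (fun t => psi t * (r%:C * eit t - a)^-1 ^+ k).

Lemma bmeas_kernel (r : R) psi k a : bmeas psi -> cabs a < r ->
  bmeas (fun t => psi t * (r%:C * eit t - a)^-1 ^+ k).
Proof.
by move=> mpsi ar; apply: bmeasM => //; apply/ccont_bmeas/ccontX; exact: ccont_kernel.
Qed.

Lemma kernel_bounds (A h : C) (m : R) : 0 < m -> m <= cabs A -> cabs h < m / 2 ->
  [/\ A != 0, A - h != 0, cabs A^-1 <= m^-1 & cabs (A - h)^-1 <= 2 / m].
Proof.
move=> m0 mA hm.
have A0 : A != 0 by rewrite -cabs_gt0; lra.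
have m2 : m / 2 <= cabs (A - h) by have := cabs_dist A h; lra.
have Ah0 : A - h != 0 by rewrite -cabs_gt0; lra.
split=> //; rewrite cabsV.
  by rewrite lef_pV2// posrE cabs_gt0.
rewrite (_ : 2 / m = (m / 2)^-1); last by rewrite invf_div.
by rewrite lef_pV2// posrE ?cabs_gt0//; lra.
Qed.

Lemma kernel_taylor1 (A h : C) (m : R) : 0 < m -> m <= cabs A -> cabs h < m / 2 ->
  cabs ((A - h)^-1 - A^-1 - h * A^-1 ^+ 2) <= 2 * m^-1 ^+ 3 * cabs h ^+ 2.
Proof.
move=> m0 mA hm; have [A0 Ah0 h1 h2] := kernel_bounds m0 mA hm.
rewrite (_ : _ - _ - _ = (A^-1 ^+ 2 * (A - h)^-1) * h ^+ 2); last first.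
  by field; rewrite A0 Ah0.
rewrite cabsM cabsX ler_wpM2r ?sqr_ge0// cabsM cabsX.
rewrite (_ : 2 * _ = m^-1 ^+ 2 * (2 / m)); last by ring.
by rewrite ler_pM ?sqr_ge0 ?cabs_ge0// lerXn2r// nnegrE ?cabs_ge0// invr_ge0 ltW.
Qed.

Lemma kernel_taylor2 (A h : C) (m : R) : 0 < m -> m <= cabs A -> cabs h < m / 2 ->
  cabs ((A - h)^-1 ^+ 2 - A^-1 ^+ 2 - 2 * h * A^-1 ^+ 3) <= 16 * m^-1 ^+ 4 * cabs h ^+ 2.
Proof.
move=> m0 mA hm; have [A0 Ah0 h1 h2] := kernel_bounds m0 mA hm.
(* An exact remainder. Its first factor is at most 4 because |h / A| is at most 1/2, and (A -
   h)^(-2) gives another 4, hence 16. *)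
rewrite (_ : _ - _ - _ = ((3 - 2 * h * A^-1) * (A^-1 ^+ 2 * (A - h)^-1 ^+ 2)) * h ^+ 2);
  last by field; rewrite A0 Ah0.
have mi : 0 <= m^-1 by rewrite invr_ge0 ltW.
rewrite cabsM cabsX ler_wpM2r ?sqr_ge0// cabsM.
rewrite (_ : 16 * _ = 4 * (m^-1 ^+ 2 * (2 / m) ^+ 2)); last by ring.
rewrite ler_pM ?cabs_ge0//.
  apply: (le_trans (cabsB _ _)).
  have c3 : cabs (3 : C) = 3.
    by rewrite (_ : (3 : C) = (3 : R)%:C) ?cabs_real ?ger0_norm// rmorph_nat.
  rewrite c3 !cabsM cabs2.
  suff : cabs h * cabs A^-1 <= 2^-1 by lra.
  rewrite (_ : 2^-1 = m / 2 * m^-1); last by field; rewrite gt_eqF.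
  by rewrite ler_pM ?cabs_ge0// ltW.
rewrite cabsM !cabsX ler_pM ?exprn_ge0 ?cabs_ge0//.
  by rewrite lerXn2r// nnegrE ?cabs_ge0.
by rewrite lerXn2r// nnegrE ?cabs_ge0// divr_ge0// ltW.
Qed.

(** The Taylor remainder of the kernel is quadratic uniformly in t, because the circle stays at
    distance r - |a| from a. Integrated against the bounded [psi], it is again quadratic, so no
    dominated convergence is involved. *)
Lemma cauchy_int_taylor (r : R) psi a (k1 k2 : nat) (c : C) (K : R) :
  bmeas psi -> cabs a < r ->
  (forall A h : C, r - cabs a <= cabs A -> cabs h < (r - cabs a) / 2 ->
     cabs ((A - h)^-1 ^+ k1 - A^-1 ^+ k1 - c * h * A^-1 ^+ k2) <= K * cabs h ^+ 2) ->
  is_cderiv (cauchy_int r psi k1) a (c * cauchy_int r psi k2 a).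
Proof.
move=> mpsi ar HK; have [_ _ [B HB]] := mpsi.
have r0 : 0 <= r by apply: le_trans (ltW ar); exact: cabs_ge0.
have B0 : 0 <= B.
  have i0 : (0 : R) \in I by rewrite inE/= in_itv/= lexx ltW// twopi_gt0.
  exact: le_trans (cabs_ge0 _) (HB _ i0).
apply: (@is_cderiv_quadratic _ _ _ _ (2 * (B * K)) ((r - cabs a) / 2)).
  by rewrite divr_gt0// subr_gt0.
move=> h hm.
have ahr : cabs (a + h) < r by have := cabsD a h; lra.
rewrite (_ : c * _ * h = c * h * cauchy_int r psi k2 a); last by ring.
rewrite /cauchy_int -circle_intZ; last exact: bmeas_kernel.
have m1 := bmeas_kernel k1 mpsi ahr.
have m2 := bmeas_kernel k1 mpsi ar.
have m3 := bmeasZ (c * h) (bmeas_kernel k2 mpsi ar).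
have N (F : R -> C) : bmeas F -> - circle_int F = circle_int (fun t => -1 * F t).
  by move=> mF; rewrite circle_intZ// mulN1r.
rewrite (N _ m2) (N _ m3) -circle_intD//; last exact: bmeasZ.
rewrite -circle_intD//; last by apply: bmeasZ.
  2: by apply: bmeasD => //; exact: bmeasZ.
rewrite -mulrA; apply: circle_int_bound.
  by apply: bmeasD; [apply: bmeasD => //; exact: bmeasZ|exact: bmeasZ].
move=> t tI.
rewrite opprD addrA (_ : _ + -1 * _ + -1 * _ = psi t *
    ((r%:C * eit t - a - h)^-1 ^+ k1 - (r%:C * eit t - a)^-1 ^+ k1 -
      c * h * (r%:C * eit t - a)^-1 ^+ k2)); last by ring.
rewrite cabsM -[leRHS]mulrA ler_pM ?cabs_ge0//; first exact: HB.
by apply: HK => //; exact: circle_dist.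
Qed.

Lemma cauchy_int_cderiv1 (r : R) psi a : bmeas psi -> cabs a < r ->
  is_cderiv (cauchy_int r psi 1) a (cauchy_int r psi 2 a).
Proof.
move=> mpsi ar; rewrite -[X in is_cderiv _ _ X]mul1r.
apply: (@cauchy_int_taylor r psi a 1 2 1 (2 * (r - cabs a)^-1 ^+ 3)) => // A h mA hm.
rewrite !expr1 mul1r.
by apply: kernel_taylor1 => //; rewrite subr_gt0.
Qed.

Lemma cauchy_int_cderiv2 (r : R) psi a : bmeas psi -> cabs a < r ->
  is_cderiv (cauchy_int r psi 2) a (2 * cauchy_int r psi 3 a).
Proof.
move=> mpsi ar.
apply: (@cauchy_int_taylor r psi a 2 3 2 (16 * (r - cabs a)^-1 ^+ 4)) => // A h mA hm.
by apply: kernel_taylor2 => //; rewrite subr_gt0.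
Qed.

(** One factor i is in the primitive, the other comes from the derivative of [eit]; their product -1
    cancels the sign from differentiating the inverse. This primitive gives 0 over the full circle,
    and explicit end values over an arc. *)
Lemma is_rderiv_kernel (r t : R) a : cabs a < r ->
  is_rderiv (fun s => 'i * (r%:C * eit s - a)^-1) t
    (r%:C * eit t * (r%:C * eit t - a)^-1 ^+ 2).
Proof.
move=> ar; have n0 := circle_neq t ar.
have di : is_cderiv (fun x : C => 'i * x^-1) (- a + r%:C * eit t)
    ('i * (- (- a + r%:C * eit t)^-1 ^+ 2)).
  apply: is_cderiv_scale; rewrite [- a + _]addrC.
  apply: (@is_cderiv_quadratic _ _ _ _ (2 * (cabs (r%:C * eit t - a))^-1 ^+ 3)
      (cabs (r%:C * eit t - a) / 2)); first by rewrite divr_gt0// cabs_gt0.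
  move=> h hm; rewrite -(cabsN h) in hm *.
  have := @kernel_taylor1 (r%:C * eit t - a) (- h) (cabs (r%:C * eit t - a)).
  rewrite cabs_gt0 n0 lexx => /(_ isT isT hm).
  by rewrite opprK !mulNr [_ ^+ 2 * h]mulrC.
have dg := is_rderiv_affine (- a) r%:C (is_rderiv_eit t).
have := is_rderiv_comp di dg.
rewrite (_ : (fun s => _) = fun s => 'i * (r%:C * eit s - a)^-1); last first.
  by apply/funext => s; rewrite addrC.
rewrite (_ : _ * (r%:C * _) = r%:C * eit t * (r%:C * eit t - a)^-1 ^+ 2)//.
rewrite [- a + _]addrC.
have i2 : ('i : C) * 'i = -1 by rewrite -expr2 sqr_i.
rewrite (_ : _ * _ = - ('i * 'i) * (r%:C * eit t * (r%:C * eit t - a)^-1 ^+ 2)).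
  by rewrite i2 opprK mul1r.
by ring.
Qed.

Lemma circle_int_kernel2 (r : R) a : cabs a < r ->
  circle_int (fun t => r%:C * eit t * (r%:C * eit t - a)^-1 ^+ 2) = 0.
Proof.
move=> ar; rewrite (circle_int_FTC (G := fun s => 'i * (r%:C * eit s - a)^-1)).
- by rewrite eit_2pi subrr mul0r.
- by apply: ccontM; [exact: ccont_circle|apply: ccontX; exact: ccont_kernel].
by move=> t; exact: is_rderiv_kernel.
Qed.

(** Move the pole from 0 to a along a segment: the derivative of the integral is a multiple of the
    integral in [circle_int_kernel2], and at pole 0 the integrand is the constant 1. *)
Lemma circle_int_kernel1 (r : R) a : cabs a < r ->
  circle_int (fun t => r%:C * eit t * (r%:C * eit t - a)^-1) = 1.
Proof.
move=> ar; have r0 : 0 < r by apply: le_lt_trans ar; exact: cabs_ge0.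
have mpsi : bmeas (fun t => r%:C * eit t) by exact/ccont_bmeas/ccont_circle.
have cE b : circle_int (fun t => r%:C * eit t * (r%:C * eit t - b)^-1) =
    cauchy_int r (fun t => r%:C * eit t) 1 b.
  by rewrite /cauchy_int; congr circle_int; apply/funext => t; rewrite expr1.
rewrite cE.
have := @is_rderiv_cst (fun s => cauchy_int r (fun t => r%:C * eit t) 1 (0 + a * s%:C)).
rewrite mulr1 mulr0 addr0 add0r => -> //.
  rewrite -cE -[RHS](circle_int_cst 1); congr circle_int; apply/funext => t.
  by rewrite subr0 mulfV// -[_ * _]subr0 circle_neq// cabs0.
move=> s /andP[s0 s1].
have sar : cabs (0 + a * s%:C) < r.
  rewrite add0r cabsM cabs_real ger0_norm//; apply: le_lt_trans ar.
  by rewrite -[leRHS]mulr1 ler_wpM2l ?cabs_ge0.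
have := is_rderiv_comp (cauchy_int_cderiv1 mpsi sar) (is_rderiv_affine 0 a (is_rderiv_real s)).
by rewrite /cauchy_int circle_int_kernel2// mul0r.
Qed.

(** Asks outright for what Cauchy's theory would deduce from one complex derivative: a
    differentiable derivative, and bounds on smaller discs. For the functions used here both follow
    from explicit formulas. *)
Definition regular (F Fd : C -> C) : Prop :=
  [/\ forall z, in_disc z -> is_cderiv F z (Fd z),
      forall z, in_disc z -> exists d, is_cderiv Fd z d &
      forall rho : R, rho < 1 -> exists M : R, forall z, cabs z <= rho ->
        cabs (F z) <= M /\ cabs (Fd z) <= M].

Lemma differentiation_under_Rintegral (f df : R -> R -> R) (u v s M : R) :
  u < s < v ->
  (forall x, u < x < v -> mu.-integrable I (EFin \o f x)) ->
  (forall x t : R, u < x < v -> t \in I -> is_derive x 1 (f ^~ t) (df x t)) ->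
  (forall x t, u < x < v -> t \in I -> `|df x t| <= M) ->
  is_derive s 1 (fun x => Rintegral mu I (f x)) (Rintegral mu I (df s)).
Proof.
move=> suv fi fd dM.
have M0 : 0 <= M.
  have i0 : (0 : R) \in I by rewrite inE/= in_itv/= lexx ltW// twopi_gt0.
  exact: le_trans (normr_ge0 _) (dM _ _ suv i0).
have sI : `]u, v[%classic s by rewrite /= in_itv.
have d1 x t : u < x < v -> t \in I -> partial1of2 f x t = df x t.
  by move=> xu tI; rewrite partial1of2E; apply: derive_val; exact: fd.
have H := @cvg_differentiation_under_integral R _ _ mu f I measI s u v sI.
have {}H : h^-1 *: (Rintegral mu I (f (h + s)) - Rintegral mu I (f s))
    @[h --> 0^'] --> Rintegral mu I (df s).
  rewrite (_ : Rintegral mu I (df s) = Rintegral mu I (partial1of2 f s)).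
    apply: (H _ _ (fun=> M)) => //.
    - move=> x t; rewrite /= in_itv/= => xu /mem_set tI.
      by case: (fd x t xu tI).
    - apply: bounded_integrable => //; exists M => t _; by rewrite ger0_norm.
    - move=> x t; rewrite /= in_itv/= => xu /mem_set tI.
      by rewrite d1// dM.
  by apply: eq_Rintegral => t tI; exact/esym/d1.
have {}H : h^-1 *: (Rintegral mu I (f (h *: (1 : R^o) + s)) - Rintegral mu I (f s))
    @[h --> 0^'] --> Rintegral mu I (df s).
  by under eq_fun do rewrite scaler1.
by split; [apply/cvg_ex; eexists; exact: H|exact/cvg_lim].
Qed.

Lemma circle_int_rderiv (F Fd : R -> R -> C) (u v s M : R) : u < s < v ->
  (forall x, u < x < v -> bmeas (F x)) ->
  (forall x t, u < x < v -> t \in I -> is_rderiv (F ^~ t) x (Fd x t)) ->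
  (forall x t, u < x < v -> t \in I -> cabs (Fd x t) <= M) ->
  is_rderiv (fun x => circle_int (F x)) s (circle_int (Fd s)).
Proof.
move=> suv mF dF FM.
pose c : R := (2 * pi)^-1.
have scale g d : is_derive s 1 g d -> is_derive s 1 (fun x => c * g x) (c * d).
  move=> /is_derive_eps Hg; apply/is_derive_eps => e e0.
  have c0 : 0 < c by rewrite /c invr_gt0 twopi_gt0.
  have [del del0 Hd] := Hg _ (divr_gt0 e0 c0); exists del => // h /Hd hd.
  rewrite -mulrA -!mulrBr normrM gtr0_norm// mulrC -ler_pdivlMr//.
  by rewrite mulrAC.
apply/is_rderivP; split.
  rewrite (_ : (fun x => _) =
      fun x => c * Rintegral mu I (fun t => complex.Re (F x t))).
    rewrite circle_intE; apply: scale.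
    apply: (@differentiation_under_Rintegral (fun x t => complex.Re (F x t))
        (fun x t => complex.Re (Fd x t)) u v s M) => //.
    + by move=> x /mF /bmeas_integrable[].
    + by move=> x t xu tI; have /is_rderivP[] := dF x t xu tI.
    + by move=> x t xu tI; apply: le_trans (FM x t xu tI); exact: norm_Re_le.
  by apply/funext => x; rewrite circle_intE.
rewrite (_ : (fun x => _) =
    fun x => c * Rintegral mu I (fun t => complex.Im (F x t))).
  rewrite circle_intE; apply: scale.
  apply: (@differentiation_under_Rintegral (fun x t => complex.Im (F x t))
      (fun x t => complex.Im (Fd x t)) u v s M) => //.
  + by move=> x /mF /bmeas_integrable[].
  + by move=> x t xu tI; have /is_rderivP[] := dF x t xu tI.
  + by move=> x t xu tI; apply: le_trans (FM x t xu tI); exact: norm_Im_le.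
by apply/funext => x; rewrite circle_intE.
Qed.

(* Contract the circle to the point [a]: the s-derivative of the integral below
   is the integral of a t-derivative over a full period. *)
Lemma cauchy_formula (F Fd : C -> C) (r : R) a : regular F Fd ->
  r < 1 -> cabs a < r ->
  circle_int (fun t => F (r%:C * eit t) * (r%:C * eit t * (r%:C * eit t - a)^-1)) = F a.
Proof.
move=> [dF dFd bF] r1 ar.
have r0 : 0 < r by apply: le_lt_trans ar; exact: cabs_ge0.
pose rho := (1 + r) / 2; have rho1 : rho < 1 by rewrite /rho; lra.
have [M HM] := bF _ rho1.
(* The parameter s runs over an open interval around [0, 1], so as to differentiate at the end
   points too. For such s, |1 - s| + |s| is at most 1 + 2 [eta] = [rho] / r, which keeps the moved
   circles in the disc of radius [rho]. *)
pose eta := (rho / r - 1) / 2.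
have eta0 : 0 < eta.
  by rewrite /eta divr_gt0// subr_gt0 ltr_pdivlMr// mul1r /rho; lra.
pose g s t : C := a + s%:C * (r%:C * eit t - a).
pose kap t : C := r%:C * eit t * (r%:C * eit t - a)^-1.
have gb s t : - eta < s < 1 + eta -> cabs (g s t) <= rho.
  move=> /andP[s1 s2].
  rewrite (_ : g s t = (1 - s)%:C * a + s%:C * (r%:C * eit t)); last first.
    by rewrite /g rmorphB rmorph1; ring.
  apply: (le_trans (cabsD _ _)); rewrite !cabsM !cabs_real cabs_eit mulr1.
  rewrite (gtr0_norm r0); apply: (@le_trans _ _ ((`|1 - s| + `|s|) * r)).
    by rewrite mulrDl lerD2r ler_wpM2l// ltW.
  rewrite -ler_pdivlMr// (_ : rho / r = 1 + 2 * eta); last by rewrite /eta; lra.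
  by have [h1|h1] := lerP 0 s; have [h2|h2] := lerP 0 (1 - s);
     rewrite ?(ger0_norm h1) ?(ltr0_norm h1) ?(ger0_norm h2) ?(ltr0_norm h2); lra.
have gd s t : - eta < s < 1 + eta -> in_disc (g s t).
  by move=> /(gb _ t) h; rewrite /in_disc; lra.
have ccg s : ccont (g s).
  apply: ccontD (ccont_cst _) _; apply: ccontM (ccont_cst _) _.
  by apply: ccontD; [exact: ccont_circle|exact: ccont_cst].
have cckap : ccont kap.
  by apply: ccontM; [exact: ccont_circle|exact: ccont_kernel].
have kapE t : (r%:C * eit t - a) * kap t = r%:C * eit t.
  by rewrite /kap mulrCA mulfV ?mulr1// circle_neq.
have ds t s : is_rderiv (g ^~ t) s (r%:C * eit t - a).
  have := is_rderiv_affine a (r%:C * eit t - a) (is_rderiv_real s); rewrite mulr1.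
  by rewrite (_ : (fun _ => _) = g ^~ t)//; apply/funext => x; rewrite /g mulrC.
have dt s t : is_rderiv (g s) t (s%:C * (r%:C * ('i * eit t))).
  have := is_rderiv_affine (a - s%:C * a) (s%:C * r%:C) (is_rderiv_eit t).
  rewrite -mulrA (_ : (fun _ => _) = g s)//.
  by apply/funext => x; rewrite /g; ring.
have ccFd s : - eta < s < 1 + eta -> ccont (fun t => Fd (g s t)).
  by move=> sI; apply: ccont_comp_cderiv => [t|//]; apply: dFd; exact: gd.
have ccF s : - eta < s < 1 + eta -> ccont (fun t => F (g s t)).
  move=> sI; apply: ccont_comp_cderiv => [t|//]; exists (Fd (g s t)).
  by apply: dF; exact: gd.
have zero s : - eta < s < 1 + eta ->
    circle_int (fun t => Fd (g s t) * (r%:C * eit t)) = 0.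
  (* At s = 0 the integrand is a constant times [eit]. Otherwise i s times the integrand is the
     t-derivative of [F (g s t)], which is 2 pi periodic. *)
  move=> sI; have [->|s0] := eqVneq s 0.
    have g0 t : g 0 t = a by rewrite /g mul0r addr0.
    under [X in circle_int X]eq_fun do rewrite g0.
    rewrite circle_intZ; last exact/ccont_bmeas/ccont_circle.
    rewrite circle_intZ; last exact/ccont_bmeas/ccont_eit.
    rewrite (circle_int_FTC (G := fun t => - 'i * eit t)).
    - by rewrite eit_2pi subrr mul0r !mulr0.
    - exact: ccont_eit.
    move=> t; have := is_rderiv_affine 0 (- 'i) (is_rderiv_eit t).
    rewrite mulrA mulNr -expr2 sqr_i opprK mul1r.
    by under eq_fun do rewrite add0r.
  have si : s%:C * 'i != 0 :> C.
    rewrite mulf_neq0//; first by rewrite -cabs_gt0 cabs_real normr_gt0.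
    by rewrite -cabs_gt0 cabsE/= expr0n add0r expr1n sqrtr1.
  apply: (mulfI si); rewrite mulr0 -circle_intZ; last first.
    by apply/ccont_bmeas/ccontM; [exact: ccFd|exact: ccont_circle].
  rewrite (circle_int_FTC (G := fun t => F (g s t))).
  - by rewrite /g eit_2pi subrr mul0r.
  - apply: ccontM (ccont_cst _) _.
    by apply: ccontM; [exact: ccFd|exact: ccont_circle].
  move=> t; rewrite (_ : _ * _ = Fd (g s t) * (s%:C * (r%:C * ('i * eit t)))).
    by apply: is_rderiv_comp (dt s t); apply: dF; exact: gd.
  by ring.
have cst : circle_int (fun t => F (g 1 t) * kap t) =
           circle_int (fun t => F (g 0 t) * kap t).
  apply: (@is_rderiv_cst (fun s => circle_int (fun t => F (g s t) * kap t))).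
  move=> s /andP[s0 s1].
  have sI : - eta < s < 1 + eta by apply/andP; split; lra.
  rewrite -(zero s sI).
  apply: (@circle_int_rderiv (fun s t => F (g s t) * kap t)
    (fun s t => Fd (g s t) * (r%:C * eit t)) (- eta) (1 + eta) s (M * r)) => //.
  - by move=> x xI; apply/ccont_bmeas/ccontM => //; exact: ccF.
  - move=> x t xI _.
    rewrite (_ : _ * (_ * _) = kap t * (Fd (g x t) * (r%:C * eit t - a))).
      have := is_rderiv_affine 0 (kap t)
        (@is_rderiv_comp _ F (g ^~ t) x _ _ (dF _ (gd _ t xI)) (ds t x)).
      rewrite (_ : (fun _ => _) = fun s => F (g s t) * kap t)//.
      by apply/funext => y; rewrite add0r mulrC.
    by rewrite -[X in Fd _ * X]kapE; ring.
  - move=> x t xI _; rewrite cabsM cabs_circle; last exact: ltW.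
    rewrite ler_wpM2r//; first exact: ltW.
    by have [] := HM _ (gb _ t xI).
have g1 t : g 1 t = r%:C * eit t by rewrite /g rmorph1 mul1r; ring.
have g0 t : g 0 t = a by rewrite /g mul0r addr0.
rewrite -[RHS]mulr1 -(circle_int_kernel1 ar) -circle_intZ; last exact: ccont_bmeas.
transitivity (circle_int (fun t => F (g 1 t) * kap t)).
  by congr circle_int; apply/funext => t; rewrite g1.
by rewrite cst; congr circle_int; apply/funext => t; rewrite g0.
Qed.

(** Near a the function F equals its Cauchy integral, whose derivative is known from
    [cauchy_int_cderiv1]; derivatives are unique. *)
Lemma cauchy_formula_deriv (F Fd : C -> C) (r : R) a : regular F Fd ->
  r < 1 -> cabs a < r ->
  circle_int (fun t => F (r%:C * eit t) * (r%:C * eit t) *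
    (r%:C * eit t - a)^-1 ^+ 2) = Fd a.
Proof.
move=> rF r1 ar; have [dF _ _] := rF.
have r0 : 0 < r by apply: le_lt_trans ar; exact: cabs_ge0.
have a1 : in_disc a by rewrite /in_disc; lra.
pose psi t := F (r%:C * eit t) * (r%:C * eit t).
have mpsi : bmeas psi.
  apply/ccont_bmeas/ccontM; last exact: ccont_circle.
  apply: ccont_comp_cderiv; last exact: ccont_circle.
  by move=> t; eexists; apply: dF; rewrite /in_disc cabs_circle// ltW.
have dC := cauchy_int_cderiv1 mpsi ar.
apply: (@is_cderiv_unique _ F a _ _ _ (dF _ a1)).
apply/is_cderivP => e e0; have /is_cderivP/(_ e e0)[d d0 Hd] := dC.
exists (Num.min d (r - cabs a)); first by rewrite lt_min d0 subr_gt0.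
move=> h; rewrite lt_min => /andP[/Hd hd har].
have ahr : cabs (a + h) < r by have := cabsD a h; lra.
have E b : cabs b < r -> cauchy_int r psi 1 b = F b.
  move=> br; rewrite -(cauchy_formula rF r1 br); congr circle_int.
  by apply/funext => t; rewrite /psi expr1 -mulrA.
by rewrite -(E _ ahr) -(E _ ar).
Qed.

End CauchyFormula.

(** * The complex exponential and its derivative *)

Section ComplexExponential.
Context {R : realType}.
Local Notation C := R[i].
Implicit Types (z w : C).

Lemma cexp0 : cexp (0 : C) = 1.
Proof. by rewrite /cexp/= expR0 cos0 sin0 mulr1 mulr0. Qed.

Lemma cexpD z w : cexp (z + w) = cexp z * cexp w.
Proof.
rewrite /cexp cReD cImD expRD cosD sinD.
by apply: complex_ext; rewrite ?cReM ?cImM/=; ring.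
Qed.

Lemma cexpN z : cexp (- z) = (cexp z)^-1.
Proof.
have E : cexp z * cexp (- z) = 1 by rewrite -cexpD subrr cexp0.
have n0 : cexp z != 0.
  by apply/eqP => z0; move: E; rewrite z0 mul0r => /eqP; rewrite eq_sym oner_eq0.
by apply: (mulfI n0); rewrite E mulfV.
Qed.

Lemma cabs_cexp z : cabs (cexp z) = expR (complex.Re z).
Proof.
rewrite cabsE/= !exprMn -mulrDr cos2Dsin2 mulr1 sqrtr_sqr ger0_norm//.

Qed.

Lemma is_cderiv_cexp0 : is_cderiv (@cexp R) 0 1.
Proof.
apply/is_cderivP => e e0.
(* The real and imaginary parts cost 4 and 8 times e / 16. [e1] also bounds |h|, which takes care of
   the product x y in the imaginary part. *)
have [e1 [e10 e11 e1e]] : exists e1, [/\ 0 < e1, e1 <= 1 & e1 <= e / 16].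
  exists (Num.min 1 (e / 16)).
  by rewrite lt_min ltr01 divr_gt0// !ge_min !lexx orbT.
have /is_derive_eps/(_ _ e10)[d1 d10 H1] := is_derive_expR (0 : R).
have /is_derive_eps/(_ _ e10)[d2 d20 H2] := is_derive_cos (0 : R).
have /is_derive_eps/(_ _ e10)[d3 d30 H3] := is_derive_sin (0 : R).
exists (Num.min e1 (Num.min d1 (Num.min d2 d3))).
  by rewrite !lt_min e10 d10 d20 d30.
move=> h; rewrite !lt_min => /and4P[h0 h1 h2 h3].
have hx := norm_Re_le h; have hy := norm_Im_le h.
set x := complex.Re h in hx *; set y := complex.Im h in hy *.
have := H1 x (le_lt_trans hx h1); have := H2 y (le_lt_trans hy h2).
have := H3 y (le_lt_trans hy h3).
rewrite !add0r expR0 cos0 sin0 oppr0 !mul0r !subr0 !mul1r addr0 => {H1 H2 H3}H3 H2 H1.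
have ex : expR x <= 3.
  have := ler_norm (expR x - 1 - x); have := ler_norm x.
  have : e1 * `|x| <= 1 * 1 by rewrite ler_pM// ?ltW//; lra.
  lra.
have ex0 := expR_ge0 x.
have ch := cabs_ge0 h.
have B0 : 0 <= e / 16 * cabs h by rewrite mulr_ge0// divr_ge0// ltW.
have B1 : e1 * `|x| <= e / 16 * cabs h by rewrite ler_pM// ltW.
have B2 : e1 * `|y| <= e / 16 * cabs h by rewrite ler_pM// ltW.
rewrite cexp0; apply: (le_trans (cabs_le_ReIm _)).
rewrite !(cReD, cReN, cImD, cImN)/= -/x -/y subr0.
have R1 : `|expR x * cos y - 1 - x| <= 4 * (e / 16 * cabs h).
  rewrite (_ : _ - _ - _ = expR x * (cos y - 1) + (expR x - 1 - x)); last by ring.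
  apply: (le_trans (ler_normD _ _)); rewrite normrM (ger0_norm ex0).
  have : expR x * `|cos y - 1| <= 3 * (e1 * `|y|) by rewrite ler_pM.
  lra.
have R2 : `|expR x * sin y - y| <= 8 * (e / 16 * cabs h).
  rewrite (_ : _ - _ = expR x * (sin y - y) + (expR x - 1 - x) * y + x * y); last by ring.
  apply: (le_trans (ler_normD _ _)).
  have Q4 : `|expR x * (sin y - y) + (expR x - 1 - x) * y| <=
      expR x * `|sin y - y| + `|expR x - 1 - x| * `|y|.
    by apply: (le_trans (ler_normD _ _)); rewrite !normrM (ger0_norm ex0).
  have Q3 : expR x * `|sin y - y| <= 3 * (e1 * `|y|) by rewrite ler_pM.
  have Q2 : `|expR x - 1 - x| * `|y| <= (e1 * `|x|) * 1 by rewrite ler_pM//; lra.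
  have Q1 : `|x * y| <= e1 * `|y| by rewrite normrM ler_wpM2r//; lra.
  apply: (le_trans (lerD (le_trans Q4 (lerD Q3 Q2)) Q1)); lra.
lra.
Qed.

Lemma is_cderiv_cexp z : is_cderiv (@cexp R) z (cexp z).
Proof.
have H := is_cderiv_scale (cexp z) is_cderiv_cexp0.
apply/is_cderivP => e e0; have /is_cderivP/(_ _ e0)[d d0 Hd] := H.
by exists d => // h /Hd; rewrite add0r cexp0 mulr1 cexpD.
Qed.

End ComplexExponential.

(** * Closure properties of regular functions *)

Section Regular.
Context {R : realType}.
Local Notation C := R[i].
Implicit Types (z w : C) (F G : C -> C).

Lemma is_cderiv_eq_disc F G z d : in_disc z ->
  (forall w, in_disc w -> F w = G w) -> is_cderiv F z d -> is_cderiv G z d.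
Proof.
move=> z1 FG /is_cderivP HF; apply/is_cderivP => e e0.
have [del del0 Hd] := HF _ e0.
have z1' : 0 < 1 - cabs z by rewrite subr_gt0.
exists (Num.min del (1 - cabs z)); first by rewrite lt_min del0.
move=> h; rewrite lt_min => /andP[/Hd hd hz]; rewrite -!FG//.
by rewrite /in_disc; have := cabsD z h; lra.
Qed.

Lemma regularM F Fd G Gd : regular F Fd -> regular G Gd ->
  regular (fun z => F z * G z) (fun z => Fd z * G z + F z * Gd z).
Proof.
move=> [dF dF2 bF] [dG dG2 bG]; split.
- by move=> z z1; apply: is_cderivM; [exact: dF|exact: dG].
- move=> z z1; have [a Ha] := dF2 _ z1; have [b Hb] := dG2 _ z1.
  eexists; apply: is_cderivD.
    by apply: is_cderivM; [exact: Ha|exact: dG].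
  by apply: is_cderivM; [exact: dF|exact: Hb].
move=> rho rho1; have [M HM] := bF _ rho1; have [N HN] := bG _ rho1.
exists (M * N + M * N) => z zr.
have [m1 m2] := HM _ zr; have [n1 n2] := HN _ zr.
have c := (cabs_ge0 (F z), cabs_ge0 (Fd z), cabs_ge0 (G z), cabs_ge0 (Gd z)).
have M0 : 0 <= M by apply: le_trans m1; exact: cabs_ge0.
have N0 : 0 <= N by apply: le_trans n1; exact: cabs_ge0.
have MN0 : 0 <= M * N by rewrite mulr_ge0.
split.
  by rewrite cabsM ler_wpDr// ler_pM// c.
by apply: (le_trans (cabsD _ _)); rewrite !cabsM lerD// ler_pM// c.
Qed.

Lemma horner_bounded (p : {poly C}) (r : R) : exists M : R, forall z,
  cabs z <= r -> cabs p.[z] <= M.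
Proof.
elim/poly_ind: p => [|p c [M HM]].
  by exists 0 => z _; rewrite horner0 cabs0.
exists (M * r + cabs c) => z zr; rewrite hornerMXaddC.
apply: (le_trans (cabsD _ _)); rewrite lerD2r cabsM.
by rewrite ler_pM ?cabs_ge0// HM.
Qed.

Lemma regular_poly (p : {poly C}) : regular (fun z => p.[z]) (fun z => (p^`()).[z]).
Proof.
split=> [z _|z _|rho _]; first exact: is_cderiv_horner.
  by eexists; exact: is_cderiv_horner.
have [M HM] := horner_bounded p rho; have [N HN] := horner_bounded p^`() rho.
exists (Num.max M N) => z zr.
by rewrite !le_max (HM _ zr) (HN _ zr) orbT.
Qed.

Lemma regular_cexp F Fd : regular F Fd ->
  regular (fun z => cexp (F z)) (fun z => cexp (F z) * Fd z).
Proof.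
move=> [dF dF2 bF].
have dE z : in_disc z -> is_cderiv (fun z => cexp (F z)) z (cexp (F z) * Fd z).
  by move=> z1; apply: is_cderiv_comp (is_cderiv_cexp _); exact: dF.
split=> [//|z z1|rho rho1].
  have [d Hd] := dF2 _ z1; eexists; apply: is_cderivM Hd; exact: dE.
have [M HM] := bF _ rho1; exists (expR M * (1 + M)) => z zr.
have [m1 m2] := HM _ zr.
have M0 : 0 <= M by apply: le_trans m1; exact: cabs_ge0.
have eM := expR_ge0 M.
have e1 : expR (complex.Re (F z)) <= expR M.
  by rewrite ler_expR (le_trans (Re_le _)).
rewrite cabsM cabs_cexp; split.
  by rewrite mulrDr mulr1; apply: (le_trans e1); rewrite lerDl mulr_ge0.
apply: (@le_trans _ _ (expR M * M)); first by rewrite ler_pM// ?expR_ge0 ?cabs_ge0.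
by rewrite ler_wpM2l// lerDr.
Qed.

End Regular.

(** * Schwarz integrals of densities with values in [0, 1] *)

Section SchwarzIntegral.
Context {R : realType}.
Local Notation C := R[i].
Local Notation mu := (@lebesgue_measure R).
Local Notation I := (`[0, 2 * pi]%classic : set R).
Implicit Types (u : R -> R) (z w : C).

Definition schwarz u z : C :=
  circle_int (fun t => (eit t + z) / (eit t - z) * (u t)%:C).

(** The z-derivative of (zeta + z) / (zeta - z) is 2 zeta / (zeta - z)^2. *)
Definition schwarz_deriv u z : C :=
  2 * cauchy_int 1 (fun t => eit t * (u t)%:C) 2 z.

Definition density u := measurable_fun I u /\ forall t, 0 <= u t <= 1.

Lemma density_bmeas u : density u -> bmeas (fun t => (u t)%:C).
Proof.
move=> [mu_ u01]; apply: bmeas_real => //; exists 1 => t _.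
by have /andP[u0 u1] := u01 t; rewrite ger0_norm.
Qed.

Lemma density_psi u : density u -> bmeas (fun t => eit t * (u t)%:C).
Proof. by move=> du; apply: bmeasM; [exact/ccont_bmeas/ccont_eit|exact: density_bmeas]. Qed.

Lemma eit_neq t z : in_disc z -> eit t - z != 0.
Proof. by move=> z1; have := circle_neq t z1; rewrite rmorph1 mul1r. Qed.

Lemma ccont_schwarz_kernel z : in_disc z -> ccont (fun t => (eit t + z) / (eit t - z)).
Proof.
move=> z1; apply: ccontM; first exact: ccontD ccont_eit (ccont_cst _).
by apply: ccontV => [|t]; [exact: ccontD ccont_eit (ccont_cst _)|exact: eit_neq].
Qed.

Lemma bmeas_schwarz u z : density u -> in_disc z ->
  bmeas (fun t => (eit t + z) / (eit t - z) * (u t)%:C).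
Proof.
move=> du z1; apply: bmeasM; last exact: density_bmeas.
exact/ccont_bmeas/ccont_schwarz_kernel.
Qed.

(** From (zeta + z) / (zeta - z) = 2 zeta / (zeta - z) - 1: up to a constant, the Schwarz integral
    is a Cauchy integral on the unit circle, so differentiability carries over. *)
Lemma schwarzE u z : density u -> in_disc z -> schwarz u z =
  2 * cauchy_int 1 (fun t => eit t * (u t)%:C) 1 z + - circle_int (fun t => (u t)%:C).
Proof.
move=> du z1; rewrite /cauchy_int -circle_intZ; last first.
  exact: bmeas_kernel (density_psi du) z1.
rewrite -[- circle_int _]mulN1r -circle_intZ; last exact: density_bmeas.
rewrite -circle_intD; last 2 first.
- by apply: bmeasZ; exact: bmeas_kernel (density_psi du) z1.
- by apply: bmeasZ; exact: density_bmeas.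
congr circle_int; apply/funext => t; rewrite rmorph1 mul1r expr1.
by field; exact: eit_neq.
Qed.

Lemma schwarz_cderiv u z : density u -> in_disc z ->
  is_cderiv (schwarz u) z (schwarz_deriv u z).
Proof.
move=> du z1; apply: (@is_cderiv_eq_disc _ (fun w =>
    2 * cauchy_int 1 (fun t => eit t * (u t)%:C) 1 w + - circle_int (fun t => (u t)%:C))) => //.
  by move=> w w1; rewrite schwarzE.
rewrite -[schwarz_deriv u z]addr0; apply: is_cderivD (is_cderiv_cst _ _).
apply: is_cderiv_scale; apply: cauchy_int_cderiv1 => //; exact: density_psi.
Qed.

Lemma schwarz_deriv_cderiv u z : density u -> in_disc z ->
  exists d, is_cderiv (schwarz_deriv u) z d.
Proof.
move=> du z1; eexists; apply: is_cderiv_scale; apply: cauchy_int_cderiv2 => //.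
exact: density_psi.
Qed.

Lemma schwarz1 z : in_disc z -> circle_int (fun t => (eit t + z) / (eit t - z)) = 1.
Proof.
move=> z1; have du : density (fun=> 1).
  by split => [|t]; [exact: measurable_cst|rewrite ler01 lexx].
have := schwarzE du z1; rewrite /schwarz/cauchy_int.
have -> : (fun t => (eit t + z) / (eit t - z) * (1 : R)%:C) =
    fun t => (eit t + z) / (eit t - z) by apply/funext => t; rewrite rmorph1 mulr1.
rewrite rmorph1 circle_int_cst => ->.
have -> : (fun t : R => eit t * 1 * (1 * eit t - z)^-1 ^+ 1) =
    fun t => (1 : R)%:C * eit t * ((1 : R)%:C * eit t - z)^-1.
  by apply/funext => t; rewrite rmorph1 expr1 mulr1 !mul1r.
by rewrite circle_int_kernel1//; ring.
Qed.

Definition poisson z t : R := (1 - cabs z ^+ 2) / cabs (eit t - z) ^+ 2.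

Lemma Re_schwarz_kernel z t : in_disc z ->
  complex.Re ((eit t + z) / (eit t - z)) = poisson z t.
Proof.
move=> z1; rewrite cReM cReV cImV /poisson.
rewrite !(cReD, cImD, cReN, cImN)/= (cabs_sqr z).
by rewrite -[X in X - (_ + _)](cos2Dsin2 t); ring.
Qed.

Lemma Im_schwarz_kernel_real (r t : R) : 0 <= r < 1 ->
  complex.Im ((eit t + r%:C) / (eit t - r%:C)) =
  - (2 * r * sin t) / (1 - 2 * r * cos t + r ^+ 2).
Proof.
move=> /andP[r0 r1].
have z1 : in_disc r%:C by rewrite /in_disc cabs_real ger0_norm.
have n0 := eit_neq t z1.
have E : cabs (eit t - r%:C) ^+ 2 = 1 - 2 * r * cos t + r ^+ 2.
  rewrite cabs_sqr !(cReD, cImD, cReN, cImN)/=.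
  by rewrite -[X in _ = X - _ + _](cos2Dsin2 t); ring.
rewrite cImM cReV cImV -E.
have := cabs_eq0 (eit t - r%:C); rewrite (negPf n0) => /negbT m0.
rewrite !(cReD, cImD, cReN, cImN)/=.
by field.
Qed.

Lemma poisson_ge0 z t : in_disc z -> 0 <= poisson z t.
Proof.
move=> z1; apply: divr_ge0; last exact: sqr_ge0.
by rewrite subr_ge0 exprn_ile1 ?cabs_ge0// ltW.
Qed.

Lemma poisson_integral z : in_disc z ->
  mu.-integrable I (EFin \o poisson z) /\ Rintegral mu I (poisson z) = 2 * pi.
Proof.
move=> z1.
have E : (fun t => complex.Re ((eit t + z) / (eit t - z))) = poisson z.
  by apply/funext => t; exact: Re_schwarz_kernel.
split.
  by rewrite -E; have [] := bmeas_integrable (ccont_bmeas (ccont_schwarz_kernel z1)).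
have := schwarz1 z1; rewrite circle_intE E => /(congr1 (fun x => complex.Re x))/= H.
have p := @twopi_gt0 R.
by apply: (mulfI (invr_neq0 (lt0r_neq0 p))); rewrite H mulVf ?lt0r_neq0.
Qed.

(** The real part is a Poisson average of u. After exponentiation this keeps both the function and
    its inverse bounded. *)
Lemma Re_schwarz u z : density u -> in_disc z -> 0 <= complex.Re (schwarz u z) <= 1.
Proof.
move=> du z1; have [ip Ip] := poisson_integral z1.
have [_ u01] := du; have p := @twopi_gt0 R.
rewrite /schwarz circle_intE/=.
have E : (fun t => complex.Re ((eit t + z) / (eit t - z) * (u t)%:C)) =
    fun t => poisson z t * u t.
  by apply/funext => t; rewrite cReM/= mulr0 subr0 Re_schwarz_kernel.
have [iu _] := bmeas_integrable (bmeas_schwarz du z1).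
rewrite E in iu *; apply/andP; split.
  rewrite mulr_ge0 ?invr_ge0 ?(ltW p)//; apply: Rintegral_ge0 => t _.
  by rewrite mulr_ge0 ?poisson_ge0//; have /andP[] := u01 t.
rewrite mulrC ler_pdivrMr// mul1r.
apply: (@le_trans _ _ (Rintegral mu I (poisson z))); last by rewrite Ip.
apply: le_Rintegral => // t _.
by rewrite -[leRHS]mulr1 ler_wpM2l ?poisson_ge0//; have /andP[] := u01 t.
Qed.

(** On the circle |zeta - z|^(-2) is the Poisson kernel divided by 1 - |z|^2, and the Poisson kernel
    has mean 1. With the factor 2 lost in [circle_int_le_Rintegral] the left-hand side is at most 4
    / (1 + |z|). *)
Lemma schwarz_deriv_bound u z : density u -> in_disc z ->
  (1 - cabs z) * cabs (schwarz_deriv u z) <= 4.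
Proof.
move=> du z1; have [ip Ip] := poisson_integral z1; have [_ u01] := du.
have c0 := cabs_ge0 z; rewrite /in_disc in z1.
have q0 : 0 < 1 - cabs z ^+ 2 by rewrite subr_gt0 expr_lt1.
have iq : mu.-integrable I (EFin \o (fun t => (1 - cabs z ^+ 2)^-1 * poisson z t)).
  rewrite (_ : EFin \o _ =
    (fun t => (1 - cabs z ^+ 2)^-1%:E * (EFin \o poisson z) t)%E)//.
  by apply: integrableZl => //; exact: measI.
have : cabs (cauchy_int 1 (fun t => eit t * (u t)%:C) 2 z) <= 2 / (1 - cabs z ^+ 2).
  apply: (le_trans (circle_int_le_Rintegral (bmeas_kernel 2 (density_psi du) z1) iq _)).
    move=> t _; rewrite rmorph1 mul1r /poisson mulKf ?gt_eqF//.
    rewrite cabsM cabsM cabs_eit mul1r cabs_real cabsX cabsV exprVn.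
    have /andP[a b] := u01 t; rewrite ger0_norm// -[leRHS]mul1r ler_wpM2r//.
    by rewrite invr_ge0 sqr_ge0.
  rewrite RintegralZl// Ip; have pf (p x : R) : p != 0 -> p^-1 * (x * (2 * p)) = 2 * x.
    by move=> p0; rewrite mulrC -mulrA mulfK// mulrC.
  by rewrite pf// pi_neq0.
rewrite /schwarz_deriv cabsM cabs2 => H.
have w0 : 0 <= 1 - cabs z by rewrite subr_ge0 ltW.
apply: (@le_trans _ _ ((1 - cabs z) * (2 * (2 / (1 - cabs z ^+ 2))))).
  by rewrite ler_wpM2l// ler_wpM2l.
rewrite (_ : (1 - cabs z) * _ = 4 / (1 + cabs z)).
  by rewrite ler_pdivrMr; lra.
have n1 : 1 - cabs z != 0 by rewrite gt_eqF// subr_gt0.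
have n2 : 1 + cabs z != 0 by rewrite gt_eqF//; lra.
by rewrite -[X in X - cabs z ^+ 2](expr1n _ 2) subr_sqr; field; rewrite n1 n2.
Qed.

Lemma schwarz_regular u : density u -> regular (schwarz u) (schwarz_deriv u).
Proof.
move=> du; split.
- by move=> z; exact: schwarz_cderiv.
- by move=> z; exact: schwarz_deriv_cderiv.
move=> rho rho1; exists (2 * (2 / (1 - rho)) + 4 / (1 - rho)) => z zr.
have z1 : in_disc z by rewrite /in_disc; lra.
have q0 : 0 < 1 - rho by rewrite subr_gt0.
split.
  apply: (@le_trans _ _ (2 * (2 / (1 - rho)))); last by rewrite lerDl divr_ge0// ltW.
  apply: circle_int_bound; first exact: bmeas_schwarz.
  move=> t _; rewrite cabsM cabsf cabs_real -[leRHS]mulr1 ler_pM ?divr_ge0 ?cabs_ge0//.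
    have h1 : cabs (eit t + z) <= 2.
      by apply: (le_trans (cabsD _ _)); rewrite cabs_eit; lra.
    have h2 : 1 - rho <= cabs (eit t - z).
      by have := cabs_dist (eit t) z; rewrite cabs_eit; lra.
    rewrite ler_pM ?invr_ge0 ?cabs_ge0// lef_pV2// posrE; lra.
  by have [_ u01] := du; have /andP[a b] := u01 t; rewrite ger0_norm.
have := schwarz_deriv_bound du z1; have := cabs_ge0 (schwarz_deriv u z) => c0 H.
have : cabs (schwarz_deriv u z) <= 4 / (1 - rho).
  rewrite ler_pdivlMr// mulrC; apply: le_trans H.
  by rewrite ler_wpM2r//; lra.
have : 0 <= 2 * (2 / (1 - rho)) by rewrite mulr_ge0// divr_ge0// ltW.
lra.
Qed.

Lemma Rintegral_indic_restrict (f : R -> R) (J : set R) : measurable J -> J `<=` I ->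
  Rintegral mu I (fun t => f t * \1_J t) = Rintegral mu J f.
Proof.
move=> mJ JI; have -> : Rintegral mu J f = Rintegral mu (I `&` J) f.
  congr Rintegral; apply/seteqP; split=> [t Jt|t []//].
  by split=> //; exact: JI.
rewrite Rintegral_mkcondr; apply: eq_Rintegral => t _.
rewrite /patch indicE; case: (t \in J); last by rewrite mulr0.
by rewrite mulr1.
Qed.

Lemma density_indic (E : set R) : measurable E -> density (\1_E : R -> R).
Proof.
move=> mE; split; first exact: measurable_indic.
by move=> t; rewrite indicE; case: (t \in E); rewrite ?ler01 ?lexx.
Qed.

(** On the radius ending at 1, an end point of the half-circle, the imaginary part integrates the
    conjugate Poisson kernel over [0, pi]. Its primitive is -ln |eit t - r|^2, so the integral
    diverges like ln (1 - r). *)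
Lemma schwarz_half_unbounded (M : R) : exists2 z : C, in_disc z &
  M < cabs (schwarz \1_(`[0, pi]%classic : set R) z).
Proof.
(* Then ln (1 - r) = -(pi |M| + 1), and the integral, 2 ln (1 - r) - 2 ln (1 + r), exceeds 2 pi |M|
   in absolute value. *)
pose r : R := 1 - expR (- (pi * `|M| + 1)).
have pp := @pi_gt0 R.
have pM : 0 <= pi * `|M| by rewrite mulr_ge0// ltW.
have eM1 : expR (- (pi * `|M| + 1)) < 1.
  by rewrite -[ltRHS](@expR0 R) ltr_expR; lra.
have eM0 := @expR_gt0 R (- (pi * `|M| + 1)).
have r0 : 0 < r by rewrite /r; lra.
have r1 : r < 1 by rewrite /r; lra.
have z1 : in_disc r%:C by rewrite /in_disc cabs_real ger0_norm// ltW.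
exists r%:C => //.
have mJ : measurable (`[0, pi]%classic : set R) by exact: measurable_itv.
have JI : `[0, pi]%classic `<=` I.
  by move=> t; rewrite /= !in_itv/= => /andP[t0 t1]; rewrite t0; lra.
pose q t : R := 1 - 2 * r * cos t + r ^+ 2.
have q0 t : 0 < q t.
  have : 0 < cabs (eit t - r%:C) ^+ 2 by rewrite exprn_gt0// cabs_gt0 eit_neq.
  rewrite cabs_sqr !(cReD, cImD, cReN, cImN)/=.
  rewrite (_ : q t = (cos t - r) ^+ 2 + (sin t - 0) ^+ 2)//.
  by rewrite /q -[X in X - _ + _](cos2Dsin2 t); ring.
have cq : continuous q.
  move=> t; apply: cvgD; last exact: cvg_cst.
  apply: cvgB; first exact: cvg_cst.
  by apply: cvgM; [exact: cvg_cst|exact: continuous_cos].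
have : Rintegral mu `[0, pi]%classic (fun t => - (2 * r * sin t) / q t) =
    - ln (q pi) - - ln (q 0).
  apply: (@FTC2_real _ _ (fun t => - ln (q t))) => //.
    move=> t; apply: cvgM; last by apply: cvgV; [rewrite gt_eqF|exact: cq].
    by apply: cvgN; apply: cvgM; [exact: cvg_cst|exact: continuous_sin].
  move=> t.
  have dq : is_derive t 1 q (2 * r * sin t).
    have -> : q = (fun t => (1 + r ^+ 2) + (- (2 * r)) * cos t).
      by apply/funext => s; rewrite /q; ring.
    apply: is_derive_eq; rewrite /GRing.scale/=; ring.
  have dl := is_derive1_comp (is_derive1_ln (q0 t)) dq.
  have dn := is_deriveN dl.
  rewrite (_ : _ / _ = - ((q t)^-1 * (2 * r * sin t))); first exact: dn.
  by rewrite mulNr mulrC.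
have -> : q pi = (1 + r) ^+ 2 by rewrite /q (@cospi R); ring.
have -> : q 0 = (1 - r) ^+ 2 by rewrite /q cos0; ring.
have E1 : 1 - r = expR (- (pi * `|M| + 1)) by rewrite /r; ring.
rewrite !lnXn ?E1//; last by lra.
rewrite expRK => HI.
have l0 : 0 <= ln (1 + r) by apply: ln_ge0; lra.
have Im_h : complex.Im (schwarz \1_(`[0, pi]%classic : set R) r%:C) =
    (2 * pi)^-1 * Rintegral mu `[0, pi]%classic (fun t => - (2 * r * sin t) / q t).
  have ImE (F : R -> C) : complex.Im (circle_int F) =
      (2 * pi)^-1 * Rintegral mu I (fun t => complex.Im (F t)) by rewrite circle_intE.
  rewrite /schwarz ImE; congr (_ * _).
  rewrite -(Rintegral_indic_restrict _ mJ JI); congr Rintegral; apply/funext => t.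
  rewrite cImM Im_schwarz_kernel_real ?(ltW r0)//.
  by rewrite [complex.Im _%:C]/= [complex.Re _%:C]/= mulr0 add0r.
apply: lt_le_trans (norm_Im_le _); rewrite Im_h HI.
set L := - _ - - _.
have : L <= - 2 * (pi * `|M| + 1) by rewrite /L; lra.
move=> HL; have p2 := @twopi_gt0 R.
rewrite normrM gtr0_norm ?invr_gt0// mulrC ltr_pdivlMr//.
have := ler_norm M; have := ler_norm (- L); rewrite normrN => n1 n2.
have : M * (2 * pi) <= `|M| * (2 * pi) by rewrite ler_wpM2r// ltW.
lra.
Qed.

End SchwarzIntegral.

(** * The set E and the size of S' above the centers of the arcs *)

Section OscillatingSet.
Context {R : realType}.
Local Notation C := R[i].
Local Notation mu := (@lebesgue_measure R).
Local Notation I := (`[0, 2 * pi]%classic : set R).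
Implicit Types (k : nat) (t : R).

(** Small enough for the error terms in [schwarz_deriv_osc] to leave a definite part of the main
    term. *)
Definition osc_eps : R := 100^-1.

(** This is sin(x/2)^2. Twice it bounds from below the squared distance from a point of modulus at
    least 1/2 to the points of the circle seen at an angle between x and pi from it. *)
Definition cos_gap (x : R) : R := (1 - cos x) / 2.

(** The inner product is [height k'] unfolded, as [height] is defined from [arc_len]. The factor
    [osc_eps] makes the next arcs negligible at that height; within [height], the factor [osc_eps]
    times [cos_gap] makes the part off the arc negligible. *)
Fixpoint arc_len k : R :=
  if k is k'.+1
  then osc_eps * (osc_eps * arc_len k' * cos_gap (arc_len k')) else 1.

Definition height k : R := osc_eps * arc_len k * cos_gap (arc_len k).

(* Every rational is the center of infinitely many arcs. *)
Definition arc_center k : R :=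
  if @unpickle (rat * nat)%type k is Some (q, _) then ratr q else 0.

Definition arc k : set R := `[arc_center k - arc_len k, arc_center k + arc_len k].

Definition half_arc k : set R := `[arc_center k, arc_center k + arc_len k].

Definition later_arcs k : set R := \bigcup_i arc (k.+1 + i).

(** A point that lies in a last arc is decided by that arc alone, whatever the earlier arcs say. *)
Definition osc_set : set R := \bigcup_k (half_arc k `\` later_arcs k).

Definition osc_point k : C := (1 - height k)%:C * eit (arc_center k).

Lemma osc_epsE : osc_eps = 100^-1. Proof. by []. Qed.

Lemma cos_gap_bounds (x : R) : 0 < x <= 1 -> 0 < cos_gap x <= 1.
Proof.
move=> /andP[x0 x1]; have p2 := @pi_ge2 R.
have sx : 0 < sin x by apply: sin_gt0_pi; apply/andP; split; lra.
have cs := cos2Dsin2 x; have cm := cos_geN1 x.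
have s2 : 0 < sin x ^+ 2 by rewrite exprn_gt0.
have c1 : cos x < 1.
  rewrite ltNge; apply/negP => c1.
  have : 1 <= cos x ^+ 2 by rewrite expr2 -[1]mulr1 ler_pM.
  lra.
by rewrite /cos_gap; apply/andP; split; lra.
Qed.

Lemma arc_len_bounds k : 0 < arc_len k <= 1.
Proof.
elim: k => [|k /[dup] IH /andP[a0 a1]]; first by rewrite /= ltr01 lexx.
have /andP[c0 c1] := cos_gap_bounds IH.
have e0 : 0 < osc_eps by rewrite osc_epsE; lra.
have e1 : osc_eps <= 1 by rewrite osc_epsE; lra.
apply/andP; split; first exact: mulr_gt0 e0 (mulr_gt0 (mulr_gt0 e0 a0) c0).
rewrite /= -[leRHS]mulr1 ler_pM ?mulr_ge0 ?(ltW e0) ?(ltW a0) ?(ltW c0)//.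
rewrite -[leRHS]mulr1 ler_pM ?mulr_ge0 ?(ltW e0) ?(ltW a0) ?(ltW c0)//.
by rewrite -[leRHS]mulr1 ler_pM ?(ltW e0) ?(ltW a0).
Qed.

Lemma height_bounds k : [/\ 0 < height k, height k <= osc_eps * arc_len k &
  height k <= osc_eps * cos_gap (arc_len k)].
Proof.
have /andP[a0 a1] := arc_len_bounds k.
have /andP[c0 c1] := cos_gap_bounds (arc_len_bounds k).
have e0 : 0 < osc_eps by rewrite osc_epsE; lra.
split; first exact: mulr_gt0 (mulr_gt0 e0 a0) c0.
  by rewrite /height -[leRHS]mulr1 ler_wpM2l// mulr_ge0 ?(ltW e0) ?(ltW a0).
rewrite /height -mulrA ler_wpM2l ?(ltW e0)// -[leRHS]mul1r.
by rewrite ler_wpM2r// ltW.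
Qed.

Lemma arc_lenS k : arc_len k.+1 = osc_eps * height k.
Proof. by []. Qed.

Lemma arc_len_halves k i : arc_len (k + i) <= arc_len k / 2 ^+ i.
Proof.
elim: i => [|i IH]; first by rewrite addn0 expr0 divr1.
rewrite addnS arc_lenS; have [h0 h1 _] := height_bounds (k + i).
have /andP[a0 _] := arc_len_bounds (k + i).
apply: (@le_trans _ _ (2^-1 * arc_len (k + i))); last first.
  rewrite (_ : _ / _ = 2^-1 * (arc_len k / 2 ^+ i)) ?ler_wpM2l//.
  by rewrite exprS invfM mulrCA.
rewrite osc_epsE in h1 *; lra.
Qed.

Lemma mu_segment (a b : R) : a < b -> mu `[a, b]%classic = (b - a)%:E.
Proof. by move=> ab; rewrite lebesgue_measure_itv/= lte_fin ab. Qed.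

Lemma measurable_arc k : measurable (arc k). Proof. exact: measurable_itv. Qed.

Lemma measurable_half_arc k : measurable (half_arc k).
Proof. exact: measurable_itv. Qed.

Lemma measurable_later_arcs k : measurable (later_arcs k).
Proof. by apply: bigcupT_measurable => i; exact: measurable_arc. Qed.

Lemma measurable_osc_set : measurable osc_set.
Proof.
apply: bigcupT_measurable => k; apply: measurableD.
  exact: measurable_half_arc.
exact: measurable_later_arcs.
Qed.

(** Each arc measures twice its [arc_len], and these at least halve from one arc to the next. *)
Lemma mu_later_arcs k : (mu (later_arcs k) <= (4 * arc_len k.+1)%:E)%E.
Proof.
have /andP[a0 _] := arc_len_bounds k.+1.
apply: le_trans (epsilon_trick0 xpredT _); last by rewrite mulr_ge0// ltW.
apply: (@le_trans _ _ (\sum_(0 <= i <oo) mu (arc (k.+1 + i)))%E).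
  apply: measure_sigma_subadditive => //.
  - by move=> i; exact: measurable_arc.
  - exact: measurable_later_arcs.
apply: lee_nneseries => // i _.
have /andP[b0 _] := arc_len_bounds (k.+1 + i).
have lt : arc_center (k.+1 + i) - arc_len (k.+1 + i) < arc_center (k.+1 + i) + arc_len (k.+1 + i).
  lra.
rewrite /arc mu_segment// lee_fin natrX exprS invfM.
have := arc_len_halves k.+1 i.
move: (arc_len (k.+1 + i)) (arc_len k.+1) (arc_center _) => a b c; lra.
Qed.

(** A later half-arc cannot contain t by assumption; an earlier one contributes nothing at t, since
    [arc k] was removed from it. *)
Lemma osc_set_arc k t : arc k t -> ~ later_arcs k t ->
  \1_osc_set t = \1_(half_arc k) t :> R.
Proof.
move=> tJ tV; rewrite !indicE; congr (_%:R); congr nat_of_bool.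
apply/idP/idP => /set_mem H; apply/mem_set; last by exists k.
case: H => k' _ [tk' tV'].
have sub : arc k' t.
  move: tk'; rewrite /half_arc /arc /= !in_itv/= => /andP[h1 h2].
  by have /andP[b0 _] := arc_len_bounds k'; apply/andP; split; lra.
case: (ltngtP k k') => [kk|kk|-> //].
  by case: tV; exists (k' - k.+1)%N => //; rewrite subnKC.
by case: tV'; exists (k - k'.+1)%N => //; rewrite subnKC.
Qed.

Lemma ccont_indic_FTC (F G : R -> C) (a b : R) : 0 <= a -> a < b -> b <= 2 * pi ->
  ccont F -> (forall t, is_rderiv G t (F t)) ->
  circle_int (fun t => F t * (\1_(`[a, b]%classic : set R) t)%:C) =
  (G b - G a) / (2 * pi)%:C.
Proof.
move=> a0 ab b2 [c1 c2] dG.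
have mJ : measurable (`[a, b]%classic : set R) by exact: measurable_itv.
have JI : `[a, b]%classic `<=` I.
  by move=> t; rewrite /= !in_itv/= => /andP[t0 t1]; apply/andP; split; lra.
have dR (t : R) : is_derive t 1 (fun s => complex.Re (G s)) (complex.Re (F t)).
  by have /is_rderivP[] := dG t.
have dI (t : R) : is_derive t 1 (fun s => complex.Im (G s)) (complex.Im (F t)).
  by have /is_rderivP[] := dG t.
rewrite circle_intE -[(2 * pi)%:C^-1]fmorphV/=.
have -> : (fun t => complex.Re (F t * (\1_(`[a, b]%classic : set R) t)%:C)) =
    fun t => complex.Re (F t) * \1_(`[a, b]%classic : set R) t.
  by apply/funext => t; rewrite cReM/= mulr0 subr0.
have -> : (fun t => complex.Im (F t * (\1_(`[a, b]%classic : set R) t)%:C)) =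
    fun t => complex.Im (F t) * \1_(`[a, b]%classic : set R) t.
  by apply/funext => t; rewrite cImM/= mulr0 add0r.
rewrite !Rintegral_indic_restrict// (FTC2_real ab c1 dR) (FTC2_real ab c2 dI).
by apply: complex_ext; rewrite ?(cReM, cImM, cReD, cImD, cReN, cImN)/=; ring.
Qed.

Lemma circle_dist_sqr (rho tau t : R) :
  cabs (eit t - rho%:C * eit tau) ^+ 2 = 1 - 2 * rho * cos (t - tau) + rho ^+ 2.
Proof.
rewrite cabs_sqr !(cReD, cImD, cReN, cImN, cReM, cImM)/= cosB.
rewrite -[X in _ = X - _ + _](cos2Dsin2 t) -[rho ^+ 2]mulr1 -[X in rho ^+ 2 * X](cos2Dsin2 tau).
ring.
Qed.

(** Here x is a difference of two parameters in [0, 2 pi], not an angle: beyond pi it is reflected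
    to 2 pi - |x| before monotonicity of cos on [0, pi] applies. *)
Lemma cos_le_off (x eta : R) : 0 < eta <= 1 -> eta <= `|x| <= 2 * pi - eta ->
  cos x <= cos eta.
Proof.
move=> /andP[e0 e1] /andP[h1 h2]; have p2 := @pi_ge2 R.
have -> : cos x = cos `|x| by case: (ger0P x) => // _; rewrite cosN.
have i2 : eta \in `[0, pi] by rewrite in_itv/=; apply/andP; split; lra.
have [hp|hp] := lerP `|x| pi.
  have i1 : `|x| \in `[0, pi] by rewrite in_itv/=; apply/andP; split; lra.
  by rewrite leNgt ltr_cos// -leNgt.
have -> : cos `|x| = cos (2 * pi - `|x|).
  have H : (2 * pi : R) = pi + pi by rewrite mulr_natl mulr2n.
  rewrite cosB {1 2}H cosD sinD (@cospi R) (@sinpi R).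
  by rewrite !(mulr0, mul0r, addr0, subr0) mulrNN !mul1r.
have i1 : 2 * pi - `|x| \in `[0, pi] by rewrite in_itv/=; apply/andP; split; lra.
by rewrite leNgt ltr_cos// -leNgt; lra.
Qed.

(** With rho the modulus of the point and c the cosine of the angle, the squared distance is (1 -
    rho)^2 + 2 rho (1 - c), and rho is at least 1/2. *)
Lemma osc_point_dist k t : arc_len k <= `|t - arc_center k| <= 2 * pi - arc_len k ->
  2 * cos_gap (arc_len k) <= cabs (eit t - osc_point k) ^+ 2.
Proof.
move=> H; have := cos_le_off (arc_len_bounds k) H => cc.
rewrite /osc_point circle_dist_sqr.
have [h0 h1 h2] := height_bounds k.
have /andP[a0 a1] := arc_len_bounds k.
have e1 : height k <= 2^-1 by rewrite osc_epsE in h1; lra.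
set rho := 1 - height k; have r1 : 2^-1 <= rho by rewrite /rho; lra.
have c1 := cos_le1 (arc_len k).
have : 0 <= (1 - rho) ^+ 2 by exact: sqr_ge0.
have : 0 <= (rho - 2^-1) * (1 - cos (arc_len k)) by rewrite mulr_ge0; lra.
have : rho * cos (t - arc_center k) <= rho * cos (arc_len k) by rewrite ler_wpM2l//; lra.
rewrite /cos_gap; nra.
Qed.

Lemma osc_point_abs k : cabs (osc_point k) = 1 - height k.
Proof.
have [h0 h1 _] := height_bounds k; have /andP[a0 a1] := arc_len_bounds k.
rewrite osc_epsE in h1; rewrite /osc_point cabs_circle//; lra.
Qed.

Lemma osc_point_disc k : in_disc (osc_point k).
Proof. by rewrite /in_disc osc_point_abs; have [h0 _ _] := height_bounds k; lra. Qed.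

Lemma osc_point_dist_ge k t : height k <= cabs (eit t - osc_point k).
Proof.
have := cabs_dist (eit t) (osc_point k); rewrite cabs_eit osc_point_abs; lra.
Qed.

(** The kernel of half of [schwarz_deriv] at [osc_point k]; the factor 1 keeps the shape of
    [cauchy_int] at radius 1. *)
Let ker k t : C := eit t * ((1 : R)%:C * eit t - osc_point k)^-1 ^+ 2.

Let ccont_ker k : ccont (ker k).
Proof.
apply: ccontM ccont_eit _; apply: ccontX; apply: ccont_kernel.
exact: osc_point_disc.
Qed.

Let ker_abs k t : cabs (ker k t) = (cabs (eit t - osc_point k) ^+ 2)^-1.
Proof. by rewrite /ker cabsM cabs_eit mul1r rmorph1 mul1r cabsX cabsV exprVn. Qed.

(** The main term, exact through the primitive of the kernel: at the center of the arc the distance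
    to the point is [height k], at the far end it is at least [cos_gap (arc_len k)]. *)
Lemma half_arc_part k : 0 <= arc_center k - arc_len k -> arc_center k + arc_len k <= 2 * pi ->
  (2 * pi)^-1 * ((height k)^-1 - (cos_gap (arc_len k))^-1) <=
  cabs (circle_int (fun t => ker k t * (\1_(half_arc k) t)%:C)).
Proof.
move=> c0 c2; have /andP[a0 a1] := arc_len_bounds k.
have [h0 h1 h2] := height_bounds k.
have /andP[g0 g1] := cos_gap_bounds (arc_len_bounds k).
rewrite (ccont_indic_FTC (G := fun s => 'i * ((1 : R)%:C * eit s - osc_point k)^-1)).
- rewrite -mulrBr cabsf cabsM (_ : cabs 'i = 1); last first.
    by rewrite cabsE/= expr0n add0r expr1n sqrtr1.
  rewrite mul1r cabs_real gtr0_norm ?twopi_gt0// mulrC.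
  rewrite ler_wpM2r ?invr_ge0 ?(ltW (@twopi_gt0 R))// cabs_distC.
  apply: le_trans (cabs_dist _ _); rewrite !cabsV rmorph1 !mul1r lerB//.
    have -> // : cabs (eit (arc_center k) - osc_point k) = height k.
    rewrite /osc_point rmorphB rmorph1 mulrBl mul1r subKr cabs_circle// ltW//.
  have d2 : 2 * cos_gap (arc_len k) <=
      cabs (eit (arc_center k + arc_len k) - osc_point k) ^+ 2.
    apply: osc_point_dist; rewrite addrC addKr gtr0_norm// lexx/=.
    have := @pi_ge2 R; lra.
  have d0 := cabs_ge0 (eit (arc_center k + arc_len k) - osc_point k).
  set d := cabs _ in d2 d0 *.
  have dg : cos_gap (arc_len k) <= d.
    rewrite leNgt; apply/negP => dl.
    have : d ^+ 2 <= cos_gap (arc_len k) * 1.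
      by rewrite expr2 ler_pM// ?ltW//; apply: (lt_le_trans dl).
    lra.
  by rewrite lef_pV2// posrE; lra.
- lra.
- lra.
- by [].
- exact: ccont_ker.
move=> t; have := is_rderiv_kernel t (osc_point_disc k).
by rewrite /ker rmorph1 mul1r.
Qed.

(** Three regions. On the later arcs the kernel is at most h^(-2) and the measure at most 4
    [osc_eps] h; on the rest of the k-th arc the two indicator functions agree; off the arc the
    kernel is at most 1 / (2 [cos_gap]). The majorant [f] collects these bounds. *)
Lemma rest_part k : 0 <= arc_center k - arc_len k -> arc_center k + arc_len k <= 2 * pi ->
  cabs (circle_int (fun t => ker k t * (\1_osc_set t - \1_(half_arc k) t)%:C)) <=
  (cos_gap (arc_len k))^-1 + 4 * osc_eps * pi^-1 * (height k)^-1.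
Proof.
move=> c0 c2; have /andP[a0 a1] := arc_len_bounds k.
have [h0 h1 h2] := height_bounds k.
have /andP[g0 g1] := cos_gap_bounds (arc_len_bounds k).
have mE : measurable_fun I (\1_osc_set : R -> R).
  exact: measurable_indic measurable_osc_set.
have mH : measurable_fun I (\1_(half_arc k) : R -> R).
  exact: measurable_indic (measurable_half_arc k).
have ind01 (A : set R) t : 0 <= (\1_A t : R) <= 1.
  by rewrite indicE; case: (t \in A); rewrite ?ler01 ?lexx.
have dif1 t : `|\1_osc_set t - \1_(half_arc k) t : R| <= 1.
  have /andP[x0 x1] := ind01 osc_set t; have /andP[y0 y1] := ind01 (half_arc k) t.
  by rewrite ler_norml; apply/andP; split; lra.
pose f t : R := (2 * cos_gap (arc_len k))^-1 + (height k ^+ 2)^-1 * \1_(later_arcs k) t.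
have mV := measurable_later_arcs k.
have iV : mu.-integrable I (EFin \o (\1_(later_arcs k) : R -> R)).
  apply: bounded_integrable; first exact: measurable_indic.
  by exists 1 => t _; have /andP[x0 x1] := ind01 (later_arcs k) t; rewrite ger0_norm.
have h2i : 0 <= (height k ^+ 2)^-1 by rewrite invr_ge0 sqr_ge0.
have c2i : 0 <= (2 * cos_gap (arc_len k))^-1 by rewrite invr_ge0 mulr_ge0// ltW.
have iV2 : mu.-integrable I
    (EFin \o (fun t => (height k ^+ 2)^-1 * (\1_(later_arcs k) t : R))).
  rewrite (_ : EFin \o _ =
    (fun t => (height k ^+ 2)^-1%:E * (EFin \o (\1_(later_arcs k) : R -> R)) t)%E)//.
  by apply: integrableZl => //; exact: measI.
have ic : mu.-integrable I (EFin \o (fun=> (2 * cos_gap (arc_len k))^-1)).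
  apply: bounded_integrable; first exact: measurable_cst.
  by exists `|(2 * cos_gap (arc_len k))^-1|.
have if_ : mu.-integrable I (EFin \o f).
  apply: bounded_integrable.
    apply: measurable_funD; first exact: measurable_cst.
    by apply: measurable_funM; [exact: measurable_cst|exact: measurable_indic].
  exists ((2 * cos_gap (arc_len k))^-1 + (height k ^+ 2)^-1) => t _.
  have /andP[x0 x1] := ind01 (later_arcs k) t.
  rewrite ger0_norm /f; last by rewrite addr_ge0// mulr_ge0.
  by rewrite lerD2l -[leRHS]mulr1 ler_wpM2l.
have IV : Rintegral mu I (\1_(later_arcs k) : R -> R) <= 4 * arc_len k.+1.
  have b0 : 0 <= 4 * arc_len k.+1.
    by have /andP[z0 _] := arc_len_bounds k.+1; rewrite mulr_ge0// ltW.
  rewrite /Rintegral integral_indic//.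
  have : (mu (later_arcs k `&` I) <= (4 * arc_len k.+1)%:E)%E.
    apply: le_trans (mu_later_arcs k); apply: le_measure; rewrite ?inE//.
    by apply: measurableI => //; exact: measI.
  move=> H; rewrite -lee_fin fineK//.
  by rewrite ge0_fin_numE// (le_lt_trans H)// ltry.
have If : Rintegral mu I f <=
    pi * (cos_gap (arc_len k))^-1 + 4 * osc_eps * (height k)^-1.
  rewrite /f RintegralD// RintegralZl//.
  rewrite Rintegral_I_cst lerD//.
    rewrite (_ : _ * _ = pi * (cos_gap (arc_len k))^-1)//.
    by rewrite invfM; move: pi => p; field; rewrite gt_eqF.
  apply: (@le_trans _ _ ((height k ^+ 2)^-1 * (4 * arc_len k.+1))).
    by rewrite ler_wpM2l// invr_ge0 sqr_ge0.
  rewrite arc_lenS le_eqVlt; apply/orP; left; apply/eqP.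
  by field; rewrite gt_eqF.
have mF : bmeas (fun t => ker k t * (\1_osc_set t - \1_(half_arc k) t)%:C).
  apply: bmeasM; first exact: ccont_bmeas (ccont_ker k).
  by apply: bmeas_real; [exact: measurable_funB|exists 1 => t _].
apply: (le_trans (circle_int_le_Rintegral mF if_ _)).
  move=> t tI; have /andP[t0 t2] : 0 <= t <= 2 * pi by move/set_mem : tI; rewrite /= in_itv.
  rewrite cabsM cabs_real ker_abs.
  have [tV|tV] := boolP (t \in later_arcs k).
    rewrite /f [\1_(later_arcs k) t]indicE tV mulr1.
    apply: (@le_trans _ _ ((height k ^+ 2)^-1)); last by rewrite lerDr.
    rewrite -[leRHS]mulr1 ler_pM ?invr_ge0 ?sqr_ge0// lef_pV2 ?posrE ?exprn_gt0//.
      by rewrite lerXn2r ?nnegrE ?cabs_ge0 ?(ltW h0)// osc_point_dist_ge.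
    by apply: lt_le_trans (osc_point_dist_ge k t).
  rewrite /f [\1_(later_arcs k) t]indicE (negPf tV) mulr0 addr0.
  have [tJ|tJ] := boolP (t \in arc k).
    rewrite (@osc_set_arc k) ?subrr ?normr0 ?mulr0//; first exact: set_mem.
    by move=> /mem_set; apply/negP.
  have off : arc_len k <= `|t - arc_center k|.
    rewrite leNgt; apply/negP; rewrite ltr_norml => /andP[x1 x2].
    move/negP: tJ; apply; apply/mem_set; rewrite /arc /= in_itv/=.
    by apply/andP; split; lra.
  have off2 : `|t - arc_center k| <= 2 * pi - arc_len k.
    by rewrite ler_norml; apply/andP; split; lra.
  have D := @osc_point_dist k t; rewrite off off2 in D; have {}D := D isT.
  rewrite -[leRHS]mulr1 ler_pM ?invr_ge0 ?sqr_ge0// lef_pV2// posrE.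
    by apply: lt_le_trans D; rewrite mulr_gt0.
  by rewrite mulr_gt0.
have p0 := @pi_gt0 R.
apply: (@le_trans _ _ (pi^-1 *
    (pi * (cos_gap (arc_len k))^-1 + 4 * osc_eps * (height k)^-1))).
  by rewrite ler_wpM2l// invr_ge0 ltW.
rewrite mulrDr mulKf ?gt_eqF// lerD2l le_eqVlt; apply/orP; left; apply/eqP.
by rewrite mulrCA !mulrA.
Qed.

(** After multiplication by the height, the main term is at least (1 - eps) / (2 pi) and the error
    at most eps + 4 eps / pi. With eps = 1/100 and 1 / pi at least 1/4, twice the difference exceeds
    1/8. *)
Lemma schwarz_deriv_osc k : 0 <= arc_center k - arc_len k -> arc_center k + arc_len k <= 2 * pi ->
  8^-1 <= (1 - cabs (osc_point k)) * cabs (schwarz_deriv \1_osc_set (osc_point k)).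
Proof.
move=> c0 c2; have HA := half_arc_part c0 c2; have HB := rest_part c0 c2.
have /andP[g0 g1] := cos_gap_bounds (arc_len_bounds k).
have [h0 h1 h2] := height_bounds k.
rewrite osc_point_abs (_ : 1 - (1 - height k) = height k); last by ring.
set A := circle_int _ in HA; set B := circle_int _ in HB.
have dE := @density_indic R _ measurable_osc_set.
have dH := @density_indic R _ (measurable_half_arc k).
have E : schwarz_deriv \1_osc_set (osc_point k) = 2 * (A + B).
  rewrite /schwarz_deriv; congr (_ * _); rewrite /A /B -circle_intD.
  - congr circle_int; apply/funext => t; rewrite /ker rmorphB; ring.
  - apply: bmeasM; first exact: ccont_bmeas (ccont_ker k).
    exact: density_bmeas.
  apply: bmeasM; first exact: ccont_bmeas (ccont_ker k).
  rewrite (_ : (fun t => _) = fun t => (\1_osc_set t)%:C + -1 * (\1_(half_arc k) t)%:C).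
    by apply: bmeasD; [exact: density_bmeas|apply: bmeasZ; exact: density_bmeas].
  by apply/funext => t; rewrite rmorphB mulN1r.
have cAB : cabs A - cabs B <= cabs (A + B).
  by rewrite -{2}[B]opprK -(cabsN B) cabs_dist.
have cE : cabs (schwarz_deriv \1_osc_set (osc_point k)) = 2 * cabs (A + B).
  by rewrite E cabsM cabs2.
rewrite cE; have p0 := @pi_gt0 R.
have p4 : 4^-1 <= pi^-1 :> R.
  by rewrite lef_pV2 ?posrE//; have := @pihalf_lt2 R; lra.
have hV : height k * (height k)^-1 = 1 by rewrite mulfV// gt_eqF.
have hg : height k * (cos_gap (arc_len k))^-1 <= osc_eps by rewrite ler_pdivrMr.
have HA' : 2^-1 * pi^-1 * (1 - osc_eps) <= height k * cabs A.
  apply: (@le_trans _ _ (height k *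
     ((2 * pi)^-1 * ((height k)^-1 - (cos_gap (arc_len k))^-1)))); last first.
    by rewrite ler_wpM2l// ltW.
  rewrite [leRHS]mulrCA [X in _ <= _ * X]mulrBr hV invfM ler_wpM2l//; last by lra.
  by rewrite mulr_ge0// invr_ge0// ltW.
have HB' : height k * cabs B <= osc_eps + 4 * osc_eps * pi^-1.
  apply: (@le_trans _ _ (height k *
     ((cos_gap (arc_len k))^-1 + 4 * osc_eps * pi^-1 * (height k)^-1))).
    by rewrite ler_wpM2l// ltW.
  by rewrite mulrDr lerD// mulrCA hV mulr1.
have : height k * (cabs A - cabs B) <= height k * cabs (A + B).
  by rewrite ler_wpM2l// ltW.
rewrite osc_epsE in HA' HB'.
move: (pi^-1) p4 HA' HB' => P p4 HA' HB'; lra.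
Qed.

Lemma arc_center_recurs (q : rat) (K : nat) : exists2 k, (K <= k)%N & arc_center k = ratr q.
Proof.
have [m Hm] : exists m, (K <= @pickle (rat * nat)%type (q, m))%N.
  (* Otherwise K + 1 distinct codes would all lie below K. *)
  apply: contrapT => /forallNP H.
  pose s := [seq @pickle (rat * nat)%type (q, m) | m <- iota 0 K.+1].
  have us : uniq s.
    rewrite map_inj_uniq ?iota_uniq// => x y /(pcan_inj pickleK).
    by move=> [].
  have ss : {subset s <= iota 0 K}.
    move=> x /mapP[m _ ->]; rewrite mem_iota/= add0n ltnNge.
    by apply/negP; exact: H.
  by have := uniq_leq_size us ss; rewrite size_map !size_iota ltnn.
by exists (pickle (q, m)) => //; rewrite /arc_center pickleK.
Qed.

End OscillatingSet.

(** * Complex series dominated by a geometric series of ratio 1/4 *)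

Section GeometricSums.
Context {R : realType}.
Local Notation C := R[i].
Implicit Types (a b : nat -> C).

Lemma sum_geometric4 J m : \sum_(i < m) ((4 : R) ^+ (J + i))^-1 <= 4 / 3 / 4 ^+ J.
Proof.
suff -> : \sum_(i < m) ((4 : R) ^+ (J + i))^-1 = 4 / 3 * ((4 ^+ J)^-1 - (4 ^+ (J + m))^-1).
  by rewrite ler_wpM2l// lerBlDr lerDl invr_ge0 exprn_ge0.
elim: m => [|m IH]; first by rewrite big_ord0 addn0 subrr mulr0.
rewrite big_ord_recr/= IH addnS exprS.
by field; rewrite !expf_neq0.
Qed.

Lemma real_tail (u : nat -> R) (M : R) : (forall j, `|u j| <= M / 4 ^+ j) ->
  forall J, `|limn (series u) - \sum_(j < J) u j| <= 4 / 3 * M / 4 ^+ J.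
Proof.
move=> uM J.
have M0 : 0 <= M by have := uM 0%N; rewrite expr0 divr1; exact: le_trans.
have cu : cvgn (series u).
  apply: normed_cvg.
  apply: (@series_le_cvg _ _ (geometric M (4^-1))).
  - by move=> n; exact: normr_ge0.
  - by move=> n; rewrite /geometric/= mulr_ge0// exprn_ge0.
  - by move=> n; rewrite /geometric/= exprVn; exact: uM.
  by apply: is_cvg_geometric_series; rewrite ger0_norm; lra.
apply/ler_addgt0Pr => e e0.
move/cvgrPdist_le : cu => /(_ _ e0)[N _ HN].
have := HN (J + N)%N (leq_addl _ _); rewrite /series/= big_mkord => H1.
rewrite [leRHS]addrC; apply: (le_trans (ler_distD (\sum_(j < J + N) u j) _ _)).
rewrite lerD//.
rewrite -(big_mkord xpredT u) -(big_mkord xpredT u) (big_cat_nat _ (n := J))//=; last exact: leq_addr.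
rewrite addrAC subrr add0r -{1}[J]add0n big_addn addKn big_mkord.
apply: (le_trans (ler_norm_sum _ _ _)).
apply: (@le_trans _ _ (\sum_(i < N) M * ((4 : R) ^+ (J + i))^-1)).
  by apply: ler_sum => i _; rewrite [(i + J)%N]addnC uM.
rewrite -mulr_sumr (_ : 4 / 3 * M / _ = M * (4 / 3 / 4 ^+ J)); last by ring.
by rewrite ler_wpM2l// sum_geometric4.
Qed.

Lemma pow4_dominates (x e : R) : 0 < e -> exists J : nat, x / 4 ^+ J <= e.
Proof.
move=> e0; exists (Num.truncn (x / e)).+1.
have h : x / e < (Num.truncn (x / e)).+1%:R by exact: truncnS_gt.
rewrite ler_pdivrMr ?exprn_gt0// mulrC -ler_pdivrMr//.
by apply: (le_trans (ltW h)); rewrite -natrX ler_nat ltnW// ltn_expl.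
Qed.

(** Meaningful when both series converge; the lemmas below secure this by a bound M / 4^j on the
    terms. *)
Definition csum a : C := limn (series (fun j => complex.Re (a j))) +i*
  limn (series (fun j => complex.Im (a j))).

Lemma Re_sum J a : complex.Re (\sum_(j < J) a j) = \sum_(j < J) complex.Re (a j).
Proof. by elim: J => [|J IH]; rewrite ?big_ord0// !big_ord_recr/= cReD IH. Qed.

Lemma Im_sum J a : complex.Im (\sum_(j < J) a j) = \sum_(j < J) complex.Im (a j).
Proof. by elim: J => [|J IH]; rewrite ?big_ord0// !big_ord_recr/= cImD IH. Qed.

(** Real and imaginary parts each cost 4/3; their total 8/3 is rounded up to 4. *)
Lemma csum_tail a (M : R) : (forall j, cabs (a j) <= M / 4 ^+ j) ->
  forall J, cabs (csum a - \sum_(j < J) a j) <= 4 * M / 4 ^+ J.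
Proof.
move=> aM J; apply: (le_trans (cabs_le_ReIm _)).
rewrite cReD cImD cReN cImN Re_sum Im_sum /=.
have h1 := @real_tail (fun j => complex.Re (a j)) M
  (fun j => le_trans (norm_Re_le _) (aM j)) J.
have h2 := @real_tail (fun j => complex.Im (a j)) M
  (fun j => le_trans (norm_Im_le _) (aM j)) J.
apply: (le_trans (lerD h1 h2)).
have M0 : 0 <= M.
  by have := aM 0%N; rewrite expr0 divr1; apply: le_trans; exact: cabs_ge0.
have : 0 <= M / 4 ^+ J by rewrite divr_ge0// exprn_ge0.
lra.
Qed.

Lemma csum_bound a (M : R) : (forall j, cabs (a j) <= M / 4 ^+ j) ->
  cabs (csum a) <= 4 * M.
Proof. by move=> /csum_tail/(_ 0%N); rewrite big_ord0 subr0 expr0 divr1. Qed.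

(** Reduces identities between sums, linearity first of all, to geometric estimates on finite
    partial sums. *)
Lemma csum_unique a (M K : R) L : (forall j, cabs (a j) <= M / 4 ^+ j) ->
  (forall J, cabs (L - \sum_(j < J) a j) <= K / 4 ^+ J) -> L = csum a.
Proof.
move=> aM LK; apply/eqP; rewrite -subr_eq0 -cabs_eq0 -[_ == 0]negbK.
apply/negP => H; have {}H : 0 < cabs (L - csum a) by rewrite lt_def H cabs_ge0.
have B J : cabs (L - csum a) <= (K + 4 * M) / 4 ^+ J.
  rewrite (_ : L - csum a = (L - \sum_(j < J) a j) - (csum a - \sum_(j < J) a j));
    last by ring.
  apply: (le_trans (cabsB _ _)); rewrite mulrDl; apply: lerD; first exact: LK.
  exact: csum_tail.
pose x := (K + 4 * M) / cabs (L - csum a).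
have BJ (J : nat) : J%:R <= x.
  apply: (@le_trans _ _ (4 ^+ J)).
    rewrite -natrX ler_nat; apply: ltnW; exact: ltn_expl.
  rewrite /x ler_pdivlMr// mulrC -ler_pdivlMr ?exprn_gt0//; exact: B.
have := BJ (Num.truncn x).+1; rewrite leNgt => /negP; apply.
by have := truncnS_gt x.
Qed.

Lemma csumD a b (M N : R) : (forall j, cabs (a j) <= M / 4 ^+ j) ->
  (forall j, cabs (b j) <= N / 4 ^+ j) ->
  csum a + csum b = csum (fun j => a j + b j).
Proof.
move=> aM bN; apply: (@csum_unique _ (M + N) (4 * M + 4 * N)) => [j|J].
  by apply: (le_trans (cabsD _ _)); rewrite mulrDl lerD.
rewrite big_split/= opprD addrACA; apply: (le_trans (cabsD _ _)).
by rewrite mulrDl lerD//; exact: csum_tail.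
Qed.

Lemma csumZ (z : C) a (M : R) : (forall j, cabs (a j) <= M / 4 ^+ j) ->
  z * csum a = csum (fun j => z * a j).
Proof.
move=> aM; apply: (@csum_unique _ (cabs z * M) (cabs z * (4 * M))) => [j|J].
  by rewrite cabsM -mulrA ler_wpM2l ?cabs_ge0.
rewrite -mulr_sumr -mulrBr cabsM -mulrA ler_wpM2l ?cabs_ge0//.
exact: csum_tail.
Qed.

End GeometricSums.

(** * Test functions in W^1 *)

Section TestFunctions.
Context {R : realType}.
Local Notation C := R[i].
Local Notation mu2 := ((@lebesgue_measure R) \x (@lebesgue_measure R))%E.
Implicit Types (z w : C).

(** Pairing F with it yields (1 - |w|) (z F)'(w). The factor 1 - |w| is the normalisation that
    bounds the area integral of the derivative independently of w. *)
Definition test_fn w z : C := (1 - cabs w)%:C * (1 - conjc w * z)^-1 ^+ 2.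

Definition test_deriv w z : C :=
  (1 - cabs w)%:C * (2 * conjc w * (1 - conjc w * z)^-1 ^+ 3).

Lemma kernel_ge w z : in_disc w -> in_disc z ->
  1 - cabs w <= cabs (1 - conjc w * z) /\ 1 - cabs z <= cabs (1 - conjc w * z).
Proof.
rewrite /in_disc => w1 z1.
have := cabs_dist 1 (conjc w * z); rewrite cabs1 cabsM cabs_conj => H.
have w0 := cabs_ge0 w; have z0 := cabs_ge0 z.
have h1 : cabs w * cabs z <= cabs w by rewrite -[leRHS]mulr1 ler_wpM2l// ltW.
have h2 : cabs w * cabs z <= cabs z by rewrite -[leRHS]mul1r ler_wpM2r// ltW.
by split; lra.
Qed.

(** The pseudo-hyperbolic distance is at most 1. This allows level sets of the kernel to be enclosed
    in squares centered at w. *)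
Lemma kernel_ge_dist w z : in_disc w -> in_disc z ->
  cabs (z - w) <= cabs (1 - conjc w * z).
Proof.
rewrite /in_disc => w1 z1.
have sq (x : R) : 0 <= x -> x < 1 -> x ^+ 2 <= 1.
  by move=> x0 x1; rewrite exprn_ile1// ltW.
have hw := sq _ (cabs_ge0 w) w1; have hz := sq _ (cabs_ge0 z) z1.
rewrite -(@ler_pXn2r _ 2) ?nnegrE ?cabs_ge0// -subr_ge0.
have -> : cabs (1 - conjc w * z) ^+ 2 - cabs (z - w) ^+ 2 =
    (1 - cabs w ^+ 2) * (1 - cabs z ^+ 2).
  rewrite !cabs_sqr; case: w {w1 hw} => a b; case: z {z1 hz} => c d /=; ring.
by rewrite mulr_ge0// subr_ge0.
Qed.

Lemma kernel_neq0 w z : in_disc w -> in_disc z -> 1 - conjc w * z != 0.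
Proof.
move=> w1 z1; rewrite -cabs_gt0; apply: lt_le_trans (kernel_ge w1 z1).1.
by rewrite subr_gt0.
Qed.

Lemma test_fn_bound w z : in_disc w -> in_disc z ->
  cabs (test_fn w z) <= (1 - cabs z)^-1.
Proof.
move=> w1 z1; have [h1 h2] := kernel_ge w1 z1; rewrite /in_disc in w1 z1.
rewrite /test_fn cabsM cabs_real ger0_norm ?subr_ge0 ?(ltW w1)// cabsX cabsV expr2 mulrA.
have m0 : 0 < cabs (1 - conjc w * z) by apply: lt_le_trans h1; rewrite subr_gt0.
rewrite -[leRHS]mul1r ler_pM ?divr_ge0 ?subr_ge0 ?invr_ge0 ?cabs_ge0 ?(ltW w1)//.
  by rewrite ler_pdivrMr// mul1r.
by rewrite lef_pV2// posrE subr_gt0.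
Qed.

Lemma test_fn_taylor w z h : in_disc w -> in_disc z -> cabs h < (1 - cabs z) / 2 ->
  cabs (test_fn w (z + h) - test_fn w z - test_deriv w z * h) <=
  16 * (1 - cabs z)^-1 ^+ 4 * cabs h ^+ 2.
Proof.
move=> w1 z1 hz; have [h1 h2] := kernel_ge w1 z1; rewrite /in_disc in w1 z1.
have w0 := cabs_ge0 w.
have hh : cabs (conjc w * h) <= cabs h.
  by rewrite cabsM cabs_conj -[leRHS]mul1r ler_wpM2r ?cabs_ge0// ltW.
have m0 : 0 < 1 - cabs z by rewrite subr_gt0.
have T := kernel_taylor2 m0 h2 (le_lt_trans hh hz).
rewrite (_ : _ - _ - _ = (1 - cabs w)%:C * ((1 - conjc w * z - conjc w * h)^-1 ^+ 2 -
  (1 - conjc w * z)^-1 ^+ 2 - 2 * (conjc w * h) * (1 - conjc w * z)^-1 ^+ 3)); last first.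
  by rewrite /test_fn /test_deriv mulrDr opprD addrA; ring.
rewrite cabsM cabs_real ger0_norm ?subr_ge0 ?(ltW w1)//.
apply: (@le_trans _ _ (1 * (16 * (1 - cabs z)^-1 ^+ 4 * cabs h ^+ 2))); last by rewrite mul1r.
rewrite ler_pM ?subr_ge0 ?cabs_ge0 ?(ltW w1)//; first by lra.
apply: (le_trans T); rewrite ler_wpM2l//.
  by rewrite mulr_ge0// exprn_ge0// invr_ge0 ltW.
by rewrite lerXn2r// nnegrE cabs_ge0.
Qed.

Lemma test_deriv_bound w z : in_disc w -> in_disc z ->
  cabs (test_deriv w z) <= 2 * (1 - cabs w) * (cabs (1 - conjc w * z))^-1 ^+ 3.
Proof.
rewrite /in_disc => w1 z1; rewrite /test_deriv cabsM cabs_real ger0_norm ?subr_ge0 ?(ltW w1)//.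
rewrite cabsM cabsM cabsX cabsV cabs_conj cabs2.
rewrite [2 * (1 - _)]mulrC -[leRHS]mulrA ler_wpM2l ?subr_ge0 ?(ltW w1)//.
rewrite ler_wpM2r ?exprn_ge0 ?invr_ge0 ?cabs_ge0//.
by rewrite -[leRHS]mulr1 ler_wpM2l// ltW.
Qed.

(** A product set, so that its area in the product measure is immediate. *)
Definition square w (s : R) : set (R * R) :=
  `[complex.Re w - s, complex.Re w + s] `*` `[complex.Im w - s, complex.Im w + s].

Lemma measurable_square w s : measurable (square w s).
Proof. by apply: measurableX; exact: measurable_itv. Qed.

Lemma mu_square w s : 0 < s -> mu2 (square w s) = (4 * s ^+ 2)%:E.
Proof.
move=> s0; rewrite /square product_measure1E; [|exact: measurable_itv..].
have lt (x : R) : x - s < x + s by lra.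
transitivity ((complex.Re w + s - (complex.Re w - s))%:E *
    (complex.Im w + s - (complex.Im w - s))%:E)%E.
  by congr (_ * _)%E; exact: mu_segment.
by rewrite -EFinM; congr _%:E; ring.
Qed.

(** Dyadic decomposition. Let d = 1 - |w| and m = |1 - conj(w) z|, and take the least i with m at
    most 2^i d. Then z is in the i-th square, and m is at least 2^(i-1) d, at i = 0 because m is at
    least d; so 2 d / m^3 is at most 16 / (8^i d^2). The square has area 4 (2^i d)^2, which leaves
    the summable 64 / 2^i. *)
Lemma test_deriv_square w (p : R * R) : in_disc w -> in_disc (p.1 +i* p.2) ->
  exists i : nat, square w (2 ^+ i * (1 - cabs w)) p /\
    cabs (test_deriv w (p.1 +i* p.2)) <= 16 / 8 ^+ i / (1 - cabs w) ^+ 2.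
Proof.
move=> w1 z1; set z := _ +i* _ in z1 *.
have [m1 _] := kernel_ge w1 z1; have md := kernel_ge_dist w1 z1.
have B := test_deriv_bound w1 z1.
set m := cabs (1 - _) in m1 md B; set d := 1 - cabs w in m1 B *.
have d0 : 0 < d by rewrite /d subr_gt0.
have m0 : 0 < m by lra.
have in_sq s : `|p.1 - complex.Re w| <= s -> `|p.2 - complex.Im w| <= s -> square w s p.
  rewrite !ler_norml => /andP[x1 x2] /andP[y1 y2]; split; rewrite /= in_itv/=;
    apply/andP; split; lra.
have nx : `|p.1 - complex.Re w| <= m.
  by apply: le_trans md; have := norm_Re_le (z - w); rewrite cReD cReN.
have ny : `|p.2 - complex.Im w| <= m.
  by apply: le_trans md; have := norm_Im_le (z - w); rewrite cImD cImN.
have ex : exists i, m <= 2 ^+ i * d.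
  exists (Num.truncn (m / d)).+1; rewrite -ler_pdivrMr//.
  apply: (le_trans (ltW (truncnS_gt _))).
  by rewrite -natrX ler_nat ltnW// ltn_expl.
have [i Hi mini] := ex_minnP ex; exists i; split.
  by apply: in_sq; [exact: le_trans Hi|exact: le_trans Hi].
apply: (le_trans B).
have im (s : R) : 0 < s -> s <= m -> m^-1 ^+ 3 <= s^-1 ^+ 3.
  move=> s0 sm; rewrite lerXn2r ?nnegrE ?invr_ge0 ?(ltW s0) ?(ltW m0)//.
  by rewrite lef_pV2.
case: i Hi mini => [_ _|i Hi mini].
  apply: (@le_trans _ _ (2 * d * d^-1 ^+ 3)).
    by rewrite ler_wpM2l ?mulr_ge0 ?(ltW d0)// im.
  rewrite expr0 divr1 (_ : 2 * d * _ = 2 / d ^+ 2); last by field; rewrite gt_eqF.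
  by rewrite ler_pM2r ?invr_gt0 ?exprn_gt0//; lra.
have mi : 2 ^+ i * d < m.
  by rewrite ltNge; apply/negP => /mini; rewrite ltnn.
apply: (@le_trans _ _ (2 * d * (2 ^+ i * d)^-1 ^+ 3)).
  by rewrite ler_wpM2l ?mulr_ge0 ?(ltW d0)// im ?(ltW mi)// mulr_gt0// exprn_gt0.
rewrite le_eqVlt; apply/orP; left; apply/eqP.
have -> : (8 : R) ^+ i.+1 = 8 * (2 ^+ i) ^+ 3.
  by rewrite exprS -exprM mulnC exprM; congr (_ * _ ^+ _); rewrite -natrX.
by field; rewrite expf_neq0// gt_eqF.
Qed.

(** Monotonicity read off the supremum over simple functions, which avoids a measurability proof for
    the derivative of the test series. *)
Lemma integral_mono_out d (T : measurableType d) (mu : {measure set T -> \bar R})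
  (D : set T) (f g : T -> \bar R) :
  (forall x, D x -> 0 <= f x)%E -> (forall x, 0 <= g x)%E ->
  (forall x, D x -> f x <= g x)%E ->
  (\int[mu]_(x in D) f x <= \int[mu]_x g x)%E.
Proof.
move=> f0 g0 fg; rewrite ge0_integralE// ge0_integralTE//.
apply: ge_ereal_sup => _ [h /= hf <-]; apply: ereal_sup_ubound; exists h => //= x.
apply: (le_trans (hf x)); rewrite /patch; case: ifPn => // /set_mem; exact: fg.
Qed.

Lemma nneseries_geometric2 (c : R) : 0 <= c ->
  (\sum_(i <oo) (c / 2 ^+ i)%:E <= (2 * c)%:E)%E.
Proof.
move=> c0; apply: le_trans (epsilon_trick0 xpredT _); last by rewrite mulr_ge0.
apply: lee_nneseries => [i _ _|i _]; rewrite lee_fin.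
  by rewrite divr_ge0// exprn_ge0.
by rewrite natrX exprS le_eqVlt; apply/orP; left; apply/eqP; field; rewrite expf_neq0.
Qed.

(** Termwise differentiation works because the Taylor remainder of [test_fn w] has a constant
    independent of w. The derivative is dominated by [U], a double series of indicators of squares,
    and the j-th summand integrates to at most 128 / 4^j. *)
Lemma W1_test_sum (c : nat -> R) (w : nat -> C) :
  (forall j, 0 <= c j <= (4 ^+ j)^-1) -> (forall j, in_disc (w j)) ->
  W1 (fun z => csum (fun j => (c j)%:C * test_fn (w j) z)).
Proof.
move=> c4 w1.
have cb (M : R) (x : C) j : cabs x <= M -> cabs ((c j)%:C * x) <= M / 4 ^+ j.
  move=> xM; have /andP[c0 c1] := c4 j.
  by rewrite cabsM cabs_real ger0_norm// mulrC ler_pM ?cabs_ge0.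
pose db z : R := 2 * ((1 - cabs z)^-1 ^+ 3).
have dbP z j : in_disc z -> cabs (test_deriv (w j) z) <= db z.
  move=> z1; apply: (le_trans (test_deriv_bound (w1 j) z1)).
  have [_ h] := kernel_ge (w1 j) z1; have := w1 j; rewrite /in_disc in z1 * => wj.
  have z0 : 0 < 1 - cabs z by rewrite subr_gt0.
  rewrite /db ler_pM//.
  - by rewrite mulr_ge0// subr_ge0 ltW.
  - by rewrite exprn_ge0// invr_ge0 cabs_ge0.
  - by have := cabs_ge0 (w j); lra.
  have m0 : 0 < cabs (1 - conjc (w j) * z) by apply: lt_le_trans h.
  by rewrite lerXn2r ?nnegrE ?invr_ge0 ?(ltW z0) ?(ltW m0)// lef_pV2.
exists (fun z => csum (fun j => (c j)%:C * test_deriv (w j) z)); split.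
  move=> z z1.
  have z0 : 0 < 1 - cabs z by rewrite subr_gt0.
  apply: (@is_cderiv_quadratic _ _ _ _ (4 * (16 * (1 - cabs z)^-1 ^+ 4)) ((1 - cabs z) / 2)).
    by rewrite divr_gt0.
  move=> h hz.
  have zh1 : in_disc (z + h) by rewrite /in_disc; have := cabsD z h; lra.
  have b1 j := cb _ _ j (test_fn_bound (w1 j) zh1).
  have b2 j := cb _ _ j (test_fn_bound (w1 j) z1).
  have b3 j := cb _ _ j (dbP _ j z1).
  have b2' j : cabs (-1 * ((c j)%:C * test_fn (w j) z)) <= (1 - cabs z)^-1 / 4 ^+ j.
    by rewrite mulN1r cabsN.
  have b3' j : cabs (- h * ((c j)%:C * test_deriv (w j) z)) <= (cabs h * db z) / 4 ^+ j.
    by rewrite cabsM cabsN -mulrA ler_wpM2l ?cabs_ge0.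
  have b12 j : cabs ((c j)%:C * test_fn (w j) (z + h) + -1 * ((c j)%:C * test_fn (w j) z))
      <= ((1 - cabs (z + h))^-1 + (1 - cabs z)^-1) / 4 ^+ j.
    by apply: (le_trans (cabsD _ _)); rewrite mulrDl lerD.
  rewrite [_ * h]mulrC -mulNr -[- csum _]mulN1r.
  rewrite (csumZ _ b2) (csumZ _ b3) (csumD b1 b2') (csumD b12 b3') -mulrA.
  apply: csum_bound => j.
  rewrite (_ : _ + _ + _ = (c j)%:C * (test_fn (w j) (z + h) - test_fn (w j) z -
     test_deriv (w j) z * h)); last by ring.
  by apply: cb; exact: test_fn_taylor.
pose del j : R := 1 - cabs (w j).
have del0 j : 0 < del j by rewrite /del subr_gt0; exact: w1.
pose co j i : R := (4 ^+ j)^-1 * (16 / 8 ^+ i / (del j) ^+ 2).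
have co0 j i : 0 <= co j i.
  by rewrite /co !mulr_ge0 ?invr_ge0 ?exprn_ge0 ?(ltW (del0 j))// mulr_ge0// invr_ge0 exprn_ge0.
pose S j i : set (R * R) := square (w j) (2 ^+ i * del j).
pose U (p : R * R) : \bar R := (\sum_(j <oo) \sum_(i <oo) (co j i * \1_(S j i) p)%:E)%E.
have term0 j i (p : R * R) : (0 <= (co j i * \1_(S j i) p)%:E)%E.
  by rewrite lee_fin mulr_ge0.
have U1 (p : R * R) j : in_disc (p.1 +i* p.2) ->
    ((cabs ((c j)%:C * test_deriv (w j) (p.1 +i* p.2)))%:E <=
     \sum_(i <oo) (co j i * \1_(S j i) p)%:E)%E.
  move=> p1; have [i [Sp Hi]] := test_deriv_square (w1 j) p1.
  have T : (\sum_(0 <= k < i.+1) (co j k * \1_(S j k) p)%:E <=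
      \sum_(k <oo) (co j k * \1_(S j k) p)%:E)%E by apply: nneseries_lim_ge.
  apply: le_trans T; rewrite big_nat_recr//= -[leLHS]add0e; apply: leeD.
    exact: sume_ge0.
  rewrite lee_fin indicE mem_set// mulr1.
  have /andP[cj0 cj1] := c4 j.
  by rewrite cabsM cabs_real ger0_norm// /co ler_pM ?cabs_ge0.
have dom (p : R * R) : in_disc (p.1 +i* p.2) ->
    ((cabs (csum (fun j => (c j)%:C * test_deriv (w j) (p.1 +i* p.2))))%:E <= U p)%E.
  (* Truncating at the cost of e leaves a finite sum to compare with the extended-real series. *)
  move=> p1; apply/lee_addgt0Pr => e e0.
  have b3 j := cb _ _ j (dbP _ j p1).
  set z := _ +i* _ in p1 b3 *.
  have [J HJ] : exists J : nat, 4 * db z / 4 ^+ J <= e.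
    exact: pow4_dominates.
  have T := csum_tail b3 J.
  set cs := csum _ in T *.
  have T2 : cabs cs <= (\sum_(j < J) cabs ((c j)%:C * test_deriv (w j) z)) + e.
    rewrite -[cs](subrK (\sum_(j < J) ((c j)%:C * test_deriv (w j) z))) addrC.
    apply: (le_trans (cabsD _ _)); rewrite lerD//; last exact: le_trans HJ.
    exact: (@cabs_sum _ _ (fun j => (c j)%:C * test_deriv (w j) z)).
  apply: (@le_trans _ _ ((\sum_(j < J) cabs ((c j)%:C * test_deriv (w j) z))%:E + e%:E)%E).
    by rewrite -EFinD lee_fin.
  rewrite leeD2r// -sumEFin.
  apply: (@le_trans _ _ (\sum_(0 <= j < J) \sum_(i <oo) (co j i * \1_(S j i) p)%:E)%E).
    by rewrite big_mkord; apply: lee_sum => j _; exact: U1.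
  by apply: nneseries_lim_ge => j _ _; apply: nneseries_ge0 => i _ _; exact: term0.
have U0 p : (0 <= U p)%E.
  by apply: nneseries_ge0 => j _ _; apply: nneseries_ge0 => i _ _; exact: term0.
apply: (@le_lt_trans _ _ (\int[mu2]_p U p)%E).
  apply: integral_mono_out => //.
  - by move=> p _; rewrite lee_fin cabs_ge0.
  move=> p /= p1; apply: dom.
  by rewrite /in_disc cabsE/= -[ltRHS]sqrtr1 ltr_sqrt.
have mS j i : measurable (S j i) by exact: measurable_square.
have mt j i : measurable_fun setT (fun p => (co j i * \1_(S j i) p)%:E).
  apply/measurable_EFinP; apply: measurable_funM; first exact: measurable_cst.
  exact: measurable_indic.
rewrite /U integral_nneseries//; last 2 first.
- move=> j; apply: (@ge0_emeasurable_sum _ _ _ setT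
    (fun i p => (co j i * \1_(S j i) p)%:E) xpredT) => [i p _ _|i _]; [exact: term0|exact: mt].
- by move=> j p _; apply: nneseries_ge0 => i _ _; exact: term0.
apply: (@le_lt_trans _ _ (\sum_(j <oo) (128 / 2 ^+ j)%:E)%E); last first.
  by apply: le_lt_trans (nneseries_geometric2 _) _; rewrite ?ltry.
apply: lee_nneseries => [j _ _|j _].
  apply: integral_ge0 => p _; apply: nneseries_ge0 => i _ _; exact: term0.
rewrite integral_nneseries//; last by move=> i; exact: mt.
apply: (@le_trans _ _ (\sum_(i <oo) ((64 / 4 ^+ j) / 2 ^+ i)%:E)%E); last first.
  apply: le_trans (nneseries_geometric2 _) _; first by rewrite divr_ge0// exprn_ge0.
  rewrite lee_fin mulrA (_ : 2 * 64 = 128); last by lra.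
  rewrite ler_pM2l// lef_pV2 ?posrE ?exprn_gt0// lerXn2r// ?nnegrE; lra.
apply: lee_nneseries => [i _ _|i _].
  by apply: integral_ge0 => p _; exact: term0.
under eq_integral do rewrite EFinM.
rewrite ge0_integralZl_EFin//; last first.
  by apply/measurable_EFinP; apply: measurable_indic; exact: mS.
rewrite integral_indic ?setIT//; last exact: mS.
rewrite [X in (_ * X <= _)%E](_ : _ = (4 * (2 ^+ i * del j) ^+ 2)%:E); last first.
  by apply: mu_square; rewrite mulr_gt0// exprn_gt0.
rewrite -EFinM lee_fin le_eqVlt; apply/orP; left; apply/eqP.
rewrite /co (_ : (8 : R) ^+ i = (2 ^+ i) ^+ 3); last first.
  by rewrite -exprM mulnC exprM; congr (_ ^+ _); rewrite -natrX.
by field; rewrite !expf_neq0// gt_eqF.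
Qed.

(** Makes evaluation at w a pairing, so that weak-star convergence implies pointwise convergence.
    The derivative is bounded, since the kernel stays at least 1 - |w| away from 0. *)
Lemma W1_cauchy_kernel w : in_disc w -> W1 (fun z => (1 - conjc w * z)^-1).
Proof.
move=> w1.
have d0 : 0 < 1 - cabs w by rewrite subr_gt0.
exists (fun z => conjc w * (1 - conjc w * z)^-1 ^+ 2); split.
  move=> z z1; have [h1 h2] := kernel_ge w1 z1.
  apply: (@is_cderiv_quadratic _ _ _ _ (2 * (1 - cabs w)^-1 ^+ 3) ((1 - cabs w) / 2)).
    by rewrite divr_gt0.
  move=> h hz.
  have hh : cabs (conjc w * h) <= cabs h.
    by rewrite cabsM cabs_conj -[leRHS]mul1r ler_wpM2r ?cabs_ge0// ltW.
  have T := kernel_taylor1 d0 h1 (le_lt_trans hh hz).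
  rewrite mulrDr opprD addrA (_ : conjc w * _ * h = conjc w * h * (1 - conjc w * z)^-1 ^+ 2);
    last by ring.
  apply: (le_trans T); rewrite ler_wpM2l//.
    by rewrite mulr_ge0// exprn_ge0// invr_ge0 ltW.
  by rewrite lerXn2r// nnegrE cabs_ge0.
pose M : R := (1 - cabs w)^-1 ^+ 2.
have M0 : 0 <= M by rewrite exprn_ge0// invr_ge0 ltW.
apply: (@le_lt_trans _ _ (\int[mu2]_p (M%:E * (\1_(square 0 1) p)%:E))%E).
  apply: integral_mono_out.
  - by move=> p _; rewrite lee_fin cabs_ge0.
  - by move=> p; rewrite -EFinM lee_fin mulr_ge0.
  move=> p /= p1.
  have z1 : in_disc (p.1 +i* p.2) by rewrite /in_disc cabsE/= -[ltRHS]sqrtr1 ltr_sqrt.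
  have [h1 h2] := kernel_ge w1 z1.
  have nR := norm_Re_le (p.1 +i* p.2); have nI := norm_Im_le (p.1 +i* p.2).
  have s1 : Num.sqrt (p.1 ^+ 2 + p.2 ^+ 2) < 1 by move: z1; rewrite /in_disc cabsE.
  simpl in nR, nI.
  rewrite indicE mem_set; last first.
    move: nR nI; rewrite !ler_norml => /andP[x1 x2] /andP[y1 y2].
    by split; rewrite /= in_itv/=; apply/andP; split; lra.
  rewrite mule1 lee_fin cabsM cabs_conj cabsX cabsV /M -[leRHS]mul1r.
  rewrite ler_pM ?cabs_ge0 ?exprn_ge0 ?invr_ge0 ?cabs_ge0 ?(ltW w1)//.
  rewrite lerXn2r ?nnegrE ?invr_ge0 ?cabs_ge0 ?(ltW d0)// lef_pV2// posrE.
  exact: lt_le_trans h1.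
rewrite ge0_integralZl_EFin//; last first.
  by apply/measurable_EFinP; exact: measurable_indic (measurable_square _ _).
rewrite integral_indic ?setIT//; last exact: measurable_square.
rewrite [X in (_ * X < _)%E](_ : _ = (4 * 1 ^+ 2)%:E) -?EFinM ?ltry//.
exact: mu_square.
Qed.

End TestFunctions.

(** * Pairings with the test functions, and uniform boundedness *)

Section Pairings.
Context {R : realType}.
Local Notation C := R[i].
Local Notation I := (`[0, 2 * pi]%classic : set R).
Implicit Types (z w l : C) (F g : C -> C) (r : R).

Definition pair r F g : C :=
  circle_int (fun t => F (r%:C * eit t) * conjc (g (r%:C * eit t))).

Definition ccvg (P : R -> C) l := forall e : R, 0 < e ->
  \forall r \near (1 : R)^'-, cabs (P r - l) <= e.

Lemma pairing_ccvg F g l : pairing_to F g l -> ccvg (fun r => pair r F g) l.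
Proof.
move=> [h1 h2] e e0; have e2 : 0 < e / 2 by lra.
move/cvgrPdist_le : h1 => /(_ _ e2) h1; move/cvgrPdist_le : h2 => /(_ _ e2) h2.
near=> r; apply: (le_trans (cabs_le_ReIm _)).
rewrite cReD cImD cReN cImN; rewrite distrC [X in _ + X]distrC.
rewrite (_ : e = e / 2 + e / 2); last by lra.
by apply: lerD; near: r.
Unshelve. all: by end_near. Qed.

Lemma ccvg_pairing F g l : ccvg (fun r => pair r F g) l -> pairing_to F g l.
Proof.
by move=> H; split; apply/cvgrPdist_le => e e0; have := H e e0;
  apply: filterS => r; apply: le_trans; rewrite distrC -?cReN -?cImN -?cReD -?cImD
    ?norm_Re_le ?norm_Im_le.
Qed.

Lemma left_ex (A B : R -> Prop) : (\forall r \near (1 : R)^'-, A r) ->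
  (\forall r \near (1 : R)^'-, B r) -> exists r, [/\ 0 < r < 1, A r & B r].
Proof.
move=> HA HB.
have N1 : \forall r \near (1 : R)^'-, 0 < r by exact: nbhs_left_gt.
have N2 : \forall r \near (1 : R)^'-, r < 1 by exact: nbhs_left_lt.
have H : \forall r \near (1 : R)^'-, (0 < r /\ r < 1) /\ (A r /\ B r).
  by apply: filterI; exact: filterI.
have [r [[r0 r1] [hA hB]]] := filter_ex H.
by exists r; split=> //; rewrite r0.
Qed.

Lemma ccvg_unique (P : R -> C) l m : ccvg P l -> ccvg P m -> l = m.
Proof.
move=> Hl Hm; apply/eqP; rewrite -subr_eq0 -cabs_eq0 -[_ == 0]negbK.
apply/negP => H; have {}H : 0 < cabs (l - m) by rewrite lt_def H cabs_ge0.
have e0 : 0 < cabs (l - m) / 3 by lra.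
have [r [_ r1 r2]] := left_ex (Hl _ e0) (Hm _ e0).
have := cabsB (P r - m) (P r - l).
rewrite (_ : P r - m - _ = l - m); last by ring.
lra.
Qed.

Lemma eq_ccvg (P P' : R -> C) l : (forall r, 0 < r < 1 -> P r = P' r) ->
  ccvg P l -> ccvg P' l.
Proof.
move=> PP' H e e0.
have N1 : \forall r \near (1 : R)^'-, 0 < r by exact: nbhs_left_gt.
have N2 : \forall r \near (1 : R)^'-, r < 1 by exact: nbhs_left_lt.
apply: filterS (filterI (filterI N1 N2) (H e e0)) => r [[r0 r1]].
by rewrite PP'// r0.
Qed.

Lemma ccvgD (P P' : R -> C) l l' : ccvg P l -> ccvg P' l' ->
  ccvg (fun r => P r + P' r) (l + l').
Proof.
move=> H H' e e0; have e2 : 0 < e / 2 by lra.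
apply: filterS (filterI (H _ e2) (H' _ e2)) => r [h h'].
rewrite opprD addrACA; apply: (le_trans (cabsD _ _)); lra.
Qed.

Lemma ccvgZ (a : C) (P : R -> C) l : ccvg P l -> ccvg (fun r => a * P r) (a * l).
Proof.
move=> H e e0; have a0 : 0 < cabs a + 1 by have := cabs_ge0 a; lra.
apply: filterS (H _ (divr_gt0 e0 a0)) => r h.
rewrite -mulrBr cabsM; apply: (@le_trans _ _ ((cabs a + 1) * cabs (P r - l))).
  by rewrite ler_wpM2r ?cabs_ge0//; lra.
by rewrite mulrC -ler_pdivlMr.
Qed.

Lemma ccvg_sum n (P : nat -> R -> C) (l : nat -> C) :
  (forall j, ccvg (P j) (l j)) ->
  ccvg (fun r => \sum_(j < n) P j r) (\sum_(j < n) l j).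
Proof.
move=> H; elim: n => [|n IH].
  move=> e e0; apply: nearW => r; rewrite !big_ord0 subrr cabs0; exact: ltW.
rewrite big_ord_recr/=; apply: eq_ccvg (ccvgD IH (H n)) => r _.
by rewrite big_ord_recr.
Qed.

(** The square of r appears because both factors of the pairing are taken on the circle of radius
    r. *)
Lemma ccvg_radial (G : C -> C) w d : in_disc w -> is_cderiv G w d ->
  ccvg (fun r => G ((r ^+ 2)%:C * w)) (G w).
Proof.
move=> w1 /is_cderiv_continuous HG e e0; have [del del0 Hd] := HG e e0.
have N0 : \forall r \near (1 : R)^'-, 0 < r by exact: nbhs_left_gt.
have N1 : \forall r \near (1 : R)^'-, 1 - del / 2 < r.
  by apply: nbhs_left_gt; lra.
have N2 : \forall r \near (1 : R)^'-, r < 1 by exact: nbhs_left_lt.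
apply: filterS (filterI (filterI N0 N1) N2) => r [[r0 r1] r2].
have -> : (r ^+ 2)%:C * w = w + - (1 - r ^+ 2)%:C * w.
  by rewrite rmorphB rmorph1; ring.
apply: Hd; rewrite cabsM cabsN cabs_real.
have q0 : 0 <= 1 - r ^+ 2 by rewrite subr_ge0 exprn_ile1// ltW.
rewrite ger0_norm//; apply: (@le_lt_trans _ _ ((1 - r ^+ 2) * 1)).
  by rewrite ler_wpM2l// ltW.
have : (1 - r) * (1 + r) <= (1 - r) * 2 by rewrite ler_wpM2l//; lra.
by rewrite mulr1 (_ : (1 - r) * (1 + r) = 1 - r ^+ 2); [lra|ring].
Qed.

Lemma regular_id : regular (fun z : C => z) (fun=> 1).
Proof.
split=> [z _|z _|rho rho1]; first exact: is_cderiv_id.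
  by exists 0; exact: is_cderiv_cst.
exists (Num.max rho 1) => z zr; rewrite cabs1 !le_max lexx orbT.
by rewrite zr.
Qed.

Lemma ccont_analytic F (r : R) : (forall z, in_disc z -> exists d, is_cderiv F z d) ->
  0 <= r < 1 -> ccont (fun t => F (r%:C * eit t)).
Proof.
move=> dF /andP[r0 r1]; apply: ccont_comp_cderiv => [t|]; last exact: ccont_circle.
by apply: dF; rewrite /in_disc cabs_circle.
Qed.

Lemma circle_in_disc r t : 0 < r < 1 -> in_disc (r%:C * eit t).
Proof. by move=> /andP[r0 r1]; rewrite /in_disc cabs_circle// ltW. Qed.

Lemma conj_mul z w : conjc (z * w) = conjc z * conjc w.
Proof. exact: (rmorphM (@conjc R)). Qed.

Lemma conj_sub z w : conjc (z - w) = conjc z - conjc w.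
Proof. exact: (rmorphB (@conjc R)). Qed.

Lemma conj_exp z n : conjc (z ^+ n) = conjc z ^+ n.
Proof. exact: (rmorphXn (@conjc R)). Qed.

Lemma radial_lt w r : 0 < r < 1 -> in_disc w -> cabs ((r ^+ 2)%:C * w) < r.
Proof.
move=> /andP[r0 r1] w1.
rewrite cabsM cabs_real ger0_norm ?sqr_ge0// expr2 -mulrA.
rewrite -[ltRHS]mulr1 ltr_pM2l//; apply: (@le_lt_trans _ _ (1 * cabs w)).
  by rewrite ler_wpM2r ?cabs_ge0// ltW.
by rewrite mul1r.
Qed.

(** On the circle of radius r the conjugate of z is r^2 / z, which turns the conjugated kernel into
    the Cauchy kernel with pole r^2 w. *)
Lemma conj_kernel w r t : 0 < r < 1 -> in_disc w ->
  conjc ((1 - conjc w * (r%:C * eit t))^-1) =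
  r%:C * eit t * (r%:C * eit t - (r ^+ 2)%:C * w)^-1.
Proof.
move=> r01 w1; have /andP[r0 r1] := r01.
have aw := radial_lt r01 w1.
have n1 := circle_neq t aw.
have n2 := kernel_neq0 w1 (circle_in_disc t r01).
have n3 : eit t != 0 :> C by rewrite -cabs_gt0 cabs_eit.
have n4 : r%:C != 0 :> C by rewrite -cabs_gt0 cabs_real normr_gt0 gt_eqF.
rewrite conjc_inv conj_sub conjc1 conj_mul conj_mul conjcK conj_eit conjc_real.
rewrite rmorphXn/= in n1 *.
have n5 : 1 - w * (r%:C * (eit t)^-1) != 0.
  rewrite (_ : _ - _ = (r%:C * eit t - r%:C ^+ 2 * w) / (r%:C * eit t)); last first.
    by field; rewrite n3 n4.
  by rewrite mulf_neq0// invr_neq0// mulf_neq0.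
apply: (mulIf n5); rewrite mulVf//.
by field; rewrite n3 n1.
Qed.

Lemma regular_analytic F Fd : regular F Fd ->
  forall z, in_disc z -> exists d, is_cderiv F z d.
Proof. by move=> [dF _ _] z z1; eexists; exact: dF. Qed.

Lemma pair_cauchy_kernel F Fd w r : regular F Fd -> 0 < r < 1 -> in_disc w ->
  pair r F (fun z => (1 - conjc w * z)^-1) = F ((r ^+ 2)%:C * w).
Proof.
move=> rF r01 w1; have /andP[_ r1] := r01.
rewrite -(cauchy_formula rF r1 (radial_lt r01 w1)).
by congr circle_int; apply/funext => t; rewrite conj_kernel.
Qed.

(* The second factor is the derivative of [z F z] at the radial point. *)
Lemma pair_test_fn F Fd w r : regular F Fd -> 0 < r < 1 -> in_disc w ->
  pair r F (test_fn w) =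
  (1 - cabs w)%:C * (1 * F ((r ^+ 2)%:C * w) + (r ^+ 2)%:C * w * Fd ((r ^+ 2)%:C * w)).
Proof.
move=> rF r01 w1; have /andP[r0 r1] := r01.
have rG := regularM regular_id rF.
have aw := radial_lt r01 w1.
rewrite -(cauchy_formula_deriv rG r1 aw) -circle_intZ; last first.
  apply/ccont_bmeas/ccontM; last by apply: ccontX; exact: ccont_kernel.
  apply: ccontM; last exact: ccont_circle.
  apply: (ccont_analytic (regular_analytic rG)); rewrite (ltW r0); exact: r1.
congr circle_int; apply/funext => t.
rewrite /test_fn conj_mul conj_exp conj_kernel// conjc_real.
by ring.
Qed.

(** A bound on (1 - |w|) |(z F)'(w)|, the quantity that the test functions measure. The factor 1 is
    the derivative of z, as produced by [regularM regular_id]. *)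
Definition radial_bound F Fd (K : R) := forall w, in_disc w ->
  (1 - cabs w) * cabs (1 * F w + w * Fd w) <= K.

Lemma radial_bound_ge0 F Fd K : radial_bound F Fd K -> 0 <= K.
Proof.
move=> H; have d0 : in_disc (0 : C) by rewrite /in_disc cabs0.
by apply: le_trans (H _ d0); rewrite cabs0 subr0 mul1r cabs_ge0.
Qed.

(** The point is a bound independent of r. The pairing is first exchanged with the sum at fixed r by
    a crude estimate that blows up as r tends to 1; the terms after J are then bounded one by one by
    [radial_bound]. *)
Lemma pair_csum_bound F Fd (K : R) (c : nat -> R) (w : nat -> C) r J :
  regular F Fd -> radial_bound F Fd K -> 0 < r < 1 ->
  (forall j, 0 <= c j <= (4 ^+ j)^-1) -> (forall j, in_disc (w j)) ->
  cabs (pair r F (fun z => csum (fun j => (c j)%:C * test_fn (w j) z)) -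
    \sum_(j < J) (c j)%:C * pair r F (test_fn (w j))) <= 4 / 3 * K / 4 ^+ J.
Proof.
move=> rF HK r01 c4 w1; have /andP[r0 r1] := r01.
have K0 := radial_bound_ge0 HK.
have [gd [dg _]] := W1_test_sum c4 w1.
set g := (fun z => csum _) in dg *.
have [M HM] : exists M : R, forall t, cabs (F (r%:C * eit t)) <= M.
  have [_ _ /(_ r r1)[M HM]] := rF; exists M => t.
  by have [] := HM (r%:C * eit t); rewrite ?cabs_circle// ltW.
have M0 : 0 <= M by apply: le_trans (HM 0); exact: cabs_ge0.
have cF : ccont (fun t => F (r%:C * eit t)).
  by apply: (ccont_analytic (regular_analytic rF)); rewrite (ltW r0).
have cg : ccont (fun t => g (r%:C * eit t)).
  apply: ccont_analytic; last by rewrite (ltW r0).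
  by move=> z z1; exists (gd z); exact: dg.
have ct j : ccont (fun t => test_fn (w j) (r%:C * eit t)).
  apply: ccontM (ccont_cst _) _; apply: ccontX; apply: ccontV.
    apply: ccontD (ccont_cst _) _; apply: ccontN.
    exact: ccontM (ccont_cst _) (ccont_circle _).
  by move=> t; apply: kernel_neq0 => //; exact: circle_in_disc.
pose q j t : C := (c j)%:C * test_fn (w j) (r%:C * eit t).
have qb t j : cabs (q j t) <= (1 - r)^-1 / 4 ^+ j.
  have /andP[c0 c1] := c4 j.
  rewrite /q cabsM cabs_real ger0_norm// mulrC ler_pM ?cabs_ge0//.
  have := test_fn_bound (w1 j) (circle_in_disc t r01).
  by rewrite cabs_circle// ltW.
have cj (j : nat) : ccont (fun t => F (r%:C * eit t) * conjc (test_fn (w j) (r%:C * eit t))).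
  by apply: ccontM => //; exact: ccont_conj.
(* The crude estimate: uniform on the circle, with a constant depending on r. *)
have main J' : cabs (pair r F g - \sum_(j < J') (c j)%:C * pair r F (test_fn (w j))) <=
    2 * (M * (4 * (1 - r)^-1 / 4 ^+ J')).
  have E : \sum_(j < J') (c j)%:C * pair r F (test_fn (w j)) =
      circle_int (fun t => \sum_(j < J') (c j)%:C *
        (F (r%:C * eit t) * conjc (test_fn (w j) (r%:C * eit t)))).
    have [_ ->] := @circle_int_sum _ J' (fun j t => (c j)%:C *
      (F (r%:C * eit t) * conjc (test_fn (w j) (r%:C * eit t))))
      (fun j => bmeasZ _ (ccont_bmeas (cj j))).
    by apply: eq_bigr => j _; rewrite circle_intZ//; exact: ccont_bmeas.
  have [mS _] := @circle_int_sum _ J' (fun j t => (c j)%:C *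
      (F (r%:C * eit t) * conjc (test_fn (w j) (r%:C * eit t))))
      (fun j => bmeasZ _ (ccont_bmeas (cj j))).
  rewrite E -mulN1r -circle_intZ// /pair -circle_intD; last 2 first.
  - by apply/ccont_bmeas/ccontM => //; exact: ccont_conj.
  - exact: bmeasZ.
  apply: circle_int_bound.
    apply: bmeasD; last exact: bmeasZ.
    by apply/ccont_bmeas/ccontM => //; exact: ccont_conj.
  move=> t _.
  have -> : F (r%:C * eit t) * conjc (g (r%:C * eit t)) + -1 * (\sum_(j < J') (c j)%:C *
      (F (r%:C * eit t) * conjc (test_fn (w j) (r%:C * eit t)))) =
      F (r%:C * eit t) * conjc (g (r%:C * eit t) - \sum_(j < J') q j t).
    rewrite conj_sub mulrBr mulN1r; congr (_ - _).
    rewrite rmorph_sum mulr_sumr; apply: eq_bigr => j _.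
    have qE : conjc (q j t) = (c j)%:C * conjc (test_fn (w j) (r%:C * eit t)).
      by rewrite /q [LHS]conj_mul conjc_real.
    by transitivity (F (r%:C * eit t) * conjc (q j t)); first by rewrite qE mulrCA.
  rewrite cabsM cabs_conj ler_pM ?cabs_ge0//.
  exact: csum_tail (qb t) J'.
apply/ler_addgt0Pr => e e0.
(* For this r, m further terms reduce the crude error to e. Each of them is evaluated at r^2 w_j,
   where 1 - |w_j| is at most 1 - |r^2 w_j|. *)
have [m Hm] := pow4_dominates (2 * (M * (4 * (1 - r)^-1 / 4 ^+ J))) e0.
have -> : pair r F g - \sum_(j < J) (c j)%:C * pair r F (test_fn (w j)) =
    (\sum_(i < m) (c (J + i)%N)%:C * pair r F (test_fn (w (J + i)%N))) +
    (pair r F g - \sum_(j < J + m) (c j)%:C * pair r F (test_fn (w j))).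
  by rewrite big_split_ord/= opprD; ring.
apply: (le_trans (cabsD _ _)); apply: lerD; last first.
  apply: le_trans Hm; apply: (le_trans (main _)).
  by rewrite exprD invfM !mulrA.
apply: (le_trans (@cabs_sum _ m (fun i => (c (J + i)%N)%:C * pair r F (test_fn (w (J + i)%N))))).
apply: (@le_trans _ _ (\sum_(i < m) K * ((4 : R) ^+ (J + i))^-1)).
  apply: ler_sum => i _; have /andP[c0 c1] := c4 (J + i)%N.
  rewrite cabsM cabs_real ger0_norm// mulrC ler_pM ?cabs_ge0//.
  set v := w (J + i)%N; have v1 : in_disc v by exact: w1.
  rewrite (pair_test_fn rF r01 v1) cabsM cabs_real ger0_norm ?subr_ge0 ?(ltW v1)//.
  have rv := radial_lt r01 v1.
  have rv1 : in_disc ((r ^+ 2)%:C * v) by rewrite /in_disc; lra.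
  apply: le_trans (HK _ rv1); rewrite ler_wpM2r ?cabs_ge0// lerB//.
  rewrite cabsM cabs_real ger0_norm ?sqr_ge0// -[leRHS]mul1r ler_wpM2r ?cabs_ge0//.
  by rewrite exprn_ile1// ltW.
rewrite -mulr_sumr (_ : 4 / 3 * K / _ = K * (4 / 3 / 4 ^+ J)); last by ring.
by rewrite ler_wpM2l// sum_geometric4.
Qed.

(** Limit r to 1 of the previous bound: finitely many terms converge, and the tail is controlled
    uniformly in r. *)
Lemma pairing_csum_bound F Fd (K : R) (c : nat -> R) (w : nat -> C) l J :
  regular F Fd -> radial_bound F Fd K ->
  (forall j, 0 <= c j <= (4 ^+ j)^-1) -> (forall j, in_disc (w j)) ->
  pairing_to F (fun z => csum (fun j => (c j)%:C * test_fn (w j) z)) l ->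
  cabs (l - \sum_(j < J) (c j)%:C * ((1 - cabs (w j))%:C * (1 * F (w j) + w j * Fd (w j))))
    <= 4 / 3 * K / 4 ^+ J.
Proof.
move=> rF HK c4 w1 /pairing_ccvg Hl.
have [_ dG _] := regularM regular_id rF; have [dGG _ _] := regularM regular_id rF.
pose T (j : nat) (r : R) : C := (c j)%:C * pair r F (test_fn (w j)).
pose L (j : nat) : C := (c j)%:C * ((1 - cabs (w j))%:C * (1 * F (w j) + w j * Fd (w j))).
have HT j : ccvg (T j) (L j).
  apply: ccvgZ; have [d Hd] := dG _ (w1 j).
  apply: eq_ccvg (ccvgZ (1 - cabs (w j))%:C (ccvg_radial (w1 j) Hd)) => r r01.
  by rewrite (pair_test_fn rF r01 (w1 j)).
have HS := ccvg_sum J HT.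
apply/ler_addgt0Pr => e e0; have e2 : 0 < e / 2 by lra.
have [r [r01 h1 h2]] := left_ex (Hl _ e2) (HS _ e2).
have h3 := pair_csum_bound J rF HK r01 c4 w1.
set P := pair r F _ in h1 h3.
rewrite (_ : l - _ = (P - \sum_(j < J) T j r) - (P - l) + (\sum_(j < J) T j r - \sum_(j < J) L j));
  last by ring.
apply: (le_trans (cabsD _ _)); have := cabsB (P - \sum_(j < J) T j r) (P - l).
lra.
Qed.

Lemma pairing_cauchy_kernel F Fd w l : regular F Fd -> in_disc w ->
  pairing_to F (fun z => (1 - conjc w * z)^-1) l -> l = F w.
Proof.
move=> rF w1 /pairing_ccvg Hl; apply: (ccvg_unique Hl).
have [dF _ _] := rF.
apply: eq_ccvg (ccvg_radial w1 (dF _ w1)) => r r01.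
by rewrite (pair_cauchy_kernel rF r01 w1).
Qed.

Lemma wstar_cvg_pointwise (F Fd : nat -> C -> C) h hd w :
  (forall n, regular (F n) (Fd n)) -> regular h hd -> wstar_cvg F h -> in_disc w ->
  forall e : R, 0 < e -> exists n, cabs (F n w - h w) <= e.
Proof.
move=> rF rh HF w1 e e0; have [l [L [Hl [HL [cR cI]]]]] := HF _ (W1_cauchy_kernel w1).
rewrite (pairing_cauchy_kernel rh w1 HL) in cR cI.
have e2 : 0 < e / 2 by lra.
move/cvgrPdist_le : cR => /(_ _ e2) cR; move/cvgrPdist_le : cI => /(_ _ e2) cI.
have [n [h1 h2]] := filter_ex (filterI cR cI); exists n.
rewrite -(pairing_cauchy_kernel (rF n) w1 (Hl n)).
apply: (le_trans (cabs_le_ReIm _)); rewrite cReD cImD cReN cImN.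
rewrite distrC [X in _ + X]distrC; lra.
Qed.

(** The coefficient number i depends on the earlier ones through their partial sum at [nn i], so
    coefficients and sums are built by one recursion; the conditional is the coefficient. *)
Fixpoint greedy_sum (lam : nat -> nat -> C) (nn : nat -> nat) i n : C :=
  if i is i'.+1 then
    greedy_sum lam nn i' n +
    (if (4 ^+ i')^-1 * cabs (lam i' (nn i')) / 2 <= cabs (greedy_sum lam nn i' (nn i'))
     then 0 else (4 ^+ i')^-1)%:C * lam i' n
  else 0.

(* At each step a term is either kept or dropped so that the new partial sum
   is at least half as large as that term. *)
Lemma greedy (lam : nat -> nat -> C) (nn : nat -> nat) :
  exists c : nat -> R, (forall i, 0 <= c i <= (4 ^+ i)^-1) /\
    forall i, (4 ^+ i)^-1 * cabs (lam i (nn i)) / 2 <=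
      cabs (\sum_(j < i.+1) (c j)%:C * lam j (nn i)).
Proof.
pose c i : R := if (4 ^+ i)^-1 * cabs (lam i (nn i)) / 2 <=
  cabs (greedy_sum lam nn i (nn i)) then 0 else (4 ^+ i)^-1.
have E i n : greedy_sum lam nn i n = \sum_(j < i) (c j)%:C * lam j n.
  by elim: i => [|i IH]; rewrite ?big_ord0// big_ord_recr/= IH.
have p0 (i : nat) : 0 <= (4 ^+ i)^-1 :> R by rewrite invr_ge0 exprn_ge0.
exists c; split=> i.
  by rewrite /c; case: ifP; rewrite ?lexx p0.
rewrite big_ord_recr/= -E /c; case: ifPn => [h|].
  by rewrite mul0r addr0.
rewrite -ltNge => h; set x := greedy_sum _ _ _ _ in h *.
have := cabs_dist ((4 ^+ i)^-1%:C * lam i (nn i)) (- x).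
rewrite opprK cabsN cabsM cabs_real ger0_norm// addrC.
move: (_ * cabs _) h => y h; lra.
Qed.

(** If no common bound exists, there are functions n_i whose own least bound K_i exceeds 10 i 4^i.
    The pairing of n_i with the greedy series is at least (9/20 - 1/3) K_i / 4^i, hence more than 7
    i / 6, whereas a convergent sequence of pairings is bounded. The tail is estimated with K_i
    itself, valid at all points w_j; individual bounds are assumed so that K_i is finite. *)
Lemma uniform_boundedness (F Fd : nat -> C -> C) h :
  (forall n, regular (F n) (Fd n)) ->
  (forall n, exists K, radial_bound (F n) (Fd n) K) ->
  wstar_cvg F h -> exists K, forall n, radial_bound (F n) (Fd n) K.
Proof.
move=> rF bF HF; apply: contrapT => /forallNP unb.
pose val n w : R := (1 - cabs w) * cabs (1 * F n w + w * Fd n w).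
have step i : exists x : nat * C * R, [/\ in_disc x.1.2, radial_bound (F x.1.1) (Fd x.1.1) x.2,
    9 / 10 * x.2 <= val x.1.1 x.1.2 & 10 * i%:R * 4 ^+ i < x.2].
  have := unb (10 * i%:R * 4 ^+ i) => /existsNP[n].
  rewrite /radial_bound => /existsNP[w0] /not_implyP[w01] /negP; rewrite -ltNge => big.
  have [K0 HK0] := bF n.
  pose A : set R := [set val n w | w in [set w | in_disc w]].
  have hsA : has_sup A.
    split; first by exists (val n w0), w0.
    by exists K0 => _ [w /= w1 <-]; exact: HK0.
  have A0 : val n w0 <= sup A by apply: ub_le_sup; [exact: hsA.2|exists w0].
  have pos : 0 < sup A.
    apply: lt_le_trans A0; apply: le_lt_trans big.
    by rewrite mulr_ge0 ?exprn_ge0// mulr_ge0.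
  have e0 : 0 < sup A / 10 by lra.
  have [_ [w /= w1 <-] Hw] := sup_adherent e0 hsA.
  exists (n, w, sup A); split=> //=.
  - by move=> v v1; apply: ub_le_sup; [exact: hsA.2|exists v].
  - by rewrite ltW//; apply: le_lt_trans Hw; lra.
  exact: lt_le_trans big A0.
have [x Hx] := choice step.
pose nn i := (x i).1.1; pose w i := (x i).1.2; pose K i := (x i).2.
have w1 i : in_disc (w i) by have [] := Hx i.
pose lam i n : C := (1 - cabs (w i))%:C * (1 * F n (w i) + w i * Fd n (w i)).
have [c [c4 Hc]] := greedy lam nn.
have [l [L [Hl [_ [cR cI]]]]] := HF _ (W1_test_sum c4 w1).
have [B HB] : exists B : R, forall n, cabs (l n) <= B.
  have bd (u : nat -> R) (a : R) : u n @[n --> \oo] --> a -> exists M : R, forall n, `|u n| <= M.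
    move=> /cvgP /cvg_seq_bounded[M [_ HM]]; exists (M + 1) => n.
    by apply: HM => //; lra.
  have [M1 H1] := bd _ _ cR; have [M2 H2] := bd _ _ cI.
  exists (M1 + M2) => n; apply: (le_trans (cabs_le_ReIm _)).
  by apply: lerD; [exact: H1|exact: H2].
pose i := (Num.truncn B).+1.
have [_ HK Hval Hbig] := Hx i.
have T := pairing_csum_bound i.+1 (rF (nn i)) HK c4 w1 (Hl (nn i)).
have G := Hc i.
have lamE : cabs (lam i (nn i)) = val (nn i) (w i).
  by rewrite /lam cabsM cabs_real ger0_norm// subr_ge0 ltW// w1.
rewrite lamE in G.
have := cabs_dist (\sum_(j < i.+1) (c j)%:C * lam j (nn i)) (l (nn i)).
rewrite cabs_distC; set S := \sum_(j < _) _ in T G *.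
have Bi : B < i%:R by exact: truncnS_gt.
have i0 : 0 <= i%:R :> R by [].
have := HB (nn i).
have p0 : 0 < (4 ^+ i)^-1 :> R by rewrite invr_gt0 exprn_gt0.
(* Half of the 9/10 with which w_i approaches the supremum. *)
have G' : 9 / 20 * ((4 ^+ i)^-1 * K i) <= cabs S.
  apply: le_trans G; rewrite (_ : 9 / 20 * _ = (4 ^+ i)^-1 * (9 / 10 * K i) / 2).
    by rewrite ler_wpM2r// ler_wpM2l// ltW.
  by field; rewrite expf_neq0.
(* The tail bound 4/3 taken at i + 1. *)
have T' : cabs (l (nn i) - S) <= 3^-1 * ((4 ^+ i)^-1 * K i).
  by apply: (le_trans T); rewrite exprS invfM /K le_eqVlt; apply/orP; left; apply/eqP; field; rewrite expf_neq0.
have Kb : 10 * i%:R < (4 ^+ i)^-1 * K i.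
  by rewrite [ltRHS]mulrC ltr_pdivlMr ?exprn_gt0.
move: (cabs S) (cabs (l (nn i) - S)) (cabs (l (nn i))) G' T' => s a b G' T'.
move: ((4 ^+ i)^-1 * K i) Kb T' G' => y Kb T' G'; lra.
Qed.

End Pairings.

(** * The maximum principle for polynomials *)

Section MaximumPrinciple.
Context {R : realType}.
Local Notation C := R[i].
Local Notation I := (`[0, 2 * pi]%classic : set R).

Lemma bernoulli (x : R) m : 1 <= x -> 1 + m%:R * (x - 1) <= x ^+ m.
Proof.
move=> x1; elim: m => [|m IH]; first by rewrite mul0r addr0 expr0.
rewrite exprS; apply: (@le_trans _ _ (x * (1 + m%:R * (x - 1)))).
  have : 0 <= m%:R * (x - 1) * (x - 1) by rewrite !mulr_ge0// subr_ge0.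
  by rewrite -natr1; lra.
by rewrite ler_wpM2l//; lra.
Qed.

(* Cauchy's formula loses a factor depending on [z]; apply it to the powers
   of [Q] and take roots. *)
Lemma poly_max_principle (Q : {poly C}) (M : R) (z : C) : 0 < M ->
  (forall t, t \in I -> cabs Q.[eit t] <= M) -> in_disc z -> cabs Q.[z] <= M.
Proof.
move=> M0 HM z1; have z0 : 0 < 1 - cabs z by rewrite subr_gt0.
have h2 : cabs (2^-1%:C : C) = 2^-1 by rewrite cabs_real ger0_norm.
have B m : cabs Q.[z] ^+ m <= 2 * (M ^+ m / (1 - cabs z)).
  (* [cauchy_formula] is confined to radii below 1, so the unit circle is rescaled to radius 1/2. *)
  pose p := (Q ^+ m) \Po (2 *: 'X).
  have pE x : p.[x] = Q.[2 * x] ^+ m by rewrite /p horner_comp hornerZ hornerX horner_exp.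
  have two : (2 : C) * 2^-1%:C = 1.
    have -> : (2 : C) = (2 : R)%:C by rewrite rmorph_nat.
    by rewrite -rmorphM mulfV ?rmorph1// pnatr_eq0.
  have pE2 x : p.[2^-1%:C * x] = Q.[x] ^+ m by rewrite pE mulrA two mul1r.
  have ar : cabs (2^-1%:C * z) < 2^-1.
    by rewrite cabsM h2 -[ltRHS]mulr1 ltr_pM2l.
  have r1 : 2^-1 < 1 :> R by lra.
  have := cauchy_formula (regular_poly p) r1 ar.
  rewrite pE2 -cabsX => <-.
  apply: circle_int_bound.
    apply/ccont_bmeas/ccontM; last by apply: ccontM; [exact: ccont_circle|exact: ccont_kernel].
    apply: ccont_comp_cderiv (ccont_circle _) => t.
    by eexists; exact: is_cderiv_horner.
  move=> t tI; rewrite pE2 cabsM cabsX cabsM cabsV.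
  rewrite cabs_circle//; apply: ler_pM; rewrite ?exprn_ge0 ?cabs_ge0//.
  - by rewrite mulr_ge0// invr_ge0 cabs_ge0.
  - by rewrite lerXn2r ?nnegrE ?cabs_ge0 ?(ltW M0)// HM.
  have := @circle_dist R 2^-1 t (2^-1%:C * z); rewrite cabsM h2 => /(_ _) D.
  have {}D : 2^-1 * (1 - cabs z) <= cabs (2^-1%:C * eit t - 2^-1%:C * z).
    by rewrite mulrBr mulr1 D.
  apply: (@le_trans _ _ (2^-1 * (2^-1 * (1 - cabs z))^-1)).
    by rewrite ler_wpM2l// lef_pV2 ?posrE//; [apply: lt_le_trans D; rewrite mulr_gt0|rewrite mulr_gt0].
  rewrite (_ : 2^-1 / _ = (1 - cabs z)^-1)//; field.
  by rewrite gt_eqF.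
rewrite leNgt; apply/negP => big.
pose x := cabs Q.[z] / M.
have x1 : 1 < x by rewrite /x ltr_pdivlMr// mul1r.
(* Instead of m-th roots: if |Q(z)| / M were above 1, its powers would grow at least linearly by
   Bernoulli, against the fixed bound 2 / (1 - |z|). *)
have Bx m : m%:R * (x - 1) <= 2 / (1 - cabs z).
  apply: (@le_trans _ _ (x ^+ m)).
    by apply: le_trans (bernoulli m (ltW x1)); rewrite lerDr.
  rewrite /x expr_div_n ler_pdivrMr ?exprn_gt0//; apply: (le_trans (B m)).
  by rewrite mulrA mulrAC.
have y0 : 0 < x - 1 by rewrite subr_gt0.
have := Bx (Num.truncn (2 / (1 - cabs z) / (x - 1))).+1.
rewrite leNgt => /negP; apply; rewrite -ltr_pdivrMr//; exact: truncnS_gt.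
Qed.

End MaximumPrinciple.

(** * The sequential limits form a linear subspace *)

Section LimitSubspace.
Context {R : realType}.
Local Notation C := R[i].
Implicit Types (F G g h : C -> C) (f : C -> C) (l m : C).

Let analytic F := forall z, in_disc z -> exists d, is_cderiv F z d.

Lemma W1_analytic g : W1 g -> analytic g.
Proof. by move=> [gd [dg _]] z z1; exists (gd z); exact: dg. Qed.

Lemma bloch_analytic h : bloch h -> analytic h.
Proof. by move=> [hd [dh _]] z z1; exists (hd z); exact: dh. Qed.

Lemma ccont_pair F g (r : R) : analytic F -> analytic g -> 0 < r < 1 ->
  ccont (fun t => F (r%:C * eit t) * conjc (g (r%:C * eit t))).
Proof.
move=> aF ag /andP[r0 r1]; apply: ccontM; last apply: ccont_conj;
  by apply: ccont_analytic => //; rewrite (ltW r0).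
Qed.

(** Analyticity makes the integrands continuous on each circle, so that [circle_int] is additive on
    them. *)
Lemma pairing_toD F G g l m : analytic F -> analytic G -> analytic g ->
  pairing_to F g l -> pairing_to G g m -> pairing_to (fun z => F z + G z) g (l + m).
Proof.
move=> aF aG ag /pairing_ccvg Hl /pairing_ccvg Hm; apply: ccvg_pairing.
apply: eq_ccvg (ccvgD Hl Hm) => r r01.
rewrite /pair -circle_intD; [|exact/ccont_bmeas/ccont_pair..].
by congr circle_int; apply/funext => t; rewrite mulrDl.
Qed.

Lemma pairing_toZ a F g l : analytic F -> analytic g ->
  pairing_to F g l -> pairing_to (fun z => a * F z) g (a * l).
Proof.
move=> aF ag /pairing_ccvg Hl; apply: ccvg_pairing.
apply: eq_ccvg (ccvgZ a Hl) => r r01.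
rewrite /pair -circle_intZ; last exact/ccont_bmeas/ccont_pair.
by congr circle_int; apply/funext => t; rewrite mulrA.
Qed.

Lemma analytic_mul_poly f (Q : {poly C}) : analytic f -> analytic (fun z => f z * Q.[z]).
Proof.
move=> af z z1; have [d Hd] := af z z1; eexists.
exact: is_cderivM Hd (is_cderiv_horner _ _).
Qed.

Lemma wstar_poly_limits0 f : wstar_poly_limits f (fun=> 0).
Proof.
have c0 r g : pair r (fun=> 0) g = 0 :> C.
  rewrite /pair -[RHS](circle_int_cst 0); congr circle_int; apply/funext => t.
  by rewrite mul0r.
split.
  exists (fun=> 0); split=> [z _|]; first exact: is_cderiv_cst.
  by exists 0 => z _; rewrite cabs0 mulr0.
exists (fun=> 0) => g _; exists (fun=> 0), 0.
have z0 : pairing_to (fun=> 0) g (0 : C).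
  apply: ccvg_pairing => e e0; apply: nearW => r.
  by rewrite c0 subrr cabs0 ltW.
split=> [n|]; last by split=> //; split; exact: cvg_cst.
by rewrite (_ : (fun z => _) = fun=> 0)//; apply/funext => z; rewrite horner0 mulr0.
Qed.

Lemma wstar_poly_limitsD f h1 h2 : analytic f -> wstar_poly_limits f h1 ->
  wstar_poly_limits f h2 -> wstar_poly_limits f (fun z => h1 z + h2 z).
Proof.
move=> af [b1 [Q1 H1]] [b2 [Q2 H2]].
have a1 := bloch_analytic b1; have a2 := bloch_analytic b2; split.
  case: b1 => d1 [D1 [M1 B1]]; case: b2 => d2 [D2 [M2 B2]].
  exists (fun z => d1 z + d2 z); split=> [z z1|].
    by apply: is_cderivD; [exact: D1|exact: D2].
  exists (M1 + M2) => z z1; apply: le_trans (lerD (B1 z z1) (B2 z z1)).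
  by rewrite -mulrDr ler_wpM2l ?cabsD// subr_ge0 ltW.
exists (fun n => Q1 n + Q2 n) => g Wg; have ag := W1_analytic Wg.
have [l1 [L1 [P1 [p1 [c1 c1']]]]] := H1 g Wg.
have [l2 [L2 [P2 [p2 [c2 c2']]]]] := H2 g Wg.
exists (fun n => l1 n + l2 n), (L1 + L2); split=> [n|].
  rewrite (_ : (fun z => _) = fun z => f z * (Q1 n).[z] + f z * (Q2 n).[z]); last first.
    by apply/funext => z; rewrite hornerD mulrDr.
  by apply: pairing_toD => //; exact: analytic_mul_poly.
split; first exact: pairing_toD.
rewrite Re_funD Im_funD cReD cImD; split; exact: cvgD.
Qed.

Lemma wstar_poly_limitsZ f (a : C) h : analytic f -> wstar_poly_limits f h ->
  wstar_poly_limits f (fun z => a * h z).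
Proof.
move=> af [b1 [Q1 H1]]; have a1 := bloch_analytic b1; split.
  case: b1 => d1 [D1 [M1 B1]].
  exists (fun z => a * d1 z); split=> [z z1|].
    by apply: is_cderiv_scale; exact: D1.
  exists (cabs a * M1) => z z1; rewrite cabsM mulrCA ler_wpM2l ?cabs_ge0//.
  exact: B1.
exists (fun n => a *: Q1 n) => g Wg; have ag := W1_analytic Wg.
have [l1 [L1 [P1 [p1 [c1 c1']]]]] := H1 g Wg.
exists (fun n => a * l1 n), (a * L1); split=> [n|].
  rewrite (_ : (fun z => _) = fun z => a * (f z * (Q1 n).[z])); last first.
    by apply/funext => z; rewrite hornerZ mulrCA.
  by apply: pairing_toZ => //; exact: analytic_mul_poly.
split; first exact: pairing_toZ.
rewrite Re_funM Im_funM cReM cImM; split.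
  by apply: cvgB; apply: cvgM => //; exact: cvg_cst.
by apply: cvgD; apply: cvgM => //; exact: cvg_cst.
Qed.

End LimitSubspace.

(** * The outer function exp S and boundedness of the limits *)

Section OscillatingOuterFunction.
Context {R : realType}.
Local Notation C := R[i].
Local Notation I := (`[0, 2 * pi]%classic : set R).
Implicit Types (z w : C).

Let u : R -> R := \1_osc_set.

Let du : density u.
Proof. exact: density_indic measurable_osc_set. Qed.

Definition osc_fun z : C := cexp (schwarz u z).

Definition osc_deriv z : C := cexp (schwarz u z) * schwarz_deriv u z.

Lemma osc_regular : regular osc_fun osc_deriv.
Proof. exact: regular_cexp (schwarz_regular du). Qed.

Lemma osc_fun_bounds z : in_disc z -> 1 <= cabs (osc_fun z) <= expR 1.
Proof.
move=> z1; rewrite /osc_fun cabs_cexp; have /andP[a b] := Re_schwarz du z1.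
by rewrite -{1}(@expR0 R) !ler_expR a.
Qed.

Lemma osc_deriv_bound z : in_disc z -> (1 - cabs z) * cabs (osc_deriv z) <= 4 * expR 1.
Proof.
move=> z1; rewrite /osc_deriv cabsM mulrCA [leRHS]mulrC.
have /andP[_ b] := osc_fun_bounds z1.
by rewrite ler_pM ?cabs_ge0 ?mulr_ge0 ?cabs_ge0 ?subr_ge0 ?(ltW z1)// schwarz_deriv_bound.
Qed.

Lemma osc_outer : outer osc_fun.
Proof.
exists 1, u; split; first exact: cabs1.
split; last by move=> z _; rewrite mul1r.
have [mu_ u01] := du; apply: (@bounded_integrable _ u mu_).
by exists 1 => t _; have /andP[a b] := u01 t; rewrite ger0_norm.
Qed.

Lemma osc_bloch : bloch osc_fun.
Proof.
have [dF _ _] := osc_regular; exists osc_deriv; split=> //.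
by exists (4 * expR 1) => z; exact: osc_deriv_bound.
Qed.

Lemma osc_inv_Hinf : Hinf (fun z => (osc_fun z)^-1).
Proof.
have E : (fun z => (osc_fun z)^-1) = fun z => cexp (-1 * schwarz u z).
  by apply/funext => z; rewrite mulN1r cexpN.
split.
  move=> z z1; rewrite E; eexists; apply: is_cderiv_comp (is_cderiv_cexp _).
  by apply: is_cderiv_scale; exact: schwarz_cderiv.
exists 1 => z z1; rewrite cabsV; have /andP[a _] := osc_fun_bounds z1.
by rewrite invf_le1// (lt_le_trans ltr01).
Qed.

Lemma osc_index (q : rat) (e : R) : 0 < (ratr q : R) < 2 * pi -> 0 < e ->
  exists k, [/\ @arc_center R k = ratr q, @height R k <= e,
    0 <= @arc_center R k - arc_len k & @arc_center R k + arc_len k <= 2 * @pi R].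
Proof.
move=> /andP[q0 q2] e0.
pose m := Num.min e (Num.min (ratr q) (2 * pi - ratr q)).
have m0 : 0 < m by rewrite !lt_min e0 q0 subr_gt0.
have [K HK] : exists K : nat, 1 / 2 ^+ K <= m.
  exists (Num.truncn m^-1).+1; rewrite mul1r -[leRHS]invrK lef_pV2 ?posrE ?exprn_gt0 ?invr_gt0//.
  by apply: (le_trans (ltW (truncnS_gt _))); rewrite -natrX ler_nat ltnW// ltn_expl.
have [k Kk ck] := @arc_center_recurs R q K; exists k.
have ak : @arc_len R k <= m.
  apply: le_trans HK; apply: (le_trans (@arc_len_halves R 0 k)).
  by rewrite /= !mul1r lef_pV2 ?posrE ?exprn_gt0// ler_eXn2l//; lra.
have m1 : m <= e by rewrite ge_min lexx.
have m2 : m <= ratr q by rewrite !ge_min lexx orbT.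
have m3 : m <= 2 * pi - ratr q by rewrite !ge_min lexx !orbT.
have [h0 h1 _] := @height_bounds R k; have /andP[a0 _] := @arc_len_bounds R k.
rewrite osc_epsE in h1; split=> //; rewrite ?ck; lra.
Qed.

(* Near the boundary a polynomial is locally constant at the scale where
   [osc_fun] still oscillates, so the oscillation controls its size. *)
Lemma radial_bound_circle (Q : {poly C}) (K : R) (t : R) :
  radial_bound (fun z => osc_fun z * Q.[z])
    (fun z => osc_deriv z * Q.[z] + osc_fun z * (Q^`()).[z]) K ->
  t \in I -> cabs Q.[eit t] <= 16 * K + 1.
Proof.
move=> HK /set_mem; rewrite /= in_itv/= => /andP[t0 t2].
have [M1 HM1] := horner_bounded Q 1; have [M2 HM2] := horner_bounded Q^`() 1.
(* Bounds, up to the factor 16, the terms of (z f Q)' that do not contain f'. They are multiplied by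
   the height and vanish with it for fixed Q; the final 1 makes [N] positive. *)
pose N := 16 * (expR 1 * (`|M1| + `|M2|)) + 1.
have e10 := @expR_gt0 R 1.
have N0 : 0 < N.
  have : 0 <= expR 1 * (`|M1| + `|M2|) by rewrite mulr_ge0 ?(ltW e10)// addr_ge0.
  rewrite /N; lra.
have at_point k : 0 <= @arc_center R k - arc_len k -> @arc_center R k + arc_len k <= 2 * pi ->
    cabs Q.[osc_point k] <= 16 * K + N * height k.
  move=> c0 c2.
  move: (osc_point k) (@osc_point_disc R k) (schwarz_deriv_osc c0 c2) (@osc_point_abs R k).
  move=> w w1 osc wE; have := HK _ w1.
  rewrite wE (_ : 1 - (1 - height k) = height k) in osc *; last by ring.
  have [h0 h1 _] := @height_bounds R k; have /andP[a0 a1] := @arc_len_bounds R k.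
  rewrite osc_epsE in h1.
  have /andP[f1 f2] := osc_fun_bounds w1.
  have Q1 : cabs Q.[w] <= `|M1|.
    by apply: le_trans (ler_norm _); apply: HM1; exact: ltW.
  have Q2 : cabs Q^`().[w] <= `|M2|.
    by apply: le_trans (ler_norm _); apply: HM2; exact: ltW.
  have wa : 2^-1 <= cabs w by rewrite wE; lra.
  have oE : cabs (osc_deriv w) = cabs (osc_fun w) * cabs (schwarz_deriv u w).
    by rewrite /osc_deriv cabsM.
  (* 1/16 is the product of the lower bounds 1/2 for |w|, 1 for |f| and 1/8 from
     [schwarz_deriv_osc]. *)
  have A1 : 16^-1 * cabs Q.[w] <= height k * cabs (w * (osc_deriv w * Q.[w])).
    rewrite cabsM [cabs (osc_deriv w * _)]cabsM oE.
    apply: (@le_trans _ _ (2^-1 * (1 * 8^-1) * cabs Q.[w])).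
      by rewrite ler_wpM2r ?cabs_ge0//; lra.
    rewrite [leRHS](_ : _ = cabs w * (cabs (osc_fun w) *
      (height k * cabs (schwarz_deriv u w))) * cabs Q.[w]); last first.
      by ring.
    rewrite ler_wpM2r ?cabs_ge0// ler_pM// ?mulr_ge0 ?invr_ge0//.
    by rewrite ler_pM// invr_ge0.
  have A2 : cabs (1 * (osc_fun w * Q.[w]) + w * (osc_fun w * (Q^`()).[w])) <=
      expR 1 * (`|M1| + `|M2|).
    apply: (le_trans (cabsD _ _)); rewrite mul1r mulrDr lerD//.
      by rewrite cabsM ler_pM ?cabs_ge0.
    rewrite cabsM [cabs (osc_fun w * _)]cabsM -[leRHS]mul1r ler_pM ?mulr_ge0 ?cabs_ge0 ?(ltW w1)//.
    by rewrite ler_pM ?cabs_ge0.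
  have A3 := cabs_dist (w * (osc_deriv w * Q.[w]))
    (- (1 * (osc_fun w * Q.[w]) + w * (osc_fun w * (Q^`()).[w]))).
  rewrite cabsN opprK in A3.
  rewrite (_ : 1 * _ + w * _ = w * (osc_deriv w * Q.[w]) +
     (1 * (osc_fun w * Q.[w]) + w * (osc_fun w * (Q^`()).[w]))); last by ring.
  move: (cabs (_ + _)) A3 => X A3 HX.
  move: (cabs (1 * _ + _)) A2 A3 => Y A2 A3.
  have B1 : height k * (cabs (w * (osc_deriv w * Q.[w])) - Y) <= height k * X.
    by rewrite ler_wpM2l// ltW.
  have B2 : height k * Y <= height k * (expR 1 * (`|M1| + `|M2|)).
    by rewrite ler_wpM2l// ltW.
  rewrite /N; move: (expR 1 * _) B2 => Z B2.
  lra.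
(* An arc centered at q with small enough height makes both the [N] term and the change of Q from
   the point to the circle at most e / 2. *)
have at_rat (q : rat) (e : R) : 0 < (ratr q : R) < 2 * pi -> 0 < e ->
    cabs Q.[eit (ratr q)] <= 16 * K + e.
  move=> q02 e0; have e2 : 0 < e / 2 by lra.
  have [del del0 Hd] := is_cderiv_continuous (is_cderiv_horner Q (eit (ratr q))) e2.
  have eN : 0 < Num.min (del / 2) (e / 2 / N) by rewrite lt_min !divr_gt0.
  have [k [ck hk c0 c2]] := osc_index q02 eN.
  have := at_point k c0 c2.
  have [h0 _ _] := @height_bounds R k.
  have E : @osc_point R k = eit (ratr q) + - ((height k)%:C * eit (ratr q)).
    by rewrite /osc_point ck rmorphB rmorph1 mulrBl mul1r.
  have hd : cabs (- ((height k)%:C * eit (ratr q)) : C) < del.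
    rewrite cabsN cabs_circle; last exact: ltW.
    have : Num.min (del / 2) (e / 2 / N) <= del / 2 by rewrite ge_min lexx.
    lra.
  have := Hd _ hd; rewrite -E => D1 D2.
  have D3 := cabs_dist Q.[eit (ratr q)] Q.[osc_point k]; rewrite cabs_distC in D3.
  have D4 : N * height k <= e / 2.
    rewrite mulrC -ler_pdivlMr//; apply: (le_trans hk).
    by rewrite ge_min lexx orbT.
  lra.
have half0 : 0 < 2^-1 :> R by lra.
have cQ : ccont (fun s => Q.[eit s]).
  by apply: ccont_comp_cderiv ccont_eit => s; eexists; exact: is_cderiv_horner.
move/ccontP : cQ => /(_ t _ half0)[del del0 Hd].
have p2 := @twopi_gt0 R.
(* The rational is taken strictly inside (0, 2 pi), also when t is an end point, since [at_rat]
   needs arcs that fit in the interval. The 1 in the conclusion is 1/2 from [at_rat] plus 1/2 from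
   continuity. *)
have lt : Num.max 0 (t - del) < Num.min (2 * pi) (t + del).
  by rewrite lt_min !gt_max p2 /=; apply/and3P; split; lra.
have [q] := rat_in_itvoo lt.
rewrite in_itv/= gt_max lt_min => /andP[/andP[q0 q1] /andP[q2 q3]].
have q02 : 0 < (ratr q : R) < 2 * pi by rewrite q0.
have := at_rat q _ q02 half0.
have tq : `|t - ratr q| < del by rewrite ltr_norml; apply/andP; split; lra.
have := Hd _ tq; have := cabs_dist Q.[eit t] Q.[eit (ratr q)]; lra.
Qed.

(** [regular h hd] is what identifies the pairing of h with a Cauchy kernel as a value of h; then
    h(z) is within 1 of some f(z) Q_n(z). *)
Lemma osc_limit_bounded (h hd : C -> C) : regular h hd ->
  wstar_poly_limits osc_fun h -> exists M : R, forall z, in_disc z -> cabs (h z) <= M.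
Proof.
move=> rh [_ [Q HQ]].
have rF n := regularM osc_regular (regular_poly (Q n)).
have e10 := @expR_gt0 R 1.
(* Bounds depending on n, as required to make the suprema in [uniform_boundedness] finite. *)
have bF n : exists K, radial_bound (fun z => osc_fun z * (Q n).[z])
    (fun z => osc_deriv z * (Q n).[z] + osc_fun z * ((Q n)^`()).[z]) K.
  have [M1 HM1] := horner_bounded (Q n) 1; have [M2 HM2] := horner_bounded (Q n)^`() 1.
  exists (expR 1 * M1 + (4 * expR 1 * M1 + expR 1 * M2)) => w w1.
  have /andP[_ f2] := osc_fun_bounds w1.
  have q1 := HM1 _ (ltW w1); have q2 := HM2 _ (ltW w1).
  have w0 : 0 <= 1 - cabs w <= 1.
    by have c0 := cabs_ge0 w; rewrite /in_disc in w1; apply/andP; split; lra.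
  have /andP[w00 w01] := w0.
  have D := osc_deriv_bound w1.
  apply: (@le_trans _ _ ((1 - cabs w) * (cabs (osc_fun w * (Q n).[w]) +
     (cabs (osc_deriv w * (Q n).[w]) + cabs (osc_fun w * ((Q n)^`()).[w]))))).
    rewrite ler_wpM2l// mul1r; apply: (le_trans (cabsD _ _)); rewrite lerD2l cabsM.
    rewrite -[leRHS]mul1r ler_pM ?cabs_ge0 ?(ltW w1)//; exact: cabsD.
  have f3 : cabs (osc_fun w * (Q n).[w]) <= expR 1 * M1.
    by rewrite cabsM ler_pM ?cabs_ge0.
  have f4 : cabs (osc_fun w * ((Q n)^`()).[w]) <= expR 1 * M2.
    by rewrite cabsM ler_pM ?cabs_ge0.
  rewrite !mulrDr; apply: lerD; last apply: lerD.
  - by rewrite -[leRHS]mul1r ler_pM ?cabs_ge0.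
  - by rewrite cabsM mulrA ler_pM ?cabs_ge0 ?mulr_ge0 ?cabs_ge0.
  by rewrite -[leRHS]mul1r ler_pM ?cabs_ge0.
have [K HK] := uniform_boundedness rF bF HQ.
have K0 := radial_bound_ge0 (HK 0%N).
exists (expR 1 * (16 * K + 1) + 1) => z z1.
have [n Hn] := wstar_cvg_pointwise rF rh HQ z1 ltr01.
have Qz : cabs (Q n).[z] <= 16 * K + 1.
  apply: poly_max_principle => //; first by lra.
  by move=> t tI; exact: radial_bound_circle (HK n) tI.
have /andP[_ f2] := osc_fun_bounds z1.
have : cabs (osc_fun z * (Q n).[z]) <= expR 1 * (16 * K + 1).
  by rewrite cabsM ler_pM ?cabs_ge0.
have := cabs_dist (h z) (osc_fun z * (Q n).[z]); rewrite cabs_distC; lra.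
Qed.

End OscillatingOuterFunction.

Theorem theorem1p10 (R : realType) :
  exists f : R[i] -> R[i],
    outer f /\ bloch f /\ Hinf (fun z => (f z)^-1) /\
    (* the set S of weak-star sequential limits of f Q is a subspace of B *)
    wstar_poly_limits f (fun _ => 0) /\
    (forall h1 h2, wstar_poly_limits f h1 -> wstar_poly_limits f h2 ->
       wstar_poly_limits f (fun z => h1 z + h2 z)) /\
    (forall (a : R[i]) h, wstar_poly_limits f h ->
       wstar_poly_limits f (fun z => a * h z)) /\
    (* ... and it is proper *)
    exists h, bloch h /\ ~ wstar_poly_limits f h.
Proof.
have af := bloch_analytic (@osc_bloch R).
exists osc_fun; split; first exact: osc_outer.
split; first exact: osc_bloch.
split; first exact: osc_inv_Hinf.
split; first exact: wstar_poly_limits0.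
split; first by move=> h1 h2; exact: wstar_poly_limitsD.
split; first by move=> a h; exact: wstar_poly_limitsZ.
have dh : density (\1_(`[0, pi]%classic : set R) : R -> R).
  by apply: density_indic; exact: measurable_itv.
have rh := schwarz_regular dh; exists (schwarz \1_(`[0, pi]%classic : set R)); split.
  exists (schwarz_deriv \1_(`[0, pi]%classic : set R)); split.
    by move=> z; exact: schwarz_cderiv.
  by exists 4 => z; exact: schwarz_deriv_bound.
move=> /(osc_limit_bounded rh)[M HM].
have [z z1] := schwarz_half_unbounded M.
by rewrite ltNge HM.
Qed.
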